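(* For $z\in\operatorname{Spin}_{n+1}$ and $\epsilon>0$, let $\Gamma:(-\epsilon,\epsilon)\to\operatorname{Spin}_{n+1}$ be a locally convex curve such that $\Gamma(0)=z$. There exists $\epsilon_a\in(0,\epsilon)$ such that for all $t\in(0,\epsilon_a]$, $\Gamma(t)\in\operatorname{Bru}_{\operatorname{adv}(z)}$. There exists $\epsilon_c\in(0,\epsilon)$ such that for all $t\in[-\epsilon_c,0)$, $\Gamma(t)\in\operatorname{Bru}_{\operatorname{chop}(z)}$.
   Context: Fix an integer $n\ge2$. $S_{n+1}$ is the group of permutations of $\{1,\ldots,n+1\}$ acting on the right, $(\sigma,k)\mapsto k^\sigma$, so $k^{\sigma_1\sigma_2}=(k^{\sigma_1})^{\sigma_2}$; it is generated by $a_j=(j,j+1)$, $1\le j\le n$. $\operatorname{inv}(\sigma)$ is the number of pairs $i<j$ with $i^\sigma>j^\sigma$; a reduced word for $\sigma$ is an expression $\sigma=a_{i_1}\cdots a_{i_k}$ with $k=\operatorname{inv}(\sigma)$. $\eta\in S_{n+1}$ is the permutation $j^\eta=n+2-j$. $\Pi:\operatorname{Spin}_{n+1}\to\operatorname{SO}_{n+1}$ is the universal (double) covering homomorphism. Let $\mathfrak a_j\in\mathfrak{so}_{n+1}$ have nonzero entries only $(\mathfrak a_j)_{j+1,j}=1$, $(\mathfrak a_j)_{j,j+1}=-1$. Identifying the Lie algebra of $\operatorname{Spin}_{n+1}$ with $\mathfrak{so}_{n+1}$ via $\Pi$, let $\alpha_j(\theta)=\exp(\theta\mathfrak a_j)\in\operatorname{Spin}_{n+1}$,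 $\acute a_j=\alpha_j(\pi/2)$, $\grave a_j=(\acute a_j)^{-1}$. For $\sigma\in S_{n+1}$ with reduced word $\sigma=a_{i_1}\cdots a_{i_k}$, set $\acute\sigma=\acute a_{i_1}\cdots\acute a_{i_k}$ and $\grave\sigma=\grave a_{i_1}\cdots\grave a_{i_k}$ (these do not depend on the reduced word). $\mathrm B^+_{n+1}\subset\operatorname{SO}_{n+1}$ is the group of signed permutation matrices of determinant $1$, $\operatorname{Diag}^+_{n+1}$ its subgroup of diagonal matrices; $\widetilde{\mathrm B}^+_{n+1}=\Pi^{-1}[\mathrm B^+_{n+1}]$, $\operatorname{Quat}_{n+1}=\Pi^{-1}[\operatorname{Diag}^+_{n+1}]$. For $z_0\in\widetilde{\mathrm B}^+_{n+1}$ with $P=\Pi(z_0)$, $\sigma_{z_0}\in S_{n+1}$ is defined by $e_j^\top P=\pm e_{j^{\sigma_{z_0}}}^\top$ for all $j$. $\operatorname{Up}^+_{n+1}$ is the group of real upper triangular $(n+1)\times(n+1)$ matrices with strictly positive diagonal entries. For $z_0\in\widetilde{\mathrm B}^+_{n+1}$ with $P=\Pi(z_0)$, the signed Bruhat cell $\operatorname{Bru}_{z_0}\subset\operatorname{Spin}_{n+1}$ is the connected component containing $z_0$ of $\Pi^{-1}\big[(\operatorname{Up}^+_{n+1}P\operatorname{Up}^+_{n+1})\cap\operatorname{SO}_{n+1}\big]$. The cells $\operatorname{Bru}_{z_0}$, $z_0\in\widetilde{\mathrm B}^+_{n+1}$, partition $\operatorname{Spin}_{n+1}$. The maps $\operatorname{adv},\operatorname{chop}:\operatorname{Spin}_{n+1}\to\acute\eta\operatorname{Quat}_{n+1}\subset\widetilde{\mathrm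 B}^+_{n+1}$: given $z\in\operatorname{Spin}_{n+1}$, let $z_0\in\widetilde{\mathrm B}^+_{n+1}$ be the unique element with $z\in\operatorname{Bru}_{z_0}$, let $\sigma_0=\sigma_{z_0}$, and write $z_0=q_a\acute\sigma_0=q_c\grave\sigma_0$ with $q_a,q_c\in\operatorname{Quat}_{n+1}$; then $\operatorname{adv}(z)=q_a\acute\eta$ and $\operatorname{chop}(z)=q_c\grave\eta$. A map $\Gamma:J\to\operatorname{Spin}_{n+1}$ on an interval $J\subseteq\mathbb R$ is a locally convex curve if it is absolutely continuous and, wherever its derivative is defined, $(\Gamma(t))^{-1}\Gamma'(t)=\sum_{j=1}^n\kappa_j(t)\mathfrak a_j$ with $\kappa_j(t)>0$ for all $j$. *)

(* Defs.v *)
From HB Require Import structures.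
From mathcomp Require Import all_boot all_order all_algebra all_fingroup.
From mathcomp Require Import all_classical all_reals all_analysis.
From mathcomp Require Import ring.
Import Order.TTheory GRing.Theory Num.Theory.
Import numFieldNormedType.Exports.

Set Implicit Arguments.
Unset Strict Implicit.
Unset Printing Implicit Defensive.

Local Open Scope classical_set_scope.
Local Open Scope ring_scope.

(* Indices are 0-based: the index j of the usual 1-based notation is j - 1    *)
(* here, both for 'I_n.+1 (coordinates, permuted points) and for 'I_n         *)
(* (generators a_j of the symmetric group, Lie algebra elements).             *)

(* The Clifford algebra Cl_m, with e_i ^ 2 = -1 and e_i e_j = - e_j e_i, is   *)
(* realized faithfully as the algebra generated by the matrices of the left   *)
(* multiplications by the e_i on Cl_m itself, in the basis of the ordered     *)
(* monomials e_B (B a subset of 'I_m).  Moving e_i into place in e_i * e_B    *)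
(* costs one sign per k in B with k < i, and one more if i is already in B.   *)
Notation Clifford R m := 'M[R]_#|{set 'I_m}|.

Section Spin.
Variables (R : realType) (m : nat).
Implicit Types (z : Clifford R m) (P : 'M[R]_m) (v : 'rV[R]_m).

Definition gamma (i : 'I_m) : Clifford R m :=
  \matrix_(a, b)
    let A : {set 'I_m} := enum_val a in let B : {set 'I_m} := enum_val b in
    if A == (if i \in B then B :\ i else i |: B)
    then (-1) ^+ #|[pred k in B | (k <= i)%N]| else 0.

Definition cl_vec v : Clifford R m := \sum_i v 0 i *: gamma i.

Definition Spin : set (Clifford R m) :=
  [set z | exists vs : seq 'rV[R]_m,
     [/\ ~~ odd (size vs),
         forall v, v \in vs -> \sum_i v 0 i ^+ 2 = 1
       & z = \prod_(v <- vs) cl_vec v]].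

Definition SO : set 'M[R]_m :=
  [set P : 'M[R]_m | P *m P^T = 1%:M /\ \det P = 1].

(* The covering map Spin_m -> SO_m: the matrix of v |-> z v z^-1.             *)
Definition Pi z : 'M[R]_m :=
  xget 0 [set P : 'M[R]_m | forall j,
    z *m gamma j *m invmx z = \sum_i P i j *: gamma i].

(* The inverse of the isomorphism from the Lie algebra of Spin_m (spanned by  *)
(* the e_i e_k, i < k) to so_m obtained by differentiating Pi at 1, namely    *)
(* the one sending x to the matrix of v |-> x v - v x; see spin_lieP.         *)
Definition spin_lie (X : 'M[R]_m) : Clifford R m :=
  4^-1 *: \sum_i \sum_k X k i *: (gamma i *m gamma k).

Definition cl_exp (x : Clifford R m) : Clifford R m :=
  lim (series (fun k => (k`!%:R : R)^-1 *: x ^+ k) @ \oo).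

Let tog (i : 'I_m) (B : {set 'I_m}) :=
  if i \in B then B :\ i else i |: B.
Let low (i : 'I_m) (B : {set 'I_m}) :=
  finset (fun k : 'I_m => (k \in B) && (k <= i)%N).
Let sg (i : 'I_m) (B : {set 'I_m}) : R := (-1) ^+ #|low i B|.

Let in_tog (i : 'I_m) (B : {set 'I_m}) x :
  (x \in tog i B) = (x == i) (+) (x \in B).
Proof.
rewrite /tog; case: ifP => iB; rewrite !inE; case: (eqVneq x i) => [->|] //=;
  by rewrite iB.
Qed.

Let sg_tog (i k : 'I_m) (B : {set 'I_m}) :
  sg i (tog k B) = (-1) ^+ (k <= i)%N * sg i B.
Proof.
rewrite /sg (cardsD1 k) [in RHS](cardsD1 k).
have -> : low i (tog k B) :\ k = low i B :\ k.
  by apply/setP => x; rewrite !inE in_tog; case: eqVneq.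
rewrite !exprD !inE in_tog eqxx /= mulrA; congr (_ * _).
by case: (k \in B); case: (k <= i)%N; rewrite /= ?expr0 ?expr1 ?mulr1;
  rewrite ?mulrNN ?mulr1.
Qed.

Let tog_comm (i k : 'I_m) (B : {set 'I_m}) : tog i (tog k B) = tog k (tog i B).
Proof. by apply/setP => x; rewrite !in_tog addbCA. Qed.

Let togK (i : 'I_m) (B : {set 'I_m}) : tog i (tog i B) = B.
Proof. by apply/setP => x; rewrite !in_tog addKb. Qed.

Let gamE i a b : gamma i a b =
  if enum_val a == tog i (enum_val b) then sg i (enum_val b) else 0.
Proof.
rewrite mxE -/(tog _ _) /sg; congr (if _ then _ ^+ _ else _).
by apply: eq_card => x; rewrite !inE.
Qed.

Let gam_mul i k a b : (gamma i *m gamma k) a b =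
  if enum_val a == tog i (tog k (enum_val b))
  then sg i (tog k (enum_val b)) * sg k (enum_val b) else 0.
Proof.
rewrite mxE (bigD1 (enum_rank (tog k (enum_val b)))) //= !gamE enum_rankK eqxx.
rewrite big1 ?addr0 => [|c nc]; first by case: ifP; rewrite ?mul0r.
rewrite !gamE [enum_val c == _]negbTE ?mulr0 //.
by apply: contra nc => /eqP <-; rewrite enum_valK.
Qed.

Lemma gamma_clifford (i k : 'I_m) : gamma i *m gamma k + gamma k *m gamma i
  = (- (i == k)%:R *+ 2)%:M.
Proof.
apply/matrixP => a b; rewrite mxE !gam_mul (tog_comm k i) !sg_tog mxE.
have sq j : sg j (enum_val b) * sg j (enum_val b) = 1.
  by rewrite -expr2 sqrr_sign.
case: (eqVneq i k) => [->|nik].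
  rewrite togK (inj_eq enum_val_inj) leqnn.
  case: eqP => _ /=; last by rewrite addr0.
  by rewrite -!mulrA sq !mulr1 expr1 mulr2n.
rewrite /= oppr0 mul0rn mul0rn; case: ifP => _; rewrite ?addr0 //.
rewrite (mulrC _ (sg k _)) -!mulrA [(-1)^+ (i <= k)%N * _]mulrC !mulrA.
have -> : (-1) ^+ (k <= i)%N = - (-1) ^+ (i <= k)%N :> R.
  case: (ltngtP i k) => [||/val_inj]; rewrite /= ?expr0 ?expr1 ?opprK // => e.
  by rewrite e eqxx in nik.
by ring.
Qed.

Lemma spin_lieP (X : 'M[R]_m) (k : 'I_m) : X^T = - X ->
  spin_lie X *m gamma k - gamma k *m spin_lie X = \sum_i X i k *: gamma i.
Proof.
move=> skX.
have sk i j : X i j = - X j i by have /matrixP/(_ j i) := skX; rewrite !mxE.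
have C i j : gamma i *m gamma j = (- (i == j)%:R *+ 2)%:M - gamma j *m gamma i.
  by rewrite -gamma_clifford addrK.
have step i j : gamma i *m gamma j *m gamma k - gamma k *m (gamma i *m gamma j)
  = (k == i)%:R *+ 2 *: gamma j - (k == j)%:R *+ 2 *: gamma i.
  rewrite -mulmxA (C j k) mulmxBr (mulmxA (gamma i) (gamma k)) (C i k).
  rewrite mulmxBl mul_mx_scalar mul_scalar_mx -(mulmxA (gamma k)).
  rewrite [j == k]eq_sym [i == k]eq_sym !mulNrn !scaleNr.
  by rewrite opprB opprK -[LHS]addrA [X in _ + X]addrAC subrr add0r addrC.
rewrite /spin_lie -scalemxAl -scalemxAr -scalerBr mulmx_suml mulmx_sumr -sumrB.
under eq_bigr => i _.
  rewrite mulmx_suml mulmx_sumr -sumrB.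
  under eq_bigr => j _ do rewrite -scalemxAl -scalemxAr -scalerBr step scalerBr
    !scalerA.
  rewrite sumrB.
  rewrite [X in _ - X](bigD1 k) //= [X in _ - (_ + X)]big1; last first.
    by move=> j; rewrite eq_sym => /negbTE ->; rewrite mul0rn mulr0 scale0r.
  rewrite eqxx addr0.
  over.
rewrite sumrB exchange_big /=.
rewrite [X in _ *: (X - _)](_ : _ = \sum_i (X i k * 2) *: gamma i); last first.
  apply: eq_bigr => j _; rewrite (bigD1 k) //= eqxx big1 ?addr0 // => i.
  by rewrite eq_sym => /negbTE ->; rewrite mul0rn mulr0 scale0r.
rewrite -sumrB scaler_sumr; apply: eq_bigr => i _.
rewrite -scalerBl scalerA (sk k i).
have -> : 4^-1 * (X i k * 2 - - X i k * 2) = X i k by field.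
by [].
Qed.

End Spin.

Section Perm.
Variable n : nat.
Implicit Types (s : 'S_n.+1) (w : seq 'I_n).

Definition gen (j : 'I_n) : 'S_n.+1 :=
  tperm (widen_ord (leqnSn n) j) (lift ord0 j).

Definition inversions s : nat :=
  #|[pred p : 'I_n.+1 * 'I_n.+1 | (p.1 < p.2)%N && (s p.2 < s p.1)%N]|.

Definition reduced_word s w : Prop :=
  s = (\prod_(j <- w) gen j)%g /\ size w = inversions s.

Definition some_reduced_word s : seq 'I_n := xget [::] (reduced_word s).

Definition eta : 'S_n.+1 := perm (@rev_ord_inj n.+1).

End Perm.

Section Bruhat.
Variables (R : realType) (n : nat).
Implicit Types (z : Clifford R n.+1) (P : 'M[R]_n.+1) (s : 'S_n.+1).

Definition so_basis (j : 'I_n) : 'M[R]_n.+1 :=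
  delta_mx (lift ord0 j) (widen_ord (leqnSn n) j)
  - delta_mx (widen_ord (leqnSn n) j) (lift ord0 j).

Definition alpha (j : 'I_n) (theta : R) : Clifford R n.+1 :=
  cl_exp (theta *: spin_lie (so_basis j)).

Definition acute_gen (j : 'I_n) : Clifford R n.+1 := alpha j (pi / 2).
Definition grave_gen (j : 'I_n) : Clifford R n.+1 := invmx (acute_gen j).

(* These do not depend on the choice of the reduced word.                     *)
Definition acute s : Clifford R n.+1 :=
  \prod_(j <- some_reduced_word s) acute_gen j.
Definition grave s : Clifford R n.+1 :=
  \prod_(j <- some_reduced_word s) grave_gen j.

Definition sgnperm P s : Prop :=
  forall j, row j P = delta_mx 0 (s j) \/ row j P = - delta_mx 0 (s j).

Definition Bplus : set 'M[R]_n.+1 :=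
  [set P : 'M[R]_n.+1 | (exists s, sgnperm P s) /\ \det P = 1].

Definition Diagplus : set 'M[R]_n.+1 :=
  [set P : 'M[R]_n.+1 | Bplus P /\ is_diag_mx P].

Definition tBplus : set (Clifford R n.+1) :=
  @Spin R n.+1 `&` @Pi R n.+1 @^-1` Bplus.

Definition Quat : set (Clifford R n.+1) :=
  @Spin R n.+1 `&` @Pi R n.+1 @^-1` Diagplus.

Definition sigma_of z : 'S_n.+1 :=
  xget 1%g [set s : 'S_n.+1 | sgnperm (Pi z) s].

Definition Upplus : set 'M[R]_n.+1 :=
  [set U : 'M[R]_n.+1 | (forall i j : 'I_n.+1, (j < i)%N -> U i j = 0) /\
           (forall i, 0 < U i i)].

Definition Bru (z0 : Clifford R n.+1) : set (Clifford R n.+1) :=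
  connected_component
    (@Spin R n.+1 `&` @Pi R n.+1 @^-1`
       (@SO R n.+1 `&`
        [set Q : 'M[R]_n.+1 | exists U1 U2,
           [/\ Upplus U1, Upplus U2 & Q = U1 *m Pi z0 *m U2]]))
    z0.

(* The signed Bruhat cells partition Spin_{n+1}: this is the unique z0 in     *)
(* tBplus with z in Bru z0.                                                   *)
Definition cell_of z : Clifford R n.+1 :=
  xget 0 [set z0 : Clifford R n.+1 | tBplus z0 /\ Bru z0 z].

Definition adv z : Clifford R n.+1 :=
  let z0 := cell_of z in
  let qa := xget 0
    [set q : Clifford R n.+1 | Quat q /\ z0 = q *m acute (sigma_of z0)] in
  qa *m acute (eta n).

Definition chop z : Clifford R n.+1 :=
  let z0 := cell_of z in
  let qc := xget 0
    [set q : Clifford R n.+1 | Quat q /\ z0 = q *m grave (sigma_of z0)] in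
  qc *m grave (eta n).

End Bruhat.

Section Curves.
Variables (R : realType) (n : nat).

Definition abs_continuous (V : normedModType R) (a b : R) (f : R -> V) : Prop :=
  forall e : R, 0 < e -> exists2 d : R, 0 < d &
    forall (N : nat) (l r : 'I_N -> R),
      (forall i, [/\ a < l i, l i <= r i & r i < b]) ->
      trivIset setT (fun i => `]l i, r i[%classic) ->
      \sum_i (r i - l i) < d ->
      \sum_i `|f (r i) - f (l i)| < e.

(* Curves on the open interval `]a, b[, valued in Spin_{n+1} seen as a        *)
(* compact submanifold of the normed space Cl_{n+1}; the values of Gam        *)
(* outside the interval are irrelevant.                                       *)
Definition locally_convex_curve (a b : R) (Gam : R -> Clifford R n.+1) : Prop :=
  [/\ forall t, a < t < b -> Spin (Gam t),
      abs_continuous a b Gam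
    & forall t, a < t < b -> derivable Gam t 1 ->
        exists2 kappa : 'I_n -> R, (forall j, 0 < kappa j) &
          invmx (Gam t) *m derive1 Gam t
          = \sum_j kappa j *: spin_lie (so_basis R j)].

End Curves.

(* Main.v *)
From HB Require Import structures.
Require Import Defs.
From mathcomp Require Import all_boot all_order all_algebra all_fingroup.
From mathcomp Require Import all_classical all_reals all_analysis.
From mathcomp Require Import measurable_realfun.
From mathcomp Require Import ring lra zify.
Import Order.TTheory GRing.Theory Num.Theory.
Import numFieldNormedType.Exports.

Set Implicit Arguments.
Unset Strict Implicit.
Unset Printing Implicit Defensive.

Local Open Scope classical_set_scope.
Local Open Scope ring_scope.

(** Write m = n+1, D = Pi q, and let the cell of z be that of z0 = q w', where
    w' is the product of the acute generators along a reduced word w.  The idea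
    is to detect the open cell entered by the curve with total positivity.

    A matrix with nonzero southwest minors (last k rows, first k columns) is
    determined, up to left and right multiplication by upper triangular
    matrices with positive diagonal, by the signs of these minors
    [same_sw_double_coset].  So the open cells over a sign pattern e form the
    open set of the z in Spin with the minors of Pi z signed by e, and it
    remains to find the pattern and the connected component.

    Sign pattern.  In the factorization Pi z = U (D Q) V with Q = Pi w', the
    matrix V Pi (z^T Gam t) has a lower triangular factor L(t) with L' = L B,
    where B is positive on the subdiagonal and zero elsewhere: this is what
    local convexity says [curve_der_Pi, flow_lowf].  The minors of L that
    are not zero for every lower triangular matrix then satisfy differential
    inequalities which force them to be positive for t > 0 [flow_tpos]; since the curve is only absolutely continuous, this uses
    that an absolutely continuous function is the integral of its derivative
    [AC_FTC].  On the other side, rotating the columns of Q along a reduced word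
    keeps the minors of Q on its last rows nonnegative [bottom_nonneg_rot]. By
    the Cauchy-Binet formula the southwest minors of D Q L(t) have the signs of
    products of diagonal entries of D, and D times the image of the acute lift of
    eta has the same ones.

    Component.  Let tau s be the lift to Spin of the orthogonal factor of
    lam s = exp (s N), N having ones below the diagonal, so that lam s is totally
    positive for s > 0.  For y in a cell and small s > 0 the point y tau s lies
    in an open cell, and its component does not change when y moves in the cell:
    the southwest minors of Pi y lam s have a term of lowest degree in s whose
    degree and sign depend only on the cell [coef_double_coset,
    germ_locally_constant].  At y = z0 the component is that of q times the acute
    lift of eta: run through the letters of w backwards from z0 to q and through those of
    a reduced word of eta from q on; all these points, multiplied by tau s, keep
    the same signs [word_path, germ_word].  By connectedness it is the same at
    y = z [germ_Bru], and Gam t tau s stays in the open cells for all small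
    t, s >= 0 not both zero, which connects z tau s to Gam t [curve_open_cell].

    The statement on chop follows by time reversal: the automorphism of the
    Clifford algebra with e_i |-> (-1)^i e_i exchanges acute and grave
    generators, and maps the reversed curve to a locally convex one
    [alt_curve]. *)

(** * Absolutely continuous functions *)

Section AC.
Variable R : realType.
Implicit Types (f : R -> R).

(** Absolute continuity on the whole line: total variations and Stieltjes
    measures then need no domain, and a function on an interval is brought here
    by clamping its argument. *)
Definition gAC f : Prop :=
  forall e : R, 0 < e -> exists2 d : R, 0 < d &
    forall (N : nat) (l r : 'I_N -> R),
      (forall i, l i <= r i) ->
      trivIset setT (fun i => `]l i, r i[%classic) ->
      \sum_i (r i - l i) < d -> \sum_i `|f (r i) - f (l i)| < e.

Lemma gAC_fin f e : gAC f -> 0 < e -> exists2 d : R, 0 < d &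
    forall (T : finType) (l r : T -> R),
      (forall i, l i <= r i) ->
      trivIset setT (fun i => `]l i, r i[%classic) ->
      \sum_i (r i - l i) < d -> \sum_i `|f (r i) - f (l i)| < e.
Proof.
move=> /[apply]-[d d0 H]; exists d => // T l r lr tr.
pose h := fun i : 'I_#|T| => (enum_val i : T).
have E (F : T -> R) : \sum_i F i = \sum_(i < #|T|) F (h i).
  by rewrite (reindex h)//; apply: onW_bij; exact: enum_val_bij.
rewrite !E; apply: H => [i|]; first exact: lr.
move=> i j _ _ ij; apply: enum_val_inj; exact: (tr _ _ I I).
Qed.

Lemma gACD f g : gAC f -> gAC g -> gAC (f \+ g).
Proof.
move=> F G e e0; have e20 : 0 < e / 2 by rewrite divr_gt0.
have [d1 d10 H1] := F _ e20; have [d2 d20 H2] := G _ e20.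
exists (Num.min d1 d2); first by rewrite lt_min d10.
move=> N l r lr tr; rewrite lt_min => /andP[s1 s2].
rewrite [e]splitr; apply: le_lt_trans (ltrD (H1 _ _ _ lr tr s1) (H2 _ _ _ lr tr s2)).
rewrite -big_split /=; apply: ler_sum => i _.
by rewrite opprD addrACA ler_normD.
Qed.

Lemma itv_partition_nth_le (l r : R) s k : itv_partition l r s -> (k < size s)%N ->
  nth r (l :: s) k < nth r (l :: s) k.+1.
Proof. by move=> [ps _] ks /=; have /pathP := ps; exact. Qed.

Lemma itv_partition_nth_last (l r : R) s : itv_partition l r s ->
  nth r (l :: s) (size s) = r.
Proof. by move=> [_ /eqP {2}<-]; exact: (nth_last r (l :: s)). Qed.

Lemma itv_partition_mono (l r : R) s i j : itv_partition l r s ->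
  (i <= j <= size s)%N -> nth r (l :: s) i <= nth r (l :: s) j.
Proof.
move=> ps; elim: j => [|j IH] /andP[ij js]; first by move: ij; rewrite leqn0 => /eqP->.
move: ij; rewrite leq_eqVlt => /predU1P[->//|ij].
have /IH/le_trans : (i <= j <= size s)%N by rewrite -ltnS ij ltnW.
by apply; apply: ltW; apply: itv_partition_nth_le.
Qed.

(** The steps of all the partitions together form one disjoint family of the
    same total length, so the variations add up to a single sum to which
    absolute continuity applies. *)
Lemma gAC_variation f e : gAC f -> 0 < e -> exists2 d : R, 0 < d &
    forall (N : nat) (l r : 'I_N -> R) (s : 'I_N -> seq R),
      (forall i, itv_partition (l i) (r i) (s i)) ->
      trivIset setT (fun i => `]l i, r i[%classic) ->
      \sum_i (r i - l i) < d -> \sum_i variation (l i) (r i) f (s i) < e.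
Proof.
move=> F e0; have [d d0 H] := gAC_fin F e0; exists d => // N l r s ps tr sd.
pose T := {i : 'I_N & 'I_(size (s i))}.
pose L (p : T) := nth (r (tag p)) (l (tag p) :: s (tag p)) (tagged p).
pose U (p : T) := nth (r (tag p)) (l (tag p) :: s (tag p)) (tagged p).+1.
have E (G : R -> R -> R) :
    \sum_p G (U p) (L p) = \sum_i \sum_(k < size (s i))
      G (nth (r i) (l i :: s i) k.+1) (nth (r i) (l i :: s i) k).
  by rewrite sig_big_dep /=; apply: eq_bigr.
have EV : \sum_i variation (l i) (r i) f (s i) = \sum_p `|f (U p) - f (L p)|.
  rewrite (E (fun u v => `|f u - f v|)); apply: eq_bigr => i _.
  by rewrite /variation big_mkord.
have LU p : L p <= U p.
  by apply: ltW; apply: itv_partition_nth_le => //; case: p.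
rewrite EV; apply: H => //.
  have sub p : `]L p, U p[ `<=` `]l (tag p), r (tag p)[%classic.
    move=> x /=; rewrite !in_itv/= => /andP[x1 x2].
    have hs : (tagged p < size (s (tag p)))%N by [].
    apply/andP; split.
      by apply: le_lt_trans x1; apply: (@itv_partition_mono _ _ _ 0 _ (ps _)); rewrite /= ltnW.
    apply: lt_le_trans x2 _.
    rewrite -[leRHS](itv_partition_nth_last (ps (tag p))).
    by apply: (itv_partition_mono (ps _)); rewrite hs leqnn.
  case=> [i k] [j k'] _ _ [x [xi xj]].
  have ij : i = j.
    by apply: (tr _ _ I I); exists x; split; [exact: (sub (existT _ i k))|exact: (sub (existT _ j k'))].
  subst j; congr existT; apply/val_inj/eqP; rewrite eqn_leq /=.
  have W (a b : 'I_(size (s i))) : `]L (existT _ i a), U (existT _ i a)[%classic x ->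
      `]L (existT _ i b), U (existT _ i b)[%classic x -> (a <= b)%N.
    rewrite /= !in_itv /= => /andP[h1 h2] /andP[h3 h4]; rewrite leqNgt; apply/negP => ba.
    have : U (existT _ i b) <= L (existT _ i a).
      by apply: (itv_partition_mono (ps i)) => /=; rewrite ba ltnW.
    by rewrite leNgt (lt_trans h1 h4).
  by rewrite (W _ _ xi xj) (W _ _ xj xi).
rewrite (E (fun u v => u - v)) (le_lt_trans _ sd)//; apply: ler_sum => i _.
have := @telescope_sumr R 0 (size (s i)) (nth (r i) (l i :: s i)) (leq0n _).
rewrite big_mkord => ->; rewrite lerD2r.
by rewrite (itv_partition_nth_last (ps i)).
Qed.

(** Intervals shorter than the d of absolute continuity for e = 1 have
    variation at most 1, and finitely many of them cover [c, d]. *)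
Lemma gAC_BV f c d : gAC f -> c <= d -> bounded_variation c d f.
Proof.
move=> F cd; have [e e0 H] := gAC_variation F ltr01.
have small x y : x <= y -> y - x < e -> bounded_variation x y f.
  move=> xy yxe; exists 1 => _ [s ps <-].
  have := H 1 (fun=> x) (fun=> y) (fun=> s) (fun=> ps).
  rewrite !big_ord1 => h; apply/ltW/h => //.
  by move=> i j _ _ _; rewrite (ord1 i) (ord1 j).
have [k dk] : exists k : nat, d - c < (e / 2) *+ k.
  exists (Num.bound ((d - c) / (e / 2))).
  rewrite -mulr_natl -ltr_pdivrMr ?divr_gt0//.
  by rewrite archi_boundP// divr_ge0 ?subr_ge0// ltW// divr_gt0.
elim: k c cd dk => [|k IH] c cd; first by rewrite mulr0n ltNge subr_ge0 cd.
move=> dk; have [|lt] := ltP (d - c) e; first exact: small.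
have cm : c <= c + e / 2 by rewrite lerDl ltW// divr_gt0.
have md : c + e / 2 <= d.
  by rewrite -lerBrDl (le_trans _ lt)// ler_pdivrMr// ler_peMr ?(ltW e0)// ler1n.
apply/bounded_variationP => //; rewrite (total_variationD _ cm md) fin_numD.
apply/andP; split; apply/bounded_variationP => //; last first.
  by apply: IH => //; rewrite opprD addrA ltrBlDr -mulrSr.
apply: small => //; rewrite addrAC subrr add0r ltr_pdivrMr// ltr_pMr// ltr1n//.
Qed.

(** Partitions that nearly attain the total variations reduce this to
    partition sums. *)
Lemma gAC_TV f e : gAC f -> 0 < e -> exists2 d : R, 0 < d &
    forall (N : nat) (l r : 'I_N -> R),
      (forall i, l i <= r i) ->
      trivIset setT (fun i => `]l i, r i[%classic) ->
      \sum_i (r i - l i) < d ->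
      \sum_i fine (total_variation (l i) (r i) f) < e.
Proof.
move=> F e0; have e20 : 0 < e / 2 by rewrite divr_gt0.
have [d d0 H] := gAC_variation F e20; exists d => // N l r lr tr sd.
have eN : 0 < e / 2 / N.+1%:R by rewrite divr_gt0.
have ex i : exists s, itv_partition (l i) (r i) s /\
   fine (total_variation (l i) (r i) f) <= variation (l i) (r i) f s + e / 2 / N.+1%:R.
  have fin : total_variation (l i) (r i) f \is a fin_num.
    by apply/bounded_variationP => //; exact: gAC_BV.
  have [_ [_ [s ps <-] <-]] := ub_ereal_sup_adherent eN fin.
  move=> h; exists s; split => //.
  rewrite -lerBlDr -lee_fin EFinB fineK//; exact: ltW.
have [s ps] := choice ex.
have ps1 i := (ps i).1.
have := H _ _ _ _ ps1 tr sd => {}H.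
apply: le_lt_trans (_ : _ <= \sum_i (variation (l i) (r i) f (s i) + e / 2 / N.+1%:R)) _.
  by apply: ler_sum => i _; exact: (ps i).2.
rewrite big_split /= sumr_const card_ord [ltRHS]splitr ltr_leD//.
by rewrite -[leLHS]mulr_natr mulrAC ler_pdivrMr// ler_pM2l// ler_nat.
Qed.

Definition clamp (c d x : R) := Num.max c (Num.min x d).

Lemma clamp_le c d x y : x <= y -> clamp c d x <= clamp c d y.
Proof.
by move=> xy; rewrite /clamp /Num.max /Num.min; do ![case: ifP => /=] => *; lra.
Qed.

Lemma clamp_in c d x : c <= d -> c <= clamp c d x <= d.
Proof. by move=> cd; rewrite /clamp le_max lexx /= ge_max cd ge_min lexx orbT. Qed.

Lemma clamp_id c d x : c <= x <= d -> clamp c d x = x.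
Proof. by move=> /andP[cx xd]; rewrite /clamp (min_idPl xd) (max_idPr cx). Qed.

Lemma clamp_lip c d x y : c <= d -> x <= y -> clamp c d y - clamp c d x <= y - x.
Proof.
by rewrite /clamp /Num.max /Num.min; do ![case: ifP => /=] => *; lra.
Qed.

Lemma clamp_itv c d x y : c <= d ->
  `]clamp c d x, clamp c d y[ `<=` `]x, y[%classic.
Proof.
move=> cd z /=; rewrite !in_itv /= => /andP[].
rewrite /clamp gt_max lt_max => /andP[cz xz] /orP[cz'|]; first by move: (lt_trans cz cz'); rewrite ltxx.
rewrite lt_min => /andP[zy zd]; rewrite zy andbT.
by move: xz; rewrite gt_min => /orP[//|dz]; move: (lt_trans dz zd); rewrite ltxx.
Qed.

Lemma gAC_clamp f a b c d : a < c -> c <= d -> d < b ->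
  abs_continuous a b (f : R -> R^o) -> gAC (f \o clamp c d).
Proof.
move=> ac cd db F e e0; have [D D0 H] := F _ e0; exists D => // N l r lr tr sD.
apply: H.
- move=> i; have /andP[h1 _] := clamp_in (l i) cd; have /andP[_ h2] := clamp_in (r i) cd.
  by rewrite (lt_le_trans ac h1) clamp_le// (le_lt_trans h2 db).
- move=> i j _ _ [x [xi xj]]; apply: (tr _ _ I I); exists x; split; exact: clamp_itv cd _ _.
- by apply: le_lt_trans sD; apply: ler_sum => i _; exact: clamp_lip.
Qed.

(** The variation function is the increasing part of the Jordan decomposition;
    its increments are total variations. *)
Lemma gAC_TV_clamp f c d : gAC f -> c <= d ->
  gAC (fun x => fine (total_variation c (clamp c d x) f)).
Proof.
move=> F cd e e0; have [D D0 H] := gAC_TV F e0; exists D => // N l r lr tr sD.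
have tr' : trivIset setT (fun i => `]clamp c d (l i), clamp c d (r i)[%classic).
  by move=> i j _ _ [x [xi xj]]; apply: (tr _ _ I I); exists x; split; exact: clamp_itv cd _ _.
have sD' : \sum_i (clamp c d (r i) - clamp c d (l i)) < D.
  by apply: le_lt_trans sD; apply: ler_sum => i _; exact: clamp_lip.
apply: le_lt_trans (H _ _ _ (fun i => clamp_le c d (lr i)) tr' sD').
apply: ler_sum => i _.
have /andP[h1 _] := clamp_in (l i) cd; have h2 := clamp_le c d (lr i).
have fin x y : x <= y -> total_variation x y f \is a fin_num.
  by move=> xy; apply/bounded_variationP => //; exact: gAC_BV.
rewrite (total_variationD f h1 h2) fineD ?fin// addrAC subrr add0r ger0_norm//.
by apply/fine_ge0/total_variation_ge0.
Qed.

End AC.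

Section MonotoneAC.
Variable R : realType.
Implicit Types (f F : R -> R).
Notation mu := (@lebesgue_measure R).

Lemma gAC_unif f e : gAC f -> 0 < e -> exists2 d : R, 0 < d &
  forall x y, x <= y -> y - x < d -> `|f y - f x| < e.
Proof.
move=> F e0; have [d d0 H] := F e e0; exists d => // x y xy yx.
have := H 1 (fun=> x) (fun=> y) (fun=> xy); rewrite !big_ord1; apply => //.
by move=> i j _ _ _; rewrite (ord1 i) (ord1 j).
Qed.

Lemma gAC_continuous f : gAC f -> continuous f.
Proof.
move=> F x; apply/cvgrPdist_lt => e e0.
have [d d0 H] := gAC_unif F e0; near=> y.
have xyd : `|x - y| < d by near: y; apply: cvgr_dist_lt => //; exact: cvg_id.
have [xy|/ltW yx] := leP x y.
  by rewrite distrC; apply: H => //; rewrite distrC ger0_norm ?subr_ge0 in xyd.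
by apply: H => //; rewrite ger0_norm ?subr_ge0 in xyd.
Unshelve. all: by end_near. Qed.

Lemma LS_itv (F : cumulative R R) (a b : R) : a <= b ->
  lebesgue_stieltjes_measure F `]a, b]%classic = (F b - F a)%:E.
Proof.
move=> ab; rewrite /lebesgue_stieltjes_measure /measure_extension.
by rewrite measurable_mu_extE /=; [rewrite wlength_itv_bnd|exact: is_ocitv].
Qed.

Lemma open_interval_bnd (J : set R) : open J -> is_interval J ->
  (mu J < +oo)%E -> exists p : R * R, p.1 <= p.2 /\ `]p.1, p.2[%classic = J.
Proof.
move=> oJ iJ muJ; have [J0|/set0P[x Jx]] := eqVneq J set0.
  by exists (0, 0); split => //=; rewrite J0 set_itvoo0.
have := @RhullK R J; rewrite inE => /(_ iJ) E.
move: E; move: (Rhull J) => i Ji; subst J.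
have EJ : [set` i]° = [set` i] by apply/interior_id.
move: muJ; rewrite lebesgue_measure_itv; case: i EJ Jx {oJ iJ} => [[bl l|[]] [br r|[]]] //=.
- rewrite interior_itv_bnd => EJ Jx _; exists (l, r); split => /=; last exact: EJ.
  have : `]l, r[%classic x by rewrite EJ.
  by rewrite /= in_itv /= => /andP[lx xr]; apply/ltW/(lt_trans lx).
all: rewrite ?ltry ?ltNyr ?in_itv /= ?andbF //= ?ltxx.
Qed.

(** A null set lies in an open set of measure less than d, a disjoint union of
    open intervals, whose images have total length less than e. *)
Lemma LS_dominated (F : cumulative R R) : gAC F ->
  lebesgue_stieltjes_measure F `<< mu.
Proof.
move=> AF; apply/null_content_dominatesP => A mA A0.
apply/eqP; rewrite eq_le measure_ge0 andbT; apply/lee_addgt0Pr => e e0.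
rewrite add0e.
have [d d0 H] := AF _ e0.
have [U [oU AU UA]] : exists U : set R, [/\ open U , A `<=` U & mu (U `\` A) < d%:E]%E.
  by apply: lebesgue_regularity_outer => //; rewrite A0.
have mU : measurable U by exact: open_measurable.
have Ud : (mu U < d%:E)%E.
  apply: le_lt_trans UA; rewrite -[leRHS]add0e -A0 -measureU//; last 2 first.
  - exact: measurableD.
  - by rewrite setDIK.
  by rewrite setDUK.
apply: (@le_trans _ _ (lebesgue_stieltjes_measure F U)).
  by apply: le_measure; rewrite ?inE.
rewrite {1}(open_disjoint_itv_bigcup oU).
set J := open_disjoint_itv oU.
have mJ k : measurable (J k) by apply: open_measurable; exact: open_disjoint_itv_open.
have tJ := @open_disjoint_itv_trivIset R U oU.
have JU k : J k `<=` U by rewrite (open_disjoint_itv_bigcup oU); exact: bigcup_sup.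
have [l [r [lr Jlr1 Jlr2]]] : exists l r : nat -> R,
    [/\ forall k, l k <= r k, forall k, `]l k, r k[ `<=` J k &
        forall k, J k `<=` `]l k, r k[%classic].
  have ex k := @open_interval_bnd (J k) (@open_disjoint_itv_open R U oU k)
      (@open_disjoint_itv_is_interval R U oU k) (le_lt_trans
        (le_measure mu (mem_set (mJ k)) (mem_set mU) (JU k))
        (lt_trans Ud (ltry d))).
  have [p hp] := choice ex; exists (fst \o p), (snd \o p); split => k /=.
  - exact: (hp k).1.
  - by rewrite (hp k).2.
  - by rewrite (hp k).2.
rewrite measure_bigcup//; last by move=> k _; exact: mJ.
rewrite (eq_eseriesl (Q := xpredT)); last by move=> k /=; rewrite in_setT.
apply: (lime_le (is_cvg_nneseries_cond (fun n _ _ => measure_ge0 _ _))).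
apply: nearW => N; rewrite big_mkord.
have muJ k : mu (J k) = (r k - l k)%:E.
  rewrite (_ : J k = `]l k, r k[%classic); last by apply/seteqP.
  rewrite lebesgue_measure_itv /= lte_fin; case: ltP => // rl.
  by congr EFin; apply/esym/eqP; rewrite subr_eq0 eq_le rl lr.
apply: (@le_trans _ _ (\sum_(k < N) (`|F (r k) - F (l k)|)%:E)%E).
  apply: lee_sum => k _; rewrite ger0_norm ?subr_ge0; last exact: cumulative_is_nondecreasing.
  rewrite -(LS_itv F (lr k)); apply: le_measure; rewrite ?inE; [exact: mJ|exact: measurable_itv|].
  by move=> x /Jlr2 /=; rewrite !in_itv /= => /andP[-> /ltW ->].
rewrite sumEFin lee_fin; apply/ltW/H => [k|i j _ _ [x [xi xj]]|]; first exact: lr.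
  apply/val_inj/(tJ _ _ I I); exists x; split; exact: Jlr1.
rewrite -lte_fin -sumEFin; apply: le_lt_trans Ud.
rewrite (eq_bigr (fun k : 'I_N => mu (J k))); last by move=> k _; rewrite muJ.
rewrite (open_disjoint_itv_bigcup oU) -/J measure_bigcup//; last by move=> k _; exact: mJ.
rewrite (eq_eseriesl (Q := xpredT)); last by move=> k /=; rewrite in_setT.
have := @nneseries_lim_ge R (fun k => mu (J k)) xpredT 0 N.
by rewrite big_mkord; apply.
Qed.

(** Lebesgue's fundamental theorem of calculus on [c, d]: g is a derivative of
    F almost everywhere, and F is the integral of g. *)
Definition FTC_on F c d (g : R -> R) : Prop :=
  [/\ forall y, mu.-integrable [set` Interval (BRight c) (BRight y)] (EFin \o g),
      forall y, c < y < d ->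
        F y = F c + \int[mu]_(t in [set` Interval (BRight c) (BRight y)]) g t &
      {ae mu, forall x, c < x < d -> derivable F x 1 /\ derive1 F x = g x}].

(** The density g is the Radon-Nikodym derivative of the Stieltjes measure of
    F with respect to Lebesgue measure. *)
Lemma gAC_nondecreasing_FTC F c d : nondecreasing F -> gAC F -> c < d ->
  exists g, FTC_on F c d g.
Proof.
move=> ndF AF cd.
have cF : right_continuous F by apply: right_continuousW; exact: gAC_continuous.
pose Fc : cumulative R R := HB.pack F (isCumulative.Build R _ R F ndF cF).
have mcd : measurable (`]c, d]%classic : set R) by exact: measurable_itv.
have fcd : (lebesgue_stieltjes_measure Fc `]c, d]%classic < +oo)%E.
  by rewrite LS_itv ?ltry// ltW.
pose nu : {finite_measure set (measurableTypeR R) -> \bar R} :=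
  @mfrestr _ (measurableTypeR R) R `]c, d]%classic
    (lebesgue_stieltjes_measure Fc) mcd fcd.
have numu : nu `<< mu.
  apply/null_content_dominatesP => A mA A0; rewrite /nu /= /mfrestr /mrestr.
  apply/eqP; rewrite eq_le measure_ge0 andbT.
  have /null_content_dominatesP D := @LS_dominated Fc AF.
  by rewrite -(D A mA A0) le_measure ?inE//; exact: measurableI.
have [g [g0 gfin gint gE]] := radon_nikodym_sigma_finite numu.
have gEE : EFin \o (fine \o g) = g by apply/funext => x /=; rewrite fineK.
pose G x := (\int[mu]_(t in [set` Interval (BRight c) (BRight x)]) fine (g t)).
have FG y : c < y < d -> F y = F c + G y.
  move=> /andP[cy yd]; rewrite /G /Rintegral.
  have -> : (\int[mu]_(x in [set` `]c, y]]) (fine (g x))%:E = (F y - F c)%:E)%E.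
    rewrite -(LS_itv Fc (ltW cy)).
    rewrite (eq_integral g) => [|x _]; last by rewrite fineK.
    rewrite -gE; last exact: measurable_itv.
    rewrite /nu /= /mfrestr /mrestr; congr (lebesgue_stieltjes_measure _ _).
    apply/seteqP; split => x /=; rewrite !in_itv /=; first by case.
    by move=> /andP[-> xy]; rewrite xy (le_trans xy (ltW yd)).
  by rewrite /= addrC subrK.
have int y : mu.-integrable [set` Interval (BRight c) (BRight y)] (EFin \o (fine \o g)).
  by rewrite gEE; apply: integrableS gint.
have loc : locally_integrable setT (fine \o g).
  by apply: (open_integrable_locally openT); rewrite gEE.
exists (fine \o g); split => //.
have := FTC1 int loc; apply: filterS; first exact: (ae_filter_ringOfSetsType mu).
move=> x H /andP[cx xd]; have [|dG eG] := H; first by rewrite lte_fin.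
have near_eq : {near x, cst (F c) + G =1 F}.
  near=> y.
  have cyd : c < y < d by apply/andP; split; near: y; [exact: lt_nbhsr|exact: lt_nbhsl].
  by rewrite (FG y cyd).
have dcG : derivable (cst (F c) + G) x 1 by apply: derivableD.
split; first exact: near_eq_derivable dcG.
rewrite derive1E -(near_eq_derive _ near_eq) ?oner_eq0// deriveD// derive_cst add0r.
by rewrite -derive1E.
Unshelve. all: by end_near. Qed.

(** By the Jordan decomposition f = (v + f) - v, with v the variation of f on
    [c, x]. *)
Theorem gAC_FTC f c d : gAC f -> c < d -> exists g, FTC_on f c d g.
Proof.
move=> Af cd.
pose v x := fine (total_variation c (clamp c d x) f).
have Av : gAC v by apply: gAC_TV_clamp => //; exact: ltW.
have fin x y : x <= y -> total_variation x y f \is a fin_num.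
  by move=> xy; apply/bounded_variationP => //; exact: gAC_BV.
have vD x y : x <= y -> v y - v x = fine (total_variation (clamp c d x) (clamp c d y) f).
  move=> xy; have /andP[h1 _] := clamp_in x (ltW cd); have h2 := clamp_le c d xy.
  by rewrite /v (total_variationD f h1 h2) fineD ?fin// addrAC subrr add0r.
have ndv : nondecreasing v.
  move=> x y xy; rewrite -subr_ge0 vD//; apply/fine_ge0/total_variation_ge0.
  exact: clamp_le.
pose w := v + (f \o clamp c d).
have Aw : gAC w.
  apply: gACD => //.
  move=> e e0; have [D D0 H] := Af _ e0; exists D => // N l r lr tr sD.
  apply: H => [i||]; first exact: clamp_le.
    by move=> i j _ _ [x [xi xj]]; apply: (tr _ _ I I); exists x; split; exact: (clamp_itv (ltW cd)).
  by apply: le_lt_trans sD; apply: ler_sum => i _; apply: clamp_lip => //; exact: ltW.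
have ndw : nondecreasing w.
  move=> x y xy; rewrite -subr_ge0 /w !fctE opprD addrACA vD//=.
  have := total_variation_ge f (clamp_le c d xy).
  rewrite -[leRHS]fineK ?fin ?clamp_le// lee_fin => /ler_normlP[] /= h _.
  rewrite -lerBlDr sub0r; exact: h.
have [h [inth hE dh]] := gAC_nondecreasing_FTC ndv Av cd.
have [g [intg gE dg]] := gAC_nondecreasing_FTC ndw Aw cd.
have fE y : c <= y <= d -> f y = w y - v y.
  move=> cyd; have -> : w y = v y + f y by rewrite /w !fctE /= (clamp_id cyd).
  by rewrite addrC addKr.
exists (g \- h); split => [y|y /[dup] cyd /andP[cy yd]|].
- have -> : EFin \o (g \- h) = ((EFin \o g) \- (EFin \o h))%E.
    by apply/funext => x /=; rewrite EFinB.
  exact: integrableB.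
- rewrite (fE y) ?(ltW cy) ?(ltW yd)// (fE c) ?lexx ?(ltW cd)// (gE y cyd) (hE y cyd).
  by rewrite RintegralB//; lra.
have F := ae_filter_ringOfSetsType mu.
apply: filterS2 dg dh => x dg dh /[dup] cxd /andP[cx xd].
have [dw wE] := dg cxd; have [dv vE] := dh cxd.
have near_eq : {near x, w - v =1 f}.
  near=> y; have cyd : c <= y <= d.
    by apply/andP; split; apply/ltW; near: y; [exact: lt_nbhsr|exact: lt_nbhsl].
  by rewrite [RHS](fE y cyd).
have dwv : derivable (w - v) x 1 by apply: derivableB.
split; first exact: near_eq_derivable dwv.
rewrite derive1E -(near_eq_derive _ near_eq) ?oner_eq0// deriveB//.
by rewrite -!derive1E wE vE.
Unshelve. all: by end_near. Qed.

Section OnInterval.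
Variables (a b : R) (f : R -> R).
Hypothesis ACf : abs_continuous a b (f : R -> R^o).

Lemma AC_FTC c d : a < c -> c < d -> d < b -> exists g, FTC_on f c d g.
Proof.
move=> ac cd db.
have [g [intg gE dg]] := gAC_FTC (gAC_clamp ac (ltW cd) db ACf) cd.
exists g; split => // [y /[dup] cyd /andP[cy yd]|].
  have := gE y cyd; rewrite /= !clamp_id ?lexx ?(ltW cd) ?(ltW cy) ?(ltW yd)//.
have F := ae_filter_ringOfSetsType mu.
apply: filterS dg => x dg /[dup] cxd /andP[cx xd].
have [df fE] := dg cxd.
have near_eq : {near x, f \o clamp c d =1 f}.
  near=> y; have cyd : c <= y <= d.
    by apply/andP; split; apply/ltW; near: y; [exact: lt_nbhsr|exact: lt_nbhsl].
  by rewrite /= (clamp_id cyd).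
split; first exact: near_eq_derivable df.
by rewrite derive1E -(near_eq_derive _ near_eq) ?oner_eq0// -derive1E.
Unshelve. all: by end_near. Qed.

Lemma between2 s t : a < s -> s <= t -> t < b ->
  exists c d, [/\ a < c, c < s, s <= t, t < d & d < b].
Proof.
move=> as_ st tb; exists ((a + s) / 2), ((t + b) / 2); split => //.
- by rewrite midf_lt.
- by rewrite midf_lt.
- by rewrite midf_lt.
- by rewrite midf_lt.
Qed.

(** The integrand of the fundamental theorem agrees almost everywhere with its
    positive part. *)
Lemma AC_nondecreasing (E : set R) s t : mu.-negligible E ->
  a < s -> s <= t -> t < b ->
  (forall u, s < u <= t -> ~ E u -> derivable f u 1 -> 0 <= derive1 f u) -> f s <= f t.
Proof.
move=> E0 as_ st tb fpos.
have [c [d [ac cs _ td db]]] := between2 as_ st tb.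
have cd : c < d by rewrite (lt_trans cs)// (le_lt_trans st).
have [g [intg gE dg]] := AC_FTC ac cd db.
have std : c < s < d by rewrite cs (le_lt_trans st).
have ctd : c < t < d by rewrite td (lt_le_trans cs).
rewrite -subr_ge0 (gE _ std) (gE _ ctd) opprD addrACA subrr add0r.
rewrite Rintegral_itvB ?bnd_simp ?(ltW cs)//.
have F := ae_filter_ringOfSetsType mu.
have ig : mu.-integrable `]s, t] (EFin \o g).
  by apply: integrableS (intg t) => //= x; rewrite /= !in_itv /= => /andP[/(lt_trans cs)-> ->].
have gpos : {ae mu, forall x, `]s, t]%classic x -> g x = Num.max (g x) 0}.
  have NE : {ae mu, forall x, ~ E x} by apply: negligibleS E0 => x /=; exact: contrapT.
  apply: filterS2 dg NE => x dg nE; rewrite /= in_itv /= => /andP[sx xt].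
  have [|df gx] := dg; first by rewrite (lt_trans cs sx) (le_lt_trans xt td).
  apply/esym/max_idPl; by rewrite -gx; apply: fpos; rewrite ?sx.
have mg : measurable_fun `]s, t] g by apply/measurable_EFinP; case/integrableP: ig.
have eqI : (\int[mu]_(x in `]s, t]) (g x)%:E =
    \int[mu]_(x in `]s, t]) (Num.max (g x) 0)%:E)%E.
  apply: ae_eq_integral => //=.
  - exact/measurable_EFinP.
  - by apply/measurable_EFinP; apply: measurable_maxr.
  - by apply: filterS gpos => x gx sxt; rewrite -gx.
apply: fine_ge0; rewrite eqI; apply: integral_ge0 => x _.
by rewrite lee_fin le_max lexx orbT.
Qed.

(** If f s = f t then f is constant on the interval, so that its derivative
    would vanish almost everywhere on an interval of positive length. *)
Lemma AC_increasing (E : set R) s t : mu.-negligible E ->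
  a < s -> s < t -> t < b ->
  (forall u, s < u <= t -> ~ E u -> derivable f u 1 -> 0 < derive1 f u) -> f s < f t.
Proof.
move=> E0 as_ st tb fpos.
have mono x y : s <= x -> x <= y -> y <= t -> f x <= f y.
  move=> sx xy yt; apply: (AC_nondecreasing E0) => // [||u /andP[xu uy] nE du].
  - exact: lt_le_trans sx.
  - exact: le_lt_trans tb.
  - by apply/ltW/fpos => //; rewrite (le_lt_trans sx xu) (le_trans uy).
rewrite lt_neqAle mono ?lexx ?(ltW st)// andbT; apply/eqP => fst.
have [c [d [ac cs _ td db]]] := between2 as_ (ltW st) tb.
have cd : c < d by rewrite (lt_trans cs)// (lt_trans st).
have [g [intg gE dg]] := AC_FTC ac cd db.
have F := ae_filter_ringOfSetsType mu.
have NE : {ae mu, forall x, ~ E x} by apply: negligibleS E0 => x /=; exact: contrapT.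
have : {ae mu, forall x, ~ `]s, t[%classic x}.
  apply: filterS2 dg NE => x dg nE; rewrite /= in_itv /= => /andP[sx xt].
  have [|df gx] := dg; first by rewrite (lt_trans cs sx) (lt_trans xt td).
  have := fpos x _ nE df; rewrite sx (ltW xt) => /(_ isT).
  rewrite derive1E (@near_eq_derive _ _ _ f (cst (f s))) ?oner_eq0 ?derive_cst ?ltxx//.
  near=> y.
  have sy : s < y by near: y; exact: lt_nbhsr.
  have yt : y < t by near: y; exact: lt_nbhsl.
  apply/eqP; rewrite eq_le /=; apply/andP; split.
    by rewrite fst; apply: mono; rewrite ?(ltW yt) ?(ltW sy).
  by apply: mono; rewrite ?(ltW sy) ?(ltW yt).
move=> N; have N' : mu.-negligible `]s, t[%classic by apply: negligibleS N => x /= ? [].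
have : mu `]s, t[%classic = 0%E.
  by move: N'; rewrite negligibleP//; exact: measurable_itv.
rewrite lebesgue_measure_itv /= lte_fin st.
by rewrite -EFinB => -[] /eqP; rewrite subr_eq0 gt_eqF.
Unshelve. all: by end_near. Qed.

End OnInterval.

End MonotoneAC.

(** * Minors and triangular factorizations *)

Section StrictlyIncreasing.
Variables k m : nat.
Implicit Types (f g : 'I_k -> 'I_m).

Definition sinc f : Prop := forall i j : 'I_k, (i < j)%N -> (f i < f j)%N.

Lemma sinc_inj f : sinc f -> injective f.
Proof.
by move=> fi i j fij; apply/val_inj; case: (ltngtP i j) => // /fi; rewrite fij ltnn.
Qed.

Lemma sinc_le f (i j : 'I_k) : sinc f -> (i <= j)%N -> (f i <= f j)%N.
Proof. by move=> fi; rewrite leq_eqVlt => /predU1P[/val_inj->//|/fi/ltnW]. Qed.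

Lemma sort_sinc f : injective f -> exists p : 'S_k, sinc (f \o p).
Proof.
move=> finj; pose le := fun i j : 'I_m => (i <= j)%N.
pose t := [tuple f i | i < k].
have : perm_eq (sort le t) t by rewrite perm_sort.
move=> /tuple_permP[p sE]; exists p => i j ij /=.
have nthE x0 (l : 'I_k) : nth x0 (sort le t) l = f (p l).
  by rewrite sE nth_mktuple tnth_mktuple.
have tr : transitive le by move=> a b c; exact: leq_trans.
have so : sorted le (sort le t) by apply: sort_sorted => a b; exact: leq_total.
have szl (l : 'I_k) : (l < size (sort le t))%N by rewrite size_sort size_tuple.
have : le (f (p i)) (f (p j)).
  rewrite -[f (p j)](nthE (f i)) -[f (p i)](nthE (f i)).
  have rl : reflexive le by move=> a; exact: leqnn.
  by apply: (sorted_leq_nth tr rl (f i) so); rewrite ?inE ?szl// ltnW.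
rewrite /le leq_eqVlt => /predU1P[/val_inj/finj/perm_inj ijE|//].
by move: ij; rewrite ijE ltnn.
Qed.

End StrictlyIncreasing.

Section Minors.
Variables (T : comNzRingType).

(** Row and column selections are arbitrary maps, so that the Cauchy-Binet
    formula and the Leibniz rule below need no sorting. *)
Definition minor {k m n} (f : 'I_k -> 'I_m) (g : 'I_k -> 'I_n)
  (A : 'M[T]_(m, n)) : T := \det (mxsub f g A).

Lemma det_rowsub_perm k n (f : 'I_k -> 'I_n) (p : 'S_k) (A : 'M[T]_(n, k)) :
  \det (rowsub (f \o p) A) = (-1) ^+ p * \det (rowsub f A).
Proof.
have -> : rowsub (f \o p) A = perm_mx p *m rowsub f A.
  by rewrite -row_permE; apply/matrixP => i j; rewrite !mxE.
by rewrite det_mulmx det_perm.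
Qed.

Lemma det_colsub_perm k n (f : 'I_k -> 'I_n) (p : 'S_k) (A : 'M[T]_(k, n)) :
  \det (colsub (f \o p) A) = (-1) ^+ p * \det (colsub f A).
Proof.
have colE (g : 'I_k -> 'I_n) : colsub g A = (rowsub g A^T)^T.
  by apply/matrixP => i j; rewrite !mxE.
by rewrite !colE !det_tr det_rowsub_perm.
Qed.

(** Multilinearity in the rows of A B. *)
Lemma det_mulmx_ffun k n (A : 'M[T]_(k, n)) (B : 'M[T]_(n, k)) :
  \det (A *m B) = \sum_(f : {ffun 'I_k -> 'I_n})
     (\prod_i A i (f i)) * \det (rowsub f B).
Proof.
rewrite /determinant.
transitivity (\sum_(s : 'S_k) \sum_(f : {ffun 'I_k -> 'I_n})
   (-1) ^+ s * ((\prod_i A i (f i)) * \prod_i B (f i) (s i))).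
  apply: eq_bigr => s _; rewrite -mulr_sumr; congr (_ * _).
  rewrite (eq_bigr (fun i => \sum_j A i j * B j (s i))); last by move=> i _; rewrite mxE.
  by rewrite bigA_distr_bigA /=; apply: eq_bigr => f _; rewrite big_split.
rewrite exchange_big; apply: eq_bigr => f _ /=.
rewrite mulr_sumr; apply: eq_bigr => s _; rewrite mulrCA; congr (_ * (_ * _)).
by apply: eq_bigr => i _; rewrite !mxE.
Qed.

(** Summing over all maps f, each k-element index set is counted k! times. *)
Lemma Cauchy_Binet k n (A : 'M[T]_(k, n)) (B : 'M[T]_(n, k)) :
  (k`!)%:R * \det (A *m B) = \sum_(f : {ffun 'I_k -> 'I_n})
     \det (colsub f A) * \det (rowsub f B).
Proof.
transitivity (\sum_(p : 'S_k) \det (A *m B)).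
  by rewrite sumr_const card_Sn mulr_natl.
transitivity (\sum_(p : 'S_k) \sum_(f : {ffun 'I_k -> 'I_n})
    (-1) ^+ p * (\prod_i A i (f (p i))) * \det (rowsub f B)).
  apply: eq_bigr => p _; rewrite det_mulmx_ffun.
  rewrite (reindex (fun f : {ffun 'I_k -> 'I_n} => [ffun i => f (p i)])) /=; last first.
    exists (fun f : {ffun 'I_k -> 'I_n} => [ffun i => f ((p^-1)%g i)]) => f _;
    by apply/ffunP => i; rewrite !ffunE ?permK ?permKV.
  apply: eq_bigr => f _.
  rewrite (_ : rowsub _ B = rowsub (f \o p) B); last by apply/matrixP => i j; rewrite !mxE ffunE.
  rewrite det_rowsub_perm mulrCA mulrA; congr (_ * _ * _).
  by apply: eq_bigr => i _; rewrite ffunE.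
rewrite exchange_big; apply: eq_bigr => f _ /=.
rewrite -mulr_suml /determinant; congr (_ * _).
by apply: eq_bigr => p _; congr (_ * _); apply: eq_bigr => i _; rewrite mxE.
Qed.

Lemma det_rowsub_noninj k n (f : 'I_k -> 'I_n) (B : 'M[T]_(n, k)) :
  ~ injective f -> \det (rowsub f B) = 0.
Proof.
move=> nf; have [i [j [ij fij]]] : exists i j, i != j /\ f i = f j.
  apply: contrapT => H; apply: nf => i j fij; apply/eqP/negPn/negP => ij.
  by apply: H; exists i, j.
by apply: (determinant_alternate ij) => l; rewrite !mxE fij.
Qed.

End Minors.

Section MinorSign.
Variables (T : realDomainType).

Section Product.
Variables (k n : nat) (A : 'M[T]_(k, n)) (B : 'M[T]_(n, k)).

Let prodf (f : 'I_k -> 'I_n) := \det (colsub f A) * \det (rowsub f B).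

Let prodf_case f : (exists2 g, sinc g & prodf f = prodf g) \/ prodf f = 0.
Proof.
have [fi|nf] := pselect (injective f).
  have [p sp] := sort_sinc fi; left; exists (f \o p) => //.
  by rewrite /prodf det_colsub_perm det_rowsub_perm mulrACA -expr2 sqrr_sign mul1r.
by right; rewrite /prodf det_rowsub_noninj ?mulr0.
Qed.

Lemma det_mulmx_ge0 : (forall f, sinc f -> 0 <= \det (colsub f A) * \det (rowsub f B)) ->
  0 <= \det (A *m B).
Proof.
move=> H; rewrite -(pmulr_rge0 _ (_ : 0 < (k`!)%:R)) ?ltr0n ?fact_gt0//.
rewrite Cauchy_Binet; apply: sumr_ge0 => f _.
by have [[g sg]|] := prodf_case f; rewrite /prodf => ->; [exact: H|].
Qed.

Lemma det_mulmx_gt0 f0 : (forall f, sinc f -> 0 <= \det (colsub f A) * \det (rowsub f B)) ->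
  sinc f0 -> 0 < \det (colsub f0 A) * \det (rowsub f0 B) -> 0 < \det (A *m B).
Proof.
move=> H s0 H0; rewrite -(pmulr_rgt0 _ (_ : 0 < (k`!)%:R)) ?ltr0n ?fact_gt0//.
rewrite Cauchy_Binet (bigD1 [ffun i => f0 i]) //= ltr_wpDr//.
  apply: sumr_ge0 => f _.
  by have [[g sg]|] := prodf_case f; rewrite /prodf => ->; [exact: H|].
rewrite (_ : colsub _ A = colsub f0 A); last by apply/matrixP => i j; rewrite !mxE ffunE.
by rewrite (_ : rowsub _ B = rowsub f0 B)//; apply/matrixP => i j; rewrite !mxE ffunE.
Qed.

Lemma det_mulmx_eq0 : (forall f, sinc f -> \det (colsub f A) * \det (rowsub f B) = 0) ->
  \det (A *m B) = 0.
Proof.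
move=> H; apply: (mulfI (_ : (k`!)%:R != 0)).
  by rewrite gt_eqF// ltr0n fact_gt0.
rewrite Cauchy_Binet mulr0 big1// => f _.
by have [[g sg]|] := prodf_case f; rewrite /prodf => ->; [exact: H|].
Qed.

End Product.

End MinorSign.

Section Selections.
Variable m : nat.
Implicit Types i : 'I_m.

(** The first i+1 indices, and the last i+1 indices in increasing order. *)
Definition top i (j : 'I_i.+1) : 'I_m := widen_ord (ltn_ord i) j.
Definition bot i (j : 'I_i.+1) : 'I_m := rev_ord (top (rev_ord j)).

Lemma top_sinc i : sinc (@top i). Proof. by move=> a b. Qed.

Lemma bot_sinc i : sinc (@bot i).
Proof. by move=> a b ab /=; have := ltn_ord i; have := ltn_ord b; lia. Qed.

Lemma topP i (x : 'I_m) : (x <= i)%N -> exists j : 'I_i.+1, top j = x.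
Proof. by move=> xi; exists (Ordinal (xi : (x < i.+1)%N)); apply/val_inj. Qed.

Lemma botP i (x : 'I_m) : (rev_ord i <= x)%N -> exists j : 'I_i.+1, bot j = x.
Proof.
move=> xi; have [|j jx] := @topP i (rev_ord x); first by move: xi => /=; have := ltn_ord x; lia.
by exists (rev_ord j); rewrite /bot rev_ordK jx rev_ordK.
Qed.

Lemma bot_ge i (j : 'I_i.+1) : (rev_ord i <= bot j)%N.
Proof. by move=> /=; have := ltn_ord i; have := ltn_ord j; lia. Qed.

End Selections.

Section Triangular.
Variable T : fieldType.

(** A product of submatrices is a submatrix of the product as soon as only the
    inner indices in the range of h contribute. *)
Lemma mxsub_mul_support k m n p q (f : 'I_k -> 'I_m) (h : 'I_q -> 'I_n) (g : 'I_k -> 'I_p)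
    (A : 'M[T]_(m, n)) (B : 'M[T]_(n, p)) : injective h ->
  (forall x a b, (forall j, h j != x) -> A (f a) x * B x (g b) = 0) ->
  mxsub f g (A *m B) = mxsub f h A *m mxsub h g B.
Proof.
move=> hi H; apply/matrixP => a b; rewrite !mxE.
rewrite (bigID (mem (codom h))) /= [X in _ + X]big1 ?addr0; last first.
  by move=> x xh; apply: H => j; apply: contra xh => /eqP<-; exact: codom_f.
rewrite -big_uniq /=; last by rewrite /codom /image_mem map_inj_uniq ?enum_uniq.
by rewrite /codom /image_mem big_map big_enum; apply: eq_bigr => j _; rewrite !mxE.
Qed.

Variable m : nat.
Implicit Types (U L M N : 'M[T]_m).

Definition upper U := forall i j : 'I_m, (j < i)%N -> U i j = 0.
Definition lower1 L := forall i j : 'I_m, (i <= j)%N -> L i j = (i == j)%:R.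

Lemma upperM U V : upper U -> upper V -> upper (U *m V).
Proof.
move=> hU hV i j ji; rewrite mxE big1// => k _.
have [ki|ik] := ltnP k i; first by rewrite hU ?mul0r.
by rewrite hV ?mulr0// (leq_trans ji).
Qed.

Lemma upperM_diag U V i : upper U -> upper V -> (U *m V) i i = U i i * V i i.
Proof.
move=> hU hV; rewrite mxE (bigD1 i)//= big1 ?addr0// => k ki.
have [lt|ik] := ltnP k i; first by rewrite hU ?mul0r.
by rewrite hV ?mulr0// ltn_neqAle eq_sym ik andbT; apply: contra ki => /eqP e; apply/eqP/val_inj.
Qed.

Lemma upper1 : upper 1%:M.
Proof. by move=> i j ji; rewrite mxE; case: eqP ji => // ->; rewrite ltnn. Qed.

Lemma det_upper U : upper U -> \det U = \prod_i U i i.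
Proof.
move=> hU; rewrite -det_tr det_trig; first by apply: eq_bigr => i _; rewrite mxE.
by apply/is_trig_mxP => i j ij; rewrite mxE hU.
Qed.

Lemma upper_unit U : upper U -> (forall i, U i i != 0) -> U \in unitmx.
Proof.
by move=> hU dU; rewrite unitmxE det_upper// unitfE; apply/prodf_neq0 => i _.
Qed.

Lemma upper_inv U : upper U -> (forall i, U i i != 0) -> upper (invmx U).
Proof.
move=> hU dU; have uU := upper_unit hU dU; set V := invmx U.
have VU : V *m U = 1%:M by rewrite mulVmx.
suff H k : forall i j : 'I_m, (j < k)%N -> (j < i)%N -> V i j = 0.
  by move=> i j; exact: H.
elim: k => [//|k IH] i j jk ji.
have /matrixP/(_ i j) := VU; rewrite !mxE (bigD1 j)//= big1 ?addr0.
  case: (eqVneq i j) ji => [->|_ _ /eqP]; first by rewrite ltnn.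
  by rewrite mulf_eq0 (negbTE (dU j)) orbF => /eqP.
move=> x xj; have [xlt|jx] := ltnP x j.
  by rewrite IH ?mul0r//; [exact: leq_trans xlt jk|exact: ltn_trans xlt ji].
by rewrite hU ?mulr0// ltn_neqAle jx andbT; apply: contra xj => /eqP e; apply/eqP/val_inj.
Qed.

Lemma upper_inv_diag U i : upper U -> (forall i, U i i != 0) -> invmx U i i = (U i i)^-1.
Proof.
move=> hU dU; have uU := upper_unit hU dU; have hV := upper_inv hU dU.
have := upperM_diag i hV hU; rewrite mulVmx// mxE eqxx => e.
by apply: (mulIf (dU i)); rewrite -e mulVf.
Qed.

Lemma mxsub_mul_upper (i : 'I_m) (f : 'I_i.+1 -> 'I_m) (A U : 'M[T]_m) : upper U ->
  mxsub f (@top m i) (A *m U) = mxsub f (@top m i) A *m mxsub (@top m i) (@top m i) U.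
Proof.
move=> hU; apply: mxsub_mul_support; first exact/sinc_inj/top_sinc.
move=> x a b H; rewrite hU ?mulr0// ltnNge; apply/negP => xb.
have [|j jx] := @topP m i x; first exact: leq_trans xb (ltn_ord b).
by move: (H j); rewrite jx eqxx.
Qed.

Lemma mxsub_upper_mul (i : 'I_m) (g : 'I_i.+1 -> 'I_m) (A U : 'M[T]_m) : upper U ->
  mxsub (@bot m i) g (U *m A) = mxsub (@bot m i) (@bot m i) U *m mxsub (@bot m i) g A.
Proof.
move=> hU; apply: mxsub_mul_support; first exact/sinc_inj/bot_sinc.
move=> x a b H; rewrite hU ?mul0r// ltnNge; apply/negP => ax.
have [|j jx] := @botP m i x; first exact: leq_trans (bot_ge a) ax.
by move: (H j); rewrite jx eqxx.
Qed.

Lemma det_mxsub_upper k (f : 'I_k -> 'I_m) U : sinc f -> upper U ->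
  \det (mxsub f f U) = \prod_j U (f j) (f j).
Proof.
move=> sf hU; rewrite -det_tr det_trig; first by apply: eq_bigr => i _; rewrite !mxE.
by apply/is_trig_mxP => i j ij; rewrite !mxE hU//; exact: sf.
Qed.

Definition lead (i : 'I_m) M : T := minor (@top m i) (@top m i) M.

Lemma lower1_unit L : lower1 L -> \det L = 1.
Proof.
move=> hL; rewrite det_trig; last first.
  by apply/is_trig_mxP => i j ij; rewrite hL ?(ltnW ij)//; case: eqP ij => // ->; rewrite ltnn.
by rewrite big1// => i _; rewrite hL// eqxx.
Qed.

Lemma mxsub_lower_mul (i : 'I_m) (g : 'I_i.+1 -> 'I_m) (L A : 'M[T]_m) : lower1 L ->
  mxsub (@top m i) g (L *m A) = mxsub (@top m i) (@top m i) L *m mxsub (@top m i) g A.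
Proof.
move=> hL; apply: mxsub_mul_support; first exact/sinc_inj/top_sinc.
move=> x a b H; rewrite hL; last first.
  rewrite leqNgt; apply/negP => xa.
  by have [|j jx] := @topP m i x; [exact: leq_trans (ltnW xa) (ltn_ord a)|move: (H j); rewrite jx eqxx].
by case: eqP => [ax|_]; [move: (H a); rewrite ax eqxx|rewrite mul0r].
Qed.

Lemma det_mxsub_lower1 k (f : 'I_k -> 'I_m) L : sinc f -> lower1 L ->
  \det (mxsub f f L) = 1.
Proof.
move=> sf hL; rewrite det_trig ?big1//.
  by move=> i _; rewrite mxE hL// eqxx.
apply/is_trig_mxP => a b ab; rewrite mxE hL ?(ltnW (sf _ _ ab))//.
by rewrite -val_eqE /= ltn_eqF// sf.
Qed.

Lemma lower1_minor_top (L : 'M[T]_m) (i j : 'I_m) : lower1 L -> (j <= i)%N ->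
  minor (fun k : 'I_j.+1 => if k == ord_max then i else top k) (@top m j) L = L i j.
Proof.
move=> hL ji; rewrite /minor det_trig.
  rewrite (bigD1 ord_max)//= big1 ?mulr1.
    by rewrite mxE eqxx; congr (L _ _); apply/val_inj.
  move=> k kn; rewrite mxE (negbTE kn) hL// eqxx//.
apply/is_trig_mxP => a b ab; rewrite mxE.
have -> : (a == ord_max) = false.
  by apply/negbTE/eqP => e; move: ab (ltn_ord b); rewrite e /=; lia.
rewrite hL; first by rewrite -val_eqE /= ltn_eqF.
by rewrite /= ltnW.
Qed.

(** Cramer's formula for the unit lower triangular factor of M = L U. *)
Definition lowf M : 'M[T]_m := \matrix_(i, j)
  if (i <= j)%N then (i == j)%:R else
  minor (fun k : 'I_j.+1 => if k == ord_max then i else top k) (@top m j) M / lead j M.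

Lemma lead_LU L U i : lower1 L -> upper U -> lead i (L *m U) = lead i U.
Proof.
move=> hL hU; rewrite /lead /minor mxsub_mul_upper// det_mulmx.
by rewrite det_mxsub_lower1 ?mul1r//; exact: top_sinc.
Qed.

(** Left multiplication by L does not change the leading minors of U, and the
    minor in the numerator splits off the entry of L. *)
Lemma lowf_LU L U : lower1 L -> upper U -> (forall i, U i i != 0) -> lowf (L *m U) = L.
Proof.
move=> hL hU dU; apply/matrixP => i j; rewrite mxE.
case: leqP => [ij|/ltnW ji]; first by rewrite hL.
rewrite lead_LU// /minor mxsub_mul_upper// det_mulmx -/(minor _ _ _).
rewrite lower1_minor_top// mulfK// /lead /minor det_mxsub_upper ?top_sinc//.
by apply/prodf_neq0 => k _.
Qed.

End Triangular.

(** One step of Gaussian elimination: the leading minors of the Schur complement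
    S are those of M divided by the pivot. *)
Lemma LU_exists (T : fieldType) m (M : 'M[T]_m) : (forall i, lead i M != 0) ->
  exists L U, [/\ lower1 L, upper U, forall i, U i i != 0 & M = L *m U].
Proof.
elim: m M => [|m IH] M hM.
  exists 1%:M, 1%:M; split; try by case.
  by apply/matrixP => -[].
pose a := M ord0 ord0.
have a0 : a != 0.
  have := hM ord0; rewrite /lead /minor (mx11_scalar (mxsub _ _ _)) det_scalar1 mxE.
  by rewrite (_ : top ord0 = ord0)//; apply/val_inj.
pose E : 'M[T]_m.+1 := \matrix_(i, j) if j == ord0 then M i ord0 / a else (i == j)%:R.
pose S : 'M[T]_m := \matrix_(i, j)
  (M (lift ord0 i) (lift ord0 j) - M (lift ord0 i) ord0 / a * M ord0 (lift ord0 j)).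
pose F : 'M[T]_m.+1 := \matrix_(i, j) if unlift ord0 i is Some i' then
   (if unlift ord0 j is Some j' then S i' j' else 0) else M ord0 j.
have ME : M = E *m F.
  apply/matrixP => i j; rewrite mxE big_ord_recl !mxE eqxx unlift_none.
  under eq_bigr => k _ do rewrite !mxE liftK /=.
  case: (unliftP ord0 i) => [i'|] ->.
    rewrite (bigD1 i')//= big1 ?addr0 => [|k ki]; last first.
      by rewrite (inj_eq (@lift_inj _ _)) eq_sym (negbTE ki) mul0r.
    rewrite eqxx mul1r; case: unliftP => [j'|] ->; first by rewrite mxE addrC subrK.
    by rewrite addr0 divfK.
  by rewrite divff// mul1r big1 ?addr0// => k _; rewrite mul0r.
have hE : lower1 E.
  move=> i j ij; rewrite mxE; case: eqP => [j0|//]; move: ij; rewrite j0 leqn0 => /eqP i0.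
  by rewrite (_ : i = ord0) ?eqxx ?divff//; apply/val_inj.
have [|L [U [hL hU dU SE]]] := IH S.
  move=> i; have := hM (lift ord0 i); rewrite ME.
  have -> : lead (lift ord0 i) (E *m F) = a * lead i S; last first.
    by rewrite mulf_eq0 negb_or => /andP[].
  rewrite /lead /minor.
  rewrite mxsub_lower_mul// det_mulmx (det_mxsub_lower1 (@top_sinc _ _) hE) mul1r.
  rewrite (expand_det_col _ ord0) big_ord_recl big1 ?addr0; last first.
    move=> k _; rewrite !mxE (_ : top (lift ord0 k) = lift ord0 (top k)); last exact/val_inj.
    by rewrite liftK (_ : top ord0 = ord0) ?unlift_none ?mul0r//; apply/val_inj.
  rewrite !mxE (_ : top ord0 = ord0) ?unlift_none; last exact/val_inj.
  congr (_ * _); rewrite /cofactor addn0 expr0 mul1r; congr (\det _).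
  apply/matrixP => p q; rewrite !mxE.
  rewrite (_ : top (lift ord0 p) = lift ord0 (top p)); last exact/val_inj.
  rewrite (_ : top (lift ord0 q) = lift ord0 (top q)); last exact/val_inj.
  by rewrite !liftK !mxE.
pose L1 : 'M[T]_m.+1 := \matrix_(i, j) if unlift ord0 i is Some i' then
   (if unlift ord0 j is Some j' then L i' j' else 0) else (j == ord0)%:R.
pose U1 : 'M[T]_m.+1 := \matrix_(i, j) if unlift ord0 i is Some i' then
   (if unlift ord0 j is Some j' then U i' j' else 0) else M ord0 j.
have hL1 : lower1 L1.
  move=> i j; rewrite mxE; case: (unliftP ord0 i) => [i'|] ->; case: (unliftP ord0 j) => [j'|] -> //= ij.
  by rewrite hL// (inj_eq (@lift_inj _ _)).
have FE : F = L1 *m U1.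
  apply/matrixP => i j; rewrite [RHS]mxE big_ord_recl !mxE eqxx unlift_none.
  under eq_bigr => k _ do rewrite !mxE liftK /=.
  case: (unliftP ord0 i) => [i' _|_] /=.
    rewrite mul0r add0r; case: (unliftP ord0 j) => [j' _|_]; first by rewrite SE mxE.
    by rewrite big1// => k _; rewrite mulr0.
  by rewrite mul1r big1 ?addr0// => k _; rewrite mul0r.
exists (E *m L1), U1; split.
- move=> i j ij; rewrite mxE (bigD1 i)//= big1 ?addr0; first by rewrite hE// eqxx mul1r hL1.
  move=> k ki; have [ik|ki'] := leqP i k; first by rewrite hE// eq_sym (negbTE ki) mul0r.
  rewrite hL1; last exact: leq_trans (ltnW ki') ij.
  by case: eqP => [kj|_]; [move: ij; rewrite -kj leqNgt ki'|rewrite mulr0].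
- move=> i j; rewrite mxE; case: (unliftP ord0 i) => [i'|] ->; case: (unliftP ord0 j) => [j'|] -> //= ji.
  by rewrite hU.
- move=> i; rewrite mxE; case: (unliftP ord0 i) => [i' _|->] //.
- by rewrite -mulmxA -FE.
Qed.

Section PositiveUpper.
Variables (T : realFieldType) (m : nat).
Implicit Types (M N U V L : 'M[T]_m).

Definition posup U := upper U /\ forall i, 0 < U i i.

Lemma posup_neq0 U i : posup U -> U i i != 0.
Proof. by move=> [_ h]; rewrite gt_eqF. Qed.

Lemma posup_unit U : posup U -> U \in unitmx.
Proof. by move=> h; apply: upper_unit h.1 _ => i; exact: posup_neq0. Qed.

Lemma posupM U V : posup U -> posup V -> posup (U *m V).
Proof.
move=> [u1 u2] [v1 v2]; split; first exact: upperM.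
by move=> i; rewrite upperM_diag// mulr_gt0.
Qed.

Lemma posupV U : posup U -> posup (invmx U).
Proof.
move=> h; split; first by apply: upper_inv h.1 _ => i; exact: posup_neq0.
move=> i; rewrite upper_inv_diag; first by rewrite invr_gt0 h.2.
- exact: h.1.
- by move=> j; exact: posup_neq0.
Qed.

Lemma posup1 : posup 1%:M.
Proof. by split; [exact: upper1|move=> i; rewrite mxE eqxx]. Qed.

Lemma det_posup U : posup U -> 0 < \det U.
Proof. by move=> [u1 u2]; rewrite det_upper//; apply: prodr_gt0. Qed.

Lemma posup_convex U V (s : T) : 0 <= s <= 1 -> posup U -> posup V ->
  posup ((1 - s) *: U + s *: V).
Proof.
move=> /andP[s0 s1] [u1 u2] [v1 v2]; split.
  by move=> i j ij; rewrite !mxE u1// v1// !mulr0 addr0.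
move=> i; rewrite !mxE; have := u2 i; have := v2 i; have [->|] := eqVneq s 0; first by nra.
by move=> sn0; have : 0 < s by [rewrite lt_neqAle eq_sym sn0]; nra.
Qed.

(** The southwest minors: on a double coset of the positive upper triangular
    group they are determined up to positive factors. *)
Definition sw (i : 'I_m) M : T := minor (@bot m i) (@top m i) M.

Lemma sw_upper i U M V : upper U -> upper V ->
  sw i (U *m M *m V) = (\prod_(j < i.+1) U (bot j) (bot j)) * sw i M * \prod_(j < i.+1) V (top j) (top j).
Proof.
move=> hU hV; rewrite /sw /minor mxsub_mul_upper// mxsub_upper_mul// !det_mulmx.
by rewrite !det_mxsub_upper//; exact: bot_sinc.
Qed.

Lemma sw_posup i U M V : posup U -> posup V ->
  exists2 c, 0 < c & sw i (U *m M *m V) = c * sw i M.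
Proof.
move=> [u1 u2] [v1 v2]; rewrite sw_upper// mulrAC; eexists; last reflexivity.
by rewrite mulr_gt0// prodr_gt0.
Qed.

Definition revperm : 'S_m := perm (@rev_ord_inj m).
Definition revmx : 'M[T]_m := perm_mx revperm.

Lemma revmxE M i j : (revmx *m M) i j = M (rev_ord i) j.
Proof. by rewrite -row_permE mxE permE. Qed.

Lemma revmxV : revmx *m revmx = 1%:M.
Proof.
rewrite /revmx -perm_mxM (_ : (_ * _)%g = 1%g) ?perm_mx1//.
by apply/permP => i; rewrite permM !permE rev_ordK.
Qed.

Lemma revmx_conjE M i j : (revmx *m M *m revmx) i j = M (rev_ord i) (rev_ord j).
Proof.
have revT : revmx^T = revmx.
  rewrite tr_perm_mx; congr perm_mx; apply/permP => k; apply: (canLR (permK _)).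
  by rewrite !permE rev_ordK.
have -> : revmx *m M *m revmx = (revmx *m (revmx *m M)^T)^T.
  by rewrite trmx_mul trmxK revT.
by rewrite mxE revmxE mxE revmxE.
Qed.

Lemma lead_rev i M : lead i (revmx *m M) =
  (-1) ^+ (perm (@rev_ord_inj i.+1)) * sw i M.
Proof.
rewrite /lead /sw /minor.
have -> : mxsub (@top m i) (@top m i) (revmx *m M) =
    rowsub (@bot m i \o perm (@rev_ord_inj i.+1)) (colsub (@top m i) M).
  by apply/matrixP => a b; rewrite mxE revmxE [RHS]mxE [RHS]mxE /= permE /bot rev_ordK.
rewrite det_rowsub_perm; congr (_ * \det _).
by apply/matrixP => a b; rewrite !mxE.
Qed.

Lemma prefix_prod_gt0 (a : 'I_m -> T) :
  (forall i : 'I_m, 0 < \prod_(j < i.+1) a (top j)) -> forall i, 0 < a i.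
Proof.
move=> H i; have := H i; rewrite big_ord_recr /=.
rewrite (_ : top ord_max = i); last exact/val_inj.
case: i => -[|k] ki /=; first by rewrite big_ord0 mul1r.
have ki' : (k < m)%N := ltnW ki.
have := H (Ordinal ki') => H1 H2.
rewrite (eq_bigr (fun j : 'I_k.+1 => a (@top m (Ordinal ki') j))) in H2; last first.
  by move=> j _; congr a; apply/val_inj.
by rewrite pmulr_rgt0 in H2.
Qed.

(** Two matrices whose southwest minors have the same signs lie in the same
    double coset of the positive upper triangular group: after reversing the
    rows both have an LU factorization, and the diagonals of the two upper
    factors have the same signs. *)
Lemma same_sw_double_coset M N : (forall i, 0 < sw i M * sw i N) ->
  exists U V, [/\ posup U, posup V & M = U *m N *m V].
Proof.
move=> H.
have nz i : sw i M != 0 /\ sw i N != 0.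
  by apply/andP; rewrite -negb_or -mulf_eq0 gt_eqF.
have ld i K : sw i K != 0 -> lead i (revmx *m K) != 0.
  by move=> h; rewrite lead_rev mulf_neq0// signr_eq0.
have [L [U [hL hU dU ME]]] := LU_exists (fun i => ld i M (nz i).1).
have [L' [U' [hL' hU' dU' NE]]] := LU_exists (fun i => ld i N (nz i).2).
have conj K : lower1 K -> posup (revmx *m K *m revmx).
  move=> hK; split => [i j ij|i]; rewrite revmx_conjE hK//= ?eqxx// ?ltr01//.
    by rewrite (inj_eq (@rev_ord_inj _)); case: eqP ij => // ->; rewrite ltnn.
  by have := ltn_ord i; lia.
have A := conj _ hL; have B := conj _ hL'.
exists (revmx *m L *m revmx *m invmx (revmx *m L' *m revmx)), (invmx U' *m U).
have uU' : U' \in unitmx by exact: upper_unit.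
split.
- by apply: posupM => //; exact: posupV.
- have hV := upper_inv hU' dU'.
  split; first exact: upperM.
  apply: (@prefix_prod_gt0 (fun i => (invmx U' *m U) i i)) => i.
  have := H i; rewrite -(pmulr_rgt0 _ (_ : 0 < ((-1) ^+ (perm (@rev_ord_inj i.+1))) ^+ 2)); last first.
    by rewrite sqrr_sign ltr01.
  rewrite expr2 mulrACA -!lead_rev ME NE !lead_LU// /lead /minor !det_mxsub_upper ?top_sinc//.
  move=> P; rewrite (eq_bigr (fun j => (U' (top j) (top j))^-1 * U (top j) (top j))); last first.
    by move=> j _; rewrite upperM_diag// upper_inv_diag.
  rewrite big_split /= prodfV mulrC; move: P.
  set p := \prod_j U _ _; set q := \prod_j U' _ _ => pq.
  have q0 : q != 0 by apply/eqP => q0; move: pq; rewrite q0 mulr0 ltxx.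
  rewrite (_ : _ * _ = p * q * q^-1 ^+ 2); last by field.
  by rewrite mulr_gt0// exprn_even_gt0// invr_eq0.
- have N2 : N = revmx *m L' *m revmx *m (revmx *m U').
    by rewrite -mulmxA (mulmxA revmx revmx) revmxV mul1mx -mulmxA -NE mulmxA revmxV mul1mx.
  have M2 : M = revmx *m L *m revmx *m (revmx *m U).
    by rewrite -mulmxA (mulmxA revmx revmx) revmxV mul1mx -mulmxA -ME mulmxA revmxV mul1mx.
  rewrite M2 N2 -(mulmxA _ (invmx _)) (mulmxA (invmx _) _ (_ *m U')) mulVmx; last exact: posup_unit.
  by rewrite mul1mx -!mulmxA (mulmxA U') mulmxV// mul1mx.
Qed.

End PositiveUpper.

Section GramSchmidt.
Variables (T : rcfType) (m : nat).
Implicit Types (M Q : 'M[T]_m).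

Lemma rowv_sqr_eq0 k (v : 'rV[T]_k) : v *m v^T = 0 -> v = 0.
Proof.
move=> /matrixP/(_ 0 0); rewrite !mxE => /eqP.
rewrite psumr_eq0; last by move=> i _; rewrite mxE -expr2 sqr_ge0.
move=> /allP H; apply/rowP => i; rewrite !mxE.
have := H i (mem_index_enum _); rewrite mxE -expr2 sqrf_eq0 /=.
by move=> /eqP.
Qed.

(** The leading minors of M^T M are Gram determinants of linearly independent
    columns. *)
Lemma lead_gram_gt0 M i : M \in unitmx -> 0 < lead i (M^T *m M).
Proof.
move=> uM; set N := colsub (@top m i) M.
have leadE : lead i (M^T *m M) = \det (N^T *m N).
  rewrite /lead /minor; congr (\det _); apply/matrixP => a b; rewrite !mxE.
  by apply: eq_bigr => k _; rewrite !mxE.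
rewrite leadE lt_neqAle eq_sym; apply/andP; split; last first.
  apply: det_mulmx_ge0 => f _.
  rewrite (_ : colsub f N^T = (rowsub f N)^T); last by apply/matrixP => a b; rewrite !mxE.
  by rewrite det_tr -expr2 sqr_ge0.
apply/det0P => -[v v0 vN]; move/negP: v0; apply.
have w0 : v *m N^T = 0.
  apply: rowv_sqr_eq0; rewrite trmx_mul trmxK mulmxA -(mulmxA v) vN mul0mx//.
pose E : 'M[T]_(i.+1, m) := \matrix_(a, b) (top a == b)%:R.
have NE : N^T = E *m M^T.
  apply/matrixP => a b; rewrite !mxE (bigD1 (top a))//= !mxE eqxx mul1r big1 ?addr0//.
  by move=> k; rewrite mxE eq_sym => /negbTE->; rewrite mul0r.
have uMT : M^T \in unitmx by rewrite unitmx_tr.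
have vE : v *m E = 0.
  by rewrite -[LHS]mulmx1 -(mulmxV uMT) mulmxA -(mulmxA v) -NE w0 mul0mx.
apply/eqP/rowP => a; move/rowP: vE => /(_ (top a)); rewrite !mxE (bigD1 a)//= !mxE eqxx mulr1.
rewrite big1 ?addr0// => k ka; rewrite mxE.
by rewrite (inj_eq (sinc_inj (@top_sinc _ _))) (negbTE ka) mulr0.
Qed.

Definition gs_pre M : 'M[T]_m := M *m \adj ((lowf (M^T *m M))^T).

(** The Gram-Schmidt orthonormalization of the columns of M, by a formula
    that makes its continuity visible: if M^T M = L U with L unit lower
    triangular, the columns of M (L^T)^-1 are orthogonal. *)
Definition gs M : 'M[T]_m :=
  \matrix_(i, j) (gs_pre M i j / Num.sqrt (\sum_k gs_pre M k j ^+ 2)).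

Section Invertible.
Variable M : 'M[T]_m.
Hypothesis uM : M \in unitmx.

Let L := lowf (M^T *m M).
Let X := gs_pre M.

Let LU : exists U, [/\ lower1 L, upper U & M^T *m M = L *m U].
Proof.
have [L' [U [hL hU dU E]]] := @LU_exists _ _ (M^T *m M)
  (fun i => lt0r_neq0 (lead_gram_gt0 i uM)).
by exists U; split; rewrite // /L E lowf_LU.
Qed.

Let hL : lower1 L. Proof. by have [U []] := LU. Qed.

Let hLT : posup L^T.
Proof.
split => [i j ij|i]; rewrite mxE hL ?eqxx ?ltr01 ?(ltnW ij)//.
by case: eqP ij => // ->; rewrite ltnn.
Qed.

Let XE : X = M *m invmx L^T.
Proof.
rewrite /X /gs_pre /invmx -/L (posup_unit hLT) det_tr lower1_unit// invr1.
by rewrite scale1r.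
Qed.

Let MX : M = X *m L^T.
Proof. by rewrite XE -mulmxA mulVmx ?mulmx1//; exact: posup_unit. Qed.

Let uX : X \in unitmx.
Proof. by move: uM; rewrite MX unitmx_mul => /andP[]. Qed.

Let XtX_diag i j : i != j -> (X^T *m X) i j = 0.
Proof.
have [U [_ hU E]] := LU; have uL : L \in unitmx by rewrite unitmxE lower1_unit// unitr1.
have XtX : X^T *m X = U *m invmx L^T.
  rewrite {1}XE trmx_mul trmx_inv trmxK XE !mulmxA -(mulmxA _ M^T M) E mulmxA.
  by rewrite mulVmx// mul1mx.
have up : upper (X^T *m X) by rewrite XtX; apply: upperM => //; exact: (posupV hLT).1.
rewrite neq_ltn => /orP[ij|]; last exact: up.
have sym : (X^T *m X)^T = X^T *m X by rewrite trmx_mul trmxK.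
by rewrite -sym mxE up.
Qed.

Let nrm j : T := \sum_k X k j ^+ 2.

Let nrm_gt0 j : 0 < nrm j.
Proof.
rewrite lt_neqAle eq_sym sumr_ge0 ?andbT => [|k _]; last exact: sqr_ge0.
apply/negP => /eqP n0; have Xj k : X k j = 0.
  move/eqP: n0; rewrite psumr_eq0 => [/allP/(_ k (mem_index_enum _))|? _]; last exact: sqr_ge0.
  by rewrite sqrf_eq0 => /eqP.
have /matrixP/(_ j j) := mulVmx uX; rewrite !mxE eqxx big1 => [/eqP|k _]; last by rewrite Xj mulr0.
by rewrite eq_sym oner_eq0.
Qed.

Let gsE : gs M = X *m diag_mx (\row_j (Num.sqrt (nrm j))^-1).
Proof. by apply/matrixP => i j; rewrite mxE mul_mx_diag !mxE. Qed.

Lemma gs_orth : (gs M)^T *m gs M = 1%:M.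
Proof.
apply/matrixP => i j; rewrite gsE trmx_mul tr_diag_mx -mulmxA (mulmxA X^T).
rewrite mul_diag_mx mul_mx_diag !mxE; have [->|ij] := eqVneq i j; last first.
  have := XtX_diag ij; rewrite mxE => ->.
  by rewrite mul0r mulr0.
rewrite (eq_bigr (fun k => X k j ^+ 2)) => [|k _]; last by rewrite mxE expr2.
have s0 : Num.sqrt (nrm j) != 0 by rewrite gt_eqF// sqrtr_gt0.
rewrite -/(nrm j) -[X in _ * (X / _)]sqr_sqrtr ?(ltW (nrm_gt0 j))//.
by rewrite expr2 mulfK// mulVf.
Qed.

Lemma gs_posup : exists2 U, posup U & M = gs M *m U.
Proof.
exists (diag_mx (\row_j Num.sqrt (nrm j)) *m L^T).
  apply: posupM => //; split => [i j ij|i]; rewrite !mxE.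
    by case: eqP ij => // ->; rewrite ltnn.
  by rewrite eqxx mulr1n sqrtr_gt0.
rewrite mulmxA gsE -(mulmxA X) mulmx_diag {1}MX; congr (_ *m _).
rewrite -[LHS]mulmx1 -diag_const_mx; congr (_ *m diag_mx _).
by apply/rowP => j; rewrite !mxE mulVf// gt_eqF// sqrtr_gt0.
Qed.

(** Orthonormal columns are already a fixed point, because M^T M = 1 has
    trivial factors. *)
Lemma gs_id : M^T *m M = 1%:M -> gs M = M.
Proof.
move=> MM; have L1 : L = 1%:M.
  rewrite /L MM -{1}[1%:M]mulmx1 lowf_LU//.
  - by move=> i j _; rewrite mxE.
  - exact: upper1.
  - by move=> i; rewrite mxE eqxx oner_eq0.
have XM : X = M by rewrite MX L1 trmx1 mulmx1.
rewrite gsE XM (_ : \row_j _ = const_mx 1) ?diag_const_mx ?mulmx1//.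
apply/rowP => j; rewrite !mxE; have /matrixP/(_ j j) := MM; rewrite !mxE eqxx.
rewrite (eq_bigr (fun k => X k j ^+ 2)) => [|k _]; last by rewrite mxE XM expr2.
by rewrite /nrm => ->; rewrite sqrtr1 invr1.
Qed.

Lemma det_gs : 0 < \det M -> \det (gs M) = 1.
Proof.
move=> dM; have [U pU ME] := gs_posup.
have g0 : 0 < \det (gs M).
  by move: dM; rewrite {1}ME det_mulmx pmulr_lgt0// det_posup.
have /(congr1 determinant) := gs_orth; rewrite det_mulmx det_tr det1 -expr2.
by move=> /eqP; rewrite sqrp_eq1 ?(ltW g0)// => /eqP.
Qed.

End Invertible.
End GramSchmidt.

Section Bruhat.
Variable (T : realFieldType).

(** A bordered by row r and column c, which are zero except for the entry x at
    their crossing. *)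
Definition ins {m} (r c : 'I_m.+1) (x : T) (A : 'M[T]_m) : 'M[T]_m.+1 :=
  \matrix_(i, j) match unlift r i, unlift c j with
    | Some i', Some j' => A i' j' | None, None => x | _, _ => 0 end.

Lemma insM m (r c d : 'I_m.+1) x y (A B : 'M[T]_m) :
  ins r c x A *m ins c d y B = ins r d (x * y) (A *m B).
Proof.
apply/matrixP => i j; rewrite mxE (bigD1_ord c)//= !mxE unlift_none.
under eq_bigr => k _ do rewrite !mxE liftK.
case: (unliftP r i) => [i' _|_]; case: (unliftP d j) => [j' _|_].
- by rewrite mul0r add0r mxE.
- by rewrite mul0r add0r big1// => k _; rewrite mulr0.
- by rewrite mulr0 add0r big1// => k _; rewrite mul0r.
- by rewrite big1 ?addr0// => k _; rewrite mul0r.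
Qed.

Definition smx m (P : 'M[T]_m) (s : 'S_m) : Prop :=
  forall j, row j P = delta_mx 0 (s j) \/ row j P = - delta_mx 0 (s j).

Lemma ins_posup m (r : 'I_m.+1) x U : 0 < x -> posup U -> posup (ins r r x U).
Proof.
move=> x0 [u1 u2]; split => [i j|i]; rewrite mxE.
  case: (unliftP r i) => [i'|] ->; case: (unliftP r j) => [j'|] -> //.
    by rewrite ltnNge /= leq_bump2 -ltnNge; exact: u1.
  by rewrite ltnn.
by case: (unliftP r i).
Qed.

Lemma ins_smx m (r c : 'I_m.+1) (x : T) P s : x = 1 \/ x = -1 -> smx P s ->
  smx (ins r c x P) (lift_perm r c s).
Proof.
move=> hx hP j; case: (unliftP r j) => [j'|] ->; last first.
  have e : row r (ins r c x P) = x *: delta_mx 0 c.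
    apply/rowP => k; rewrite !mxE unlift_none eqxx /=.
    case: (unliftP c k) => [k'|] ->; last by rewrite eqxx mulr1.
    by rewrite eq_sym (negbTE (neq_lift _ _)) mulr0.
  rewrite lift_perm_id e; case: hx => ->; first by left; rewrite scale1r.
  by right; rewrite scaleN1r.
rewrite lift_perm_lift.
have e (y : T) : row j' P = y *: delta_mx 0 (s j') ->
    row (lift r j') (ins r c x P) = y *: delta_mx 0 (lift c (s j')).
  move=> /rowP h; apply/rowP => k; rewrite !mxE liftK.
  case: (unliftP c k) => [k'|] ->; last by rewrite (negbTE (neq_lift _ _)) mulr0.
  by have := h k'; rewrite !mxE => ->; rewrite (inj_eq (@lift_inj _ _)).
case: (hP j') => h; [left|right].
  by rewrite (e 1) ?scale1r.
by rewrite (e (-1)) ?scaleN1r.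
Qed.

(** The Bruhat decomposition, by pivoting on the lowest nonzero entry of the
    first column. *)
Lemma Bruhat_exists m (M : 'M[T]_m) : M \in unitmx ->
  exists U P s V, [/\ posup U, posup V, smx P s & M = U *m P *m V].
Proof.
elim: m M => [|m IH] M uM.
  by exists 1%:M, 1%:M, 1%g, 1%:M; split; [exact: posup1|exact: posup1|case|apply/matrixP => -[]].
have [r Mr0 rmax] : exists2 r, M r ord0 != 0 & forall i : 'I_m.+1, (r < i)%N -> M i ord0 = 0.
  have [i0 Mi0] : exists i, M i ord0 != 0.
    apply: contrapT => H; have Z i : M i ord0 = 0.
      by apply/eqP/negPn/negP => h; apply: H; exists i.
    have := mulVmx uM => /matrixP/(_ ord0 ord0); rewrite !mxE big1 => [/eqP|k _]; last by rewrite Z mulr0.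
    by rewrite eq_sym oner_eq0.
  (* the pivot is the lowest nonzero entry, so that rows can only be added upwards *)
  pose r := [arg max_(i > i0 | M i ord0 != 0) (i : nat)].
  exists r; rewrite /r; case: arg_maxnP => // i Mi hi j ij; apply/eqP/negPn/negP => /hi.
  by rewrite /= leqNgt ij.
pose a := M r ord0.
pose A : 'M[T]_m.+1 := \matrix_(i, j)
  if i == j then 1 else if (i < j)%N && (j == r) then M i ord0 / a else 0.
pose B : 'M[T]_m.+1 := \matrix_(i, j)
  if i == j then 1 else if (i < j)%N && (i == ord0) then M r j / a else 0.
have pA : posup A.
  split => [i j ij|i]; rewrite mxE ?eqxx ?ltr01//.
  by rewrite (ltnNge i) (ltnW ij) /=; case: eqP ij => // ->; rewrite ltnn.
have pB : posup B.
  split => [i j ij|i]; rewrite mxE ?eqxx ?ltr01//.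
  by rewrite (ltnNge i) (ltnW ij) /=; case: eqP ij => // ->; rewrite ltnn.
pose S : 'M[T]_m := \matrix_(i, j) (M (lift r i) (lift ord0 j) -
   M (lift r i) ord0 * M r (lift ord0 j) / a).
have a0 : a != 0 by [].
have ME : M = A *m ins r ord0 a S *m B.
  apply/matrixP => i j; rewrite mxE big_ord_recl.
  have C1 k : (A *m ins r ord0 a S) k ord0 = M k ord0.
    rewrite mxE (bigD1_ord r)//= !mxE !unlift_none big1 ?addr0 => [|l _]; last first.
      by rewrite !mxE liftK unlift_none mulr0.
    case: (eqVneq k r) => [->|kr]; first by rewrite mul1r.
    rewrite eqxx andbT; case: ltnP => [_|rk]; first by rewrite divfK.
    by rewrite mul0r rmax// ltn_neqAle rk andbT eq_sym; apply: contra kr => /eqP e; apply/eqP/val_inj.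
  have C2 k l : (A *m ins r ord0 a S) k (lift ord0 l) =
      if unlift r k is Some k' then S k' l else 0.
    rewrite mxE (bigD1_ord r)//= [ins _ _ _ _ r _]mxE unlift_none liftK mulr0 add0r.
    have AE q : A k (lift r q) = (k == lift r q)%:R.
      by rewrite mxE (eq_sym (lift r q) r) (negbTE (neq_lift _ _)) andbF; case: eqP.
    under eq_bigr => q _ do rewrite AE mxE !liftK.
    case: (unliftP r k) => [k'|] ->.
      rewrite (bigD1 k')//= eqxx mul1r big1 ?addr0// => q qk.
      by rewrite (inj_eq (@lift_inj _ _)) eq_sym (negbTE qk) mul0r.
    by rewrite big1// => q _; rewrite (negbTE (neq_lift _ _)) mul0r.
  rewrite C1; under eq_bigr => k _ do rewrite C2.
  have BE k q : B (lift ord0 k) q = (lift ord0 k == q)%:R.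
    by rewrite mxE (eq_sym (lift ord0 k) ord0) (negbTE (neq_lift _ _)) andbF; case: eqP.
  under eq_bigr => k _ do rewrite BE.
  case: (unliftP ord0 j) => [j'|] ->; last first.
    rewrite mxE eqxx mulr1 big1 ?addr0// => k _.
    by rewrite eq_sym (negbTE (neq_lift _ _)) mulr0.
  rewrite (bigD1 j')//= eqxx mulr1 big1 ?addr0 => [|k kj]; last first.
    by rewrite (inj_eq (@lift_inj _ _)) (negbTE kj) mulr0.
  rewrite mxE (negbTE (neq_lift _ _)) eqxx andbT /=.
  case: (unliftP r i) => [i'|] ->; first by rewrite mxE mulrA addrC subrK.
  by rewrite addr0 mulrCA mulfV// mulr1.
have uS : S \in unitmx.
  have : ins r ord0 a S \in unitmx by move: uM; rewrite ME !unitmx_mul => /andP[/andP[_ ->]].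
  rewrite !unitmxE !unitfE; apply: contra => /det0P[v v0 vS].
  apply/det0P; exists (\row_i if unlift r i is Some i' then v 0 i' else 0).
    apply: contra v0 => /eqP/rowP h; apply/eqP/rowP => i.
    by have := h (lift r i); rewrite !mxE liftK.
  apply/rowP => j; rewrite !mxE (bigD1_ord r)//= mxE unlift_none mul0r add0r.
  under eq_bigr => k _ do rewrite !mxE !liftK.
  case: (unliftP ord0 j) => [j' _|_]; last by rewrite big1// => k _; rewrite mulr0.
  move/rowP: vS => /(_ j'); rewrite mxE [RHS]mxE => vSj; rewrite -[RHS]vSj.
  by apply: eq_bigr => k _.
have [U [P [s [V [pU pV hP SE]]]]] := IH S uS.
exists (A *m ins r r 1 U), (ins r ord0 (Num.sg a) P), (lift_perm r ord0 s),
  (ins ord0 ord0 `|a| V *m B); split.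
- by apply: posupM => //; exact: ins_posup.
- by apply: posupM => //; apply: ins_posup => //; rewrite normr_gt0.
- apply: ins_smx => //; rewrite /Num.sg (negbTE a0).
  by case: ifP => _; [right|left].
- have -> : M = A *m (ins r r 1 U *m ins r ord0 (Num.sg a) P *m ins ord0 ord0 `|a| V) *m B.
    by rewrite !insM mul1r -SE -numEsg.
  by rewrite !mulmxA.
Qed.

End Bruhat.

(** * Matrix-valued functions and total positivity *)

Section FunctionAlgebra.
Variables (R : realType) (X : Type) (K : (X -> R) -> Prop).
Implicit Types (f g : X -> R).

(** Differentiability, continuity and bounded absolute continuity of real
    functions are all closed under sums and products; the record lets their
    consequences for determinants, adjugates and Gram-Schmidt factors be derived
    once for the three of them. *)
Record funalg : Prop := FunAlg {
  falg_cst : forall c, K (fun=> c);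
  falgD : forall f g, K f -> K g -> K (fun x => f x + g x);
  falgM : forall f g, K f -> K g -> K (fun x => f x * g x) }.

Hypothesis KA : funalg.

Lemma falg_sum (I : Type) (r : seq I) (P : pred I) (F : I -> X -> R) :
  (forall i, P i -> K (F i)) -> K (fun x => \sum_(i <- r | P i) F i x).
Proof.
move=> KF; elim: r => [|i r IH].
  by under eq_fun do rewrite big_nil; exact: (falg_cst KA).
case Pi : (P i); under eq_fun do rewrite big_cons Pi; last exact: IH.
by apply: (falgD KA) => //; exact: KF.
Qed.

Lemma falg_prod (I : Type) (r : seq I) (P : pred I) (F : I -> X -> R) :
  (forall i, P i -> K (F i)) -> K (fun x => \prod_(i <- r | P i) F i x).
Proof.
move=> KF; elim: r => [|i r IH].
  by under eq_fun do rewrite big_nil; exact: (falg_cst KA).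
case Pi : (P i); under eq_fun do rewrite big_cons Pi; last exact: IH.
by apply: (falgM KA) => //; exact: KF.
Qed.

Lemma falgX f k : K f -> K (fun x => f x ^+ k).
Proof.
move=> Kf; elim: k => [|k IH]; first by under eq_fun do rewrite expr0; exact: (falg_cst KA).
by under eq_fun do rewrite exprS; exact: (falgM KA).
Qed.

Lemma falgN f : K f -> K (fun x => - f x).
Proof.
move=> Kf; rewrite (_ : (fun x => _) = fun x => -1 * f x).
  by apply: (falgM KA) => //; exact: (falg_cst KA).
by apply/funext => x; rewrite mulN1r.
Qed.

Definition mxK p q (F : X -> 'M[R]_(p, q)) := forall i j, K (fun x => F x i j).

Lemma mxK_cst p q (A : 'M[R]_(p, q)) : mxK (fun=> A).
Proof. by move=> i j; exact: (falg_cst KA). Qed.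

Lemma mxKD p q (F G : X -> 'M[R]_(p, q)) : mxK F -> mxK G -> mxK (fun x => F x + G x).
Proof. by move=> KF KG i j; under eq_fun do rewrite mxE; exact: (falgD KA). Qed.

Lemma mxKZ p q f (F : X -> 'M[R]_(p, q)) : K f -> mxK F -> mxK (fun x => f x *: F x).
Proof. by move=> Kf KF i j; under eq_fun do rewrite mxE; exact: (falgM KA). Qed.

Lemma mxK_sum (I : Type) (r : seq I) p q (F : I -> X -> 'M[R]_(p, q)) :
  (forall i, mxK (F i)) -> mxK (fun x => \sum_(i <- r) F i x).
Proof.
by move=> KF i j; under eq_fun do rewrite summxE; apply: falg_sum => k _; exact: KF.
Qed.

Lemma mxKM p q r (F : X -> 'M[R]_(p, q)) (G : X -> 'M[R]_(q, r)) :
  mxK F -> mxK G -> mxK (fun x => F x *m G x).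
Proof.
by move=> KF KG i j; under eq_fun do rewrite mxE; apply: falg_sum => k _; exact: (falgM KA).
Qed.

Lemma mxK_tr p q (F : X -> 'M[R]_(p, q)) : mxK F -> mxK (fun x => (F x)^T).
Proof. by move=> KF i j; under eq_fun do rewrite mxE; exact: KF. Qed.

Lemma mxK_sub p q p' q' (f : 'I_p' -> 'I_p) (g : 'I_q' -> 'I_q) (F : X -> 'M[R]_(p, q)) :
  mxK F -> mxK (fun x => mxsub f g (F x)).
Proof. by move=> KF i j; under eq_fun do rewrite mxE; exact: KF. Qed.

Lemma falg_det p (F : X -> 'M[R]_p) : mxK F -> K (fun x => \det (F x)).
Proof.
move=> KF; apply: falg_sum => s _; apply: (falgM KA); first exact: (falg_cst KA).
by apply: falg_prod => i _; exact: KF.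
Qed.

Lemma falg_minor k p q (f : 'I_k -> 'I_p) (g : 'I_k -> 'I_q) (F : X -> 'M[R]_(p, q)) :
  mxK F -> K (fun x => minor f g (F x)).
Proof. by move=> KF; apply/falg_det/mxK_sub. Qed.

Lemma mxK_adj p (F : X -> 'M[R]_p) : mxK F -> mxK (fun x => \adj (F x)).
Proof.
move=> KF i j; under eq_fun do rewrite mxE; apply: (falgM KA); first exact: (falg_cst KA).
apply: falg_det => a b; under eq_fun do rewrite !mxE; exact: KF.
Qed.

Lemma mxK_lowf m (F : X -> 'M[R]_m) : mxK F ->
  (forall i, K (fun x => (lead i (F x))^-1)) -> mxK (fun x => lowf (F x)).
Proof.
move=> KF KV i j; case: (boolP (i <= j)%N) => ij; under eq_fun do rewrite mxE ?ij ?(negbTE ij);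
  first exact: (falg_cst KA).
by apply: (falgM KA); [exact: falg_minor|exact: KV].
Qed.

Lemma mxK_gs m (F : X -> 'M[R]_m) : mxK F ->
  (forall i, K (fun x => (lead i ((F x)^T *m F x))^-1)) ->
  (forall j, K (fun x => (Num.sqrt (\sum_k gs_pre (F x) k j ^+ 2))^-1)) ->
  mxK (fun x => gs (F x)).
Proof.
move=> KF KV KS i j; under eq_fun do rewrite mxE; apply: (falgM KA); last exact: KS.
apply: mxKM => //; apply/mxK_adj/mxK_tr/mxK_lowf => //.
by apply: mxKM => //; exact: mxK_tr.
Qed.

Lemma mxK_gs_pre m (F : X -> 'M[R]_m) : mxK F ->
  (forall i, K (fun x => (lead i ((F x)^T *m F x))^-1)) ->
  mxK (fun x => gs_pre (F x)).
Proof.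
move=> KF KV; apply: mxKM => //; apply/mxK_adj/mxK_tr/mxK_lowf => //.
by apply: mxKM => //; exact: mxK_tr.
Qed.

End FunctionAlgebra.

Section Instances.
Variable R : realType.

Lemma derivable_falg (t : R) : funalg (fun f : R -> R => derivable f t 1).
Proof.
split=> [c|f g|f g].
- exact: derivable_cst.
- exact: derivableD.
- exact: derivableM.
Qed.

Lemma continuous_falg (X : topologicalType) (x : X) :
  funalg (fun f : X -> R => {for x, continuous f}).
Proof.
split=> [c|f g|f g].
- exact: cst_continuous.
- exact: continuousD.
- exact: continuousM.
Qed.

(** Boundedness makes the class closed under products. *)
Definition bounded_AC (a b : R) (f : R -> R) : Prop :=
  abs_continuous a b (f : R -> R^o) /\
  exists C, forall t, a < t < b -> `|f t| <= C.

Lemma bounded_AC_falg (a b : R) : funalg (bounded_AC a b).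
Proof.
split=> [c|f g [Af [C fC]] [Ag [D gD]]|f g [Af [C fC]] [Ag [D gD]]].
- split; last by exists `|c|.
  move=> e e0; exists 1 => // N l r _ _ _.
  by rewrite big1// => i _; rewrite subrr normr0.
- split; last first.
    exists (C + D) => t tab; apply: le_trans (ler_normD _ _) _.
    by rewrite lerD ?fC ?gD.
  move=> e e0; have e20 : 0 < e / 2 by rewrite divr_gt0.
  have [d d0 H] := Af _ e20; have [d' d'0 H'] := Ag _ e20.
  exists (Num.min d d'); first by rewrite lt_min d0.
  move=> N l r lr tr; rewrite lt_min => /andP[s1 s2].
  rewrite [e]splitr; apply: le_lt_trans (ltrD (H _ _ _ lr tr s1) (H' _ _ _ lr tr s2)).
  rewrite -big_split /=; apply: ler_sum => i _.
  by rewrite opprD addrACA ler_normD.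
- split; last first.
    exists (`|C| * `|D|) => t tab; rewrite normrM ler_pM//.
      by rewrite (le_trans (fC _ tab))// ler_norm.
    by rewrite (le_trans (gD _ tab))// ler_norm.
  move=> e e0.
  have C0 : 0 < `|C| + 1 by rewrite ltr_pwDr.
  have D0 : 0 < `|D| + 1 by rewrite ltr_pwDr.
  have e1 : 0 < e / 2 / (`|D| + 1) by rewrite !divr_gt0.
  have e2 : 0 < e / 2 / (`|C| + 1) by rewrite !divr_gt0.
  have [d d0 H] := Af _ e1; have [d' d'0 H'] := Ag _ e2.
  exists (Num.min d d'); first by rewrite lt_min d0.
  move=> N l r lr tr; rewrite lt_min => /andP[s1 s2].
  have := H _ _ _ lr tr s1; rewrite ltr_pdivlMr// => h1.
  have := H' _ _ _ lr tr s2; rewrite ltr_pdivlMr// => h2.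
  rewrite [e]splitr; apply: le_lt_trans (ltrD h1 h2).
  rewrite !mulr_suml -big_split /=; apply: ler_sum => i _.
  have [h3 h4 h5] := lr i.
  have rab : a < r i < b by rewrite (lt_le_trans h3).
  have lab : a < l i < b by rewrite h3 (le_lt_trans h4).
  have -> : f (r i) * g (r i) - f (l i) * g (l i) =
     (f (r i) - f (l i)) * g (r i) + f (l i) * (g (r i) - g (l i)) by ring.
  apply: le_trans (ler_normD _ _) _; rewrite !normrM; apply: lerD.
    by rewrite ler_wpM2l// (le_trans (gD _ rab))// (le_trans (ler_norm _))// lerDl.
  by rewrite mulrC ler_wpM2l// (le_trans (fC _ lab))// (le_trans (ler_norm _))// lerDl.
Qed.

(** A lower bound on f is needed on the whole interval, which is why the flow
    below asks for a uniform bound on its leading minors. *)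
Lemma bounded_AC_inv (a b c : R) (f : R -> R) : 0 < c ->
  (forall t, a < t < b -> c <= f t) -> bounded_AC a b f ->
  bounded_AC a b (fun t => (f t)^-1).
Proof.
move=> c0 fc [Af _].
have fpos t : a < t < b -> 0 < f t by move=> /fc; exact: lt_le_trans.
split; last first.
  exists c^-1 => t tab; rewrite gtr0_norm ?invr_gt0 ?fpos//.
  by rewrite lef_pV2 ?posrE ?fpos// fc.
move=> e e0; have [d d0 H] := Af _ (mulr_gt0 e0 (exprn_gt0 2 c0)).
exists d => // N l r lr tr sd.
have := H _ _ _ lr tr sd; rewrite -ltr_pdivrMr ?exprn_gt0//; apply: le_lt_trans.
rewrite mulr_suml; apply: ler_sum => i _.
have [h3 h4 h5] := lr i.
have rab : a < r i < b by rewrite (lt_le_trans h3).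
have lab : a < l i < b by rewrite h3 (le_lt_trans h4).
have -> : (f (r i))^-1 - (f (l i))^-1 = - (f (r i) - f (l i)) / (f (r i) * f (l i)).
  by field; rewrite !gt_eqF ?fpos.
rewrite normrM normrN ler_wpM2l// gtr0_norm; last by rewrite invr_gt0 mulr_gt0 ?fpos.
by rewrite lef_pV2 ?posrE ?exprn_gt0 ?mulr_gt0 ?fpos// expr2 ler_pM ?fc ?(ltW c0).
Qed.

Lemma abs_continuous_sub (V : normedModType R) (a b a' b' : R) (f : R -> V) : a <= a' -> b' <= b ->
  abs_continuous a b f -> abs_continuous a' b' f.
Proof.
move=> aa bb Af e e0; have [d d0 H] := Af _ e0; exists d => // N l r lr.
by apply: H => i; have [h1 h2 h3] := lr i; split=> //; [exact: le_lt_trans h1|exact: lt_le_trans h3 _].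
Qed.

End Instances.

Section MatrixDerivative.
Variable R : realType.
Implicit Types (t : R).

Definition der t (f : R -> R) (df : R) : Prop := is_derive t 1 f df.

Lemma der_cst t c : der t (fun=> c) 0.
Proof. exact: is_derive_cst. Qed.

Lemma der_ext t f g df : (forall x, f x = g x) -> der t f df -> der t g df.
Proof. by move=> /funext->. Qed.

Lemma derD t f g df dg : der t f df -> der t g dg -> der t (fun x => f x + g x) (df + dg).
Proof. by move=> h1 h2; exact: is_deriveD. Qed.

Lemma derM t f g df dg : der t f df -> der t g dg ->
  der t (fun x => f x * g x) (df * g t + f t * dg).
Proof.
move=> h1 h2; rewrite /der addrC [df * _]mulrC; exact: is_deriveM.
Qed.

Lemma der_sum t (I : Type) (r : seq I) (F : I -> R -> R) (dF : I -> R) :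
  (forall i, der t (F i) (dF i)) ->
  der t (fun x => \sum_(i <- r) F i x) (\sum_(i <- r) dF i).
Proof.
move=> H; elim: r => [|i r IH].
  by rewrite big_nil; apply: der_ext (der_cst t 0) => x; rewrite big_nil.
rewrite big_cons; apply: der_ext (derD (H i) IH) => x; by rewrite big_cons.
Qed.

Lemma der_prod t (I : eqType) (r : seq I) (F : I -> R -> R) (dF : I -> R) : uniq r ->
  (forall i, der t (F i) (dF i)) ->
  der t (fun x => \prod_(i <- r) F i x)
    (\sum_(k <- r) \prod_(i <- r) if i == k then dF i else F i t).
Proof.
move=> + H; elim: r => [_|i r IH /= /andP[ir ur]].
  by rewrite big_nil; apply: der_ext (der_cst t 1) => x; rewrite big_nil.
have := derM (H i) (IH ur); rewrite /der => h.
rewrite big_cons big_cons eqxx (_ : \prod_(j <- r) _ = \prod_(j <- r) F j t); last first.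
  by apply: eq_big_seq => j jr; case: eqP => // ji; rewrite -ji jr in ir.
rewrite (_ : \sum_(j <- r) _ = F i t * \sum_(k <- r) \prod_(i <- r) if i == k then dF i else F i t).
  by apply: der_ext h => x; rewrite big_cons.
rewrite mulr_sumr; apply: eq_big_seq => j jr; rewrite big_cons.
by case: eqP => // ij; rewrite ij jr in ir.
Qed.

Lemma derU t f df df' : der t f df -> der t f df' -> df = df'.
Proof. by move=> [_ <-] [_ <-]. Qed.

Definition mxder p q t (F : R -> 'M[R]_(p, q)) (dF : 'M[R]_(p, q)) : Prop :=
  forall i j, der t (fun x => F x i j) (dF i j).

Lemma mxderM p q r t (F : R -> 'M[R]_(p, q)) (G : R -> 'M[R]_(q, r)) dF dG :
  mxder t F dF -> mxder t G dG -> mxder t (fun x => F x *m G x) (dF *m G t + F t *m dG).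
Proof.
move=> hF hG i j; rewrite !mxE -big_split /=.
apply: der_ext (der_sum _ (fun k => derM (hF i k) (hG k j))) => x.
by rewrite mxE.
Qed.

Lemma mxder_cst p q t (A : 'M[R]_(p, q)) : mxder t (fun=> A) 0.
Proof. by move=> i j; rewrite mxE; exact: der_cst. Qed.

Lemma mxder_derivable p q t (F : R -> 'M[R]_(p, q)) :
  (forall i j, derivable (fun x => F x i j) t 1) -> exists dF, mxder t F dF.
Proof.
move=> H; exists (\matrix_(i, j) ('D_1 (fun x => F x i j) t)) => i j.
by rewrite mxE /der; exact: derivableP.
Qed.

Lemma der_det p t (F : R -> 'M[R]_p) dF : mxder t F dF ->
  der t (fun x => \det (F x))
    (\sum_k \det (\matrix_(i, j) if j == k then dF i j else F t i j)).
Proof.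
move=> hF.
have detE (A : 'M[R]_p) : \det A = \sum_(s : 'S_p) (-1) ^+ s * \prod_j A (s j) j.
  by rewrite -det_tr; apply: eq_bigr => s _; congr (_ * _); apply: eq_bigr => j _; rewrite mxE.
rewrite (eq_bigr (fun k => \sum_(s : 'S_p) (-1) ^+ s *
   \prod_j if j == k then dF (s j) j else F t (s j) j)); last first.
  move=> k _; rewrite detE; apply: eq_bigr => s _; congr (_ * _).
  by apply: eq_bigr => j _; rewrite mxE.
rewrite exchange_big /=.
have P (s : 'S_p) : der t (fun x => (-1) ^+ s * \prod_j F x (s j) j)
    (\sum_k (-1) ^+ s * \prod_j if j == k then dF (s j) j else F t (s j) j).
  rewrite -mulr_sumr; have := derM (der_cst t ((-1) ^+ s))
    (der_prod (index_enum_uniq 'I_p) (fun j => hF (s j) j)).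
  by rewrite mul0r add0r.
by apply: der_ext (der_sum _ P) => x; rewrite detE.
Qed.

Lemma der_minor k p t (f : 'I_k -> 'I_p) (g : 'I_k -> 'I_p) (F : R -> 'M[R]_p) dF : mxder t F dF ->
  der t (fun x => minor f g (F x))
    (\sum_l \det (\matrix_(i, j) if j == l then dF (f i) (g j) else F t (f i) (g j))).
Proof.
move=> hF; have := @der_det k t (fun x => mxsub f g (F x)) (mxsub f g dF).
rewrite /der => h; rewrite (eq_bigr (fun l =>
  \det (\matrix_(i, j) if j == l then mxsub f g dF i j else mxsub f g (F t) i j))).
  by apply: h => i j; rewrite mxE; apply: der_ext (hF (f i) (g j)) => x; rewrite mxE.
by move=> l _; congr (\det _); apply/matrixP => i j; rewrite !mxE.
Qed.

End MatrixDerivative.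

Section TotalPositivity.
Variables (R : realType) (m : nat).
Implicit Types (L M : 'M[R]_m).

Definition tnn L : Prop := forall k (f g : 'I_k -> 'I_m),
  sinc f -> sinc g -> 0 <= minor f g L.

(** A minor of a lower triangular matrix vanishes unless the column indices
    are below the row indices, so this is positivity of all the others. *)
Definition tpos L : Prop := forall k (f g : 'I_k -> 'I_m),
  sinc f -> sinc g -> (forall i, (g i <= f i)%N) -> 0 < minor f g L.

Definition raise k (g : 'I_k -> 'I_m) (l : 'I_k) (x : 'I_m) : 'I_k -> 'I_m :=
  fun i => if i == l then x else g i.

(** Raising an index of an increasing selection by one either leaves it
    increasing or makes it meet the next index, and then the minor is zero. *)
Lemma raise_case k (g : 'I_k -> 'I_m) l (x : 'I_m) : sinc g -> x = (g l).+1 :> nat ->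
  sinc (raise g l x) \/ ~ injective (raise g l x).
Proof.
move=> sg xE; have [[j jl gj]|H] := pselect (exists2 j, j != l & g j = x).
  by right => /(_ j l); rewrite /raise (negbTE jl) eqxx => /(_ gj)/eqP; rewrite (negbTE jl).
left => i j ij; rewrite /raise; case: eqP => [il|/eqP il]; case: eqP => [jl|/eqP jl].
- by move: ij; rewrite il jl ltnn.
- rewrite xE ltn_neqAle; apply/andP; split; last by apply: sg; rewrite -il.
  by apply/eqP => e; apply: H; exists j => //; apply/val_inj; rewrite /= -e -xE.
- by rewrite xE ltnS ltnW// sg// -jl.
- exact: sg.
Qed.

Lemma minor_noninj k (f g : 'I_k -> 'I_m) L : ~ injective g -> minor f g L = 0.
Proof.
move=> ng; rewrite /minor -det_tr.
rewrite (_ : _^T = rowsub g (rowsub f L)^T); last by apply/matrixP => i j; rewrite !mxE.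
exact: det_rowsub_noninj.
Qed.

(** If L' = L B with B supported on the subdiagonal, the derivative of a minor
    of L is the sum of the minors obtained by raising one column index. *)
Lemma der_minor_subdiag t (L : R -> 'M[R]_m) (B : 'M[R]_m) k (f g : 'I_k -> 'I_m) :
  mxder t L (L t *m B) -> (forall i j : 'I_m, i != j.+1 :> nat -> B i j = 0) ->
  der t (fun x => minor f g (L x))
    (\sum_l \sum_(x : 'I_m | x == (g l).+1 :> nat) B x (g l) * minor f (raise g l x) (L t)).
Proof.
move=> hL hB; have := der_minor f g hL; rewrite /der => h.
rewrite (eq_bigr (fun l => \det (\matrix_(i, j)
  if j == l then (L t *m B) (f i) (g j) else L t (f i) (g j))))//.
move=> l _; case: (pickP (fun x : 'I_m => x == (g l).+1 :> nat)) => [x xg|none]; last first.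
  rewrite big_pred0 => [|x]; last exact: none.
  rewrite (expand_det_col _ l) big1// => i _; rewrite mxE eqxx mxE big1 ?mul0r// => x _.
  by rewrite hB ?mulr0// none.
rewrite (big_pred1 x); last by move=> y; rewrite -(eqP xg).
have -> : (\matrix_(i, j) (if j == l then (L t *m B) (f i) (g j) else L t (f i) (g j))) =
   mxsub f (raise g l x) (L t) *m diag_mx (\row_j if j == l then B x (g l) else 1).
  apply/matrixP => i j; rewrite mul_mx_diag !mxE /raise; case: eqP => [->|_]; last by rewrite mulr1.
  rewrite (bigD1 x)//= big1 ?addr0// => y yx; rewrite hB ?mulr0//.
  by rewrite -(eqP xg).
rewrite det_mulmx det_diag (bigD1 l)//= mxE eqxx big1 ?mulr1 1?mulrC// => j jl.
by rewrite mxE (negbTE jl).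
Qed.

Lemma der_near (t : R) (f g : R -> R) df : {near t, f =1 g} -> der t f df -> der t g df.
Proof. by rewrite /der => fg; apply: near_eq_is_derive; rewrite ?oner_eq0. Qed.

Lemma lead_gt0_LU M : (forall i, 0 < lead i M) ->
  [/\ lower1 (lowf M), posup (\adj (lowf M) *m M) & M = lowf M *m (\adj (lowf M) *m M)].
Proof.
move=> hM; have [L [U [hL hU dU ME]]] := LU_exists (fun i => lt0r_neq0 (hM i)).
have -> : lowf M = L by rewrite ME lowf_LU.
have uL : L \in unitmx by rewrite unitmxE lower1_unit// unitr1.
have adjL : \adj L = invmx L by rewrite /invmx uL lower1_unit// invr1 scale1r.
have UE : invmx L *m M = U by rewrite ME mulmxA mulVmx// mul1mx.
rewrite adjL UE; split => //; split => //.
apply: prefix_prod_gt0 => i; have := hM i.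
by rewrite ME lead_LU// /lead /minor det_mxsub_upper//; exact: top_sinc.
Qed.

Section Flow.
Variables (a b c : R) (M : R -> 'M[R]_m) (E : set R).
Hypothesis AC_M : mxK (bounded_AC a b) M.
Hypothesis c0 : 0 < c.
Hypothesis lead_M : forall t, a < t < b -> forall i, c <= lead i (M t).
Hypothesis E0 : (@lebesgue_measure R).-negligible E.
Hypothesis der_M : forall t, a < t < b -> ~ E t -> exists Lam : 'M[R]_m,
  [/\ mxder t M (M t *m Lam), forall i j : 'I_m, (j.+1 < i)%N -> Lam i j = 0 &
      forall i j : 'I_m, i = j.+1 :> nat -> 0 < Lam i j].

Let L t := lowf (M t).
Let U t := \adj (L t) *m M t.

Let LU t : a < t < b -> [/\ lower1 (L t), posup (U t) & M t = L t *m U t].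
Proof.
by move=> tab; apply: lead_gt0_LU => i; apply: lt_le_trans (lead_M tab i).
Qed.

Let near_ab t : a < t < b -> \forall x \near t, a < x < b.
Proof.
move=> /andP[at_ tb]; near=> x; apply/andP; split; near: x; [exact: lt_nbhsr|exact: lt_nbhsl].
Unshelve. all: by end_near. Qed.

(** Differentiating M = L U gives L^-1 L' = U Lam U^-1 - U' U^-1, whose left side
    is strictly lower triangular while U' U^-1 is upper triangular; so the left
    side is the strictly lower part of U Lam U^-1, which is subdiagonal. *)
Lemma flow_lowf t : a < t < b -> ~ E t -> exists B : 'M[R]_m,
  [/\ mxder t L (L t *m B), forall i j : 'I_m, i != j.+1 :> nat -> B i j = 0 &
      forall i j : 'I_m, i = j.+1 :> nat -> 0 < B i j].
Proof.
move=> tab nE; have [Lam [dM Lam0 Lampos]] := der_M tab nE.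
have DA := @derivable_falg R t.
have KM : mxK (fun f : R -> R => derivable f t 1) M by move=> i j; case: (dM i j).
have KL : mxK (fun f : R -> R => derivable f t 1) L.
  apply: mxK_lowf => // i; apply: derivableV; last exact: (falg_minor DA).
  by apply/lt0r_neq0/(lt_le_trans c0)/lead_M.
have KU : mxK (fun f : R -> R => derivable f t 1) U.
  by apply: (mxKM DA) => //; exact: mxK_adj.
have [dL hdL] := mxder_derivable KL; have [dU hdU] := mxder_derivable KU.
have [hL hU ME] := LU tab.
have dL0 (i j : 'I_m) : (i <= j)%N -> dL i j = 0.
  move=> ij; apply: derU (hdL i j) _; apply: der_ext (der_cst t (i == j)%:R) => x.
  by rewrite mxE ij.
have dU0 : upper dU.
  move=> i j ji; apply: derU (hdU i j) _; apply: der_near (der_cst t 0).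
  by apply: filterS (near_ab tab) => x /LU[_ [h _] _]; rewrite h.
have dME : M t *m Lam = dL *m U t + L t *m dU.
  apply/matrixP => i j; apply: derU (dM i j) _.
  apply: der_near (mxderM hdL hdU i j).
  by apply: filterS (near_ab tab) => x /LU[_ _ h]; rewrite [in RHS]h.
have uL : L t \in unitmx by rewrite unitmxE lower1_unit// unitr1.
have uU := posup_unit hU.
pose B := invmx (L t) *m dL.
have BE : B = U t *m Lam *m invmx (U t) - dU *m invmx (U t).
  have : B *m U t = U t *m Lam - dU.
    apply: (canRL (addrK _)); rewrite /B -mulmxA -[dU](mulKmx uL) -mulmxDr -dME {1}ME.
    by rewrite -mulmxA mulKmx.
  by move=> /(congr1 (mulmx^~ (invmx (U t)))); rewrite mulmxK// mulmxBl.
have hV := posupV hU.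
have ULV (i j : 'I_m) : (j < i)%N -> B i j =
    (if i == j.+1 :> nat then U t i i * Lam i j * invmx (U t) j j else 0).
  move=> ji; rewrite BE mxE [X in _ + X]mxE (upperM dU0 hV.1)// subr0.
  have T (x y : 'I_m) : ~ [/\ (x = i :> nat), (y = j :> nat) & i = j.+1 :> nat] ->
      U t i x * Lam x y * invmx (U t) y j = 0.
    move=> xy; have [xi|ix] := ltnP x i; first by rewrite hU.1// !mul0r.
    have [jy|yj] := ltnP j y; first by rewrite hV.1// mulr0.
    have [yx|xy'] := ltnP y.+1 x; first by rewrite Lam0// mulr0 mul0r.
    by exfalso; apply: xy; clear -ji ix yj xy'; split; move: ji ix yj xy'; lia.
  rewrite mxE; under eq_bigr => y _ do rewrite mxE mulr_suml.
  case: eqP => ij; last first.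
    by rewrite big1// => y _; rewrite big1// => x _; apply: T => -[].
  rewrite (bigD1 j)//= [X in _ + X]big1 ?addr0; last first.
    move=> y yj; rewrite big1// => x _; apply: T => -[_ /val_inj e _].
    by rewrite e eqxx in yj.
  rewrite (bigD1 i)//= big1 ?addr0// => x xi; apply: T => -[/val_inj e _ _].
  by rewrite e eqxx in xi.
have hLT : posup (L t)^T.
  split => [i j ij|i]; rewrite mxE hL ?eqxx ?ltr01 ?(ltnW ij)//.
  by case: eqP ij => // ->; rewrite ltnn.
exists B; split.
- by rewrite /B mulKVmx.
- move=> i j ij; have [ji|ij'] := ltnP j i; first by rewrite ULV// (negbTE ij).
  rewrite /B mxE big1// => x _; have [xj|jx] := leqP x j; first by rewrite dL0// mulr0.
  have := (posupV hLT).1 x i (leq_ltn_trans ij' jx).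
  by rewrite -trmx_inv mxE => ->; rewrite mul0r.
- move=> i j ij; rewrite ULV ?ij ?ltnSn// -ij eqxx.
  by rewrite !mulr_gt0 ?Lampos ?hU.2 ?hV.2.
Qed.

Lemma flow_minor_AC k (f g : 'I_k -> 'I_m) : bounded_AC a b (fun t => minor f g (L t)).
Proof.
apply: (falg_minor (bounded_AC_falg a b)); apply: (mxK_lowf (bounded_AC_falg a b)) => //.
move=> i; apply: (bounded_AC_inv c0) => [t tab|]; first exact: lead_M.
exact: (falg_minor (bounded_AC_falg a b)).
Qed.

Variable s : R.
Hypothesis as_ : a < s.
Hypothesis tnn_s : tnn (L s).

Let wt k (g : 'I_k -> 'I_m) := (\sum_i (m - g i))%N.

Let wt_raise k (g : 'I_k -> 'I_m) l (x : 'I_m) : x = (g l).+1 :> nat ->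
  (wt (raise g l x) < wt g)%N.
Proof.
move=> xE; rewrite /wt (bigD1 l)//= [in ltnRHS](bigD1 l)//= /raise eqxx xE.
rewrite -addSn leq_add//; first by have := ltn_ord x; rewrite xE; lia.
by apply: leq_sum => i /negbTE ->.
Qed.

(** By induction on the total distance of the columns from the bottom: the
    derivative of a minor is a nonnegative combination of minors with one column
    raised. *)
Lemma flow_tnn t : s <= t -> t < b -> tnn (L t).
Proof.
move=> + + k f g sf; move: t.
move: {2}(wt g).+1 (ltnSn (wt g)) => N; elim: N g => // N IH g gN t st tb sg.
apply: le_trans (tnn_s sf sg) _.
apply: (AC_nondecreasing (flow_minor_AC f g).1 E0 as_ st tb) => u /andP[su ut] nE _.
have uab : a < u < b by rewrite (lt_trans as_ su) (le_lt_trans ut).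
have [B [dLB B0 Bpos]] := flow_lowf uab nE.
have := der_minor_subdiag f g dLB B0.
move=> [_]; rewrite derive1E => ->.
apply: sumr_ge0 => l _; apply: sumr_ge0 => x /eqP xE.
rewrite mulr_ge0//; first exact/ltW/Bpos.
have [sr|/minor_noninj->//] := raise_case sg xE.
by apply: IH; rewrite ?(ltW su) ?(le_lt_trans ut)// (leq_trans (wt_raise xE)).
Qed.

(** A minor with equal row and column selections is 1. Otherwise raising the last
    column index that is less than its row index gives an increasing
    selection of the same kind, whose minor contributes a positive term to the
    derivative. *)
Lemma flow_tpos t : s < t -> t < b -> tpos (L t).
Proof.
move=> + + k f g sf; move: t.
move: {2}(wt g).+1 (ltnSn (wt g)) => N; elim: N g => // N IH g gN t st tb sg gf.
have tab x : s <= x -> x <= t -> a < x < b.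
  by move=> sx xt; rewrite (lt_le_trans as_) ?(le_lt_trans xt).
case: (pickP (fun l => (g l < f l)%N)) => [l0 gl0|gfE]; last first.
  have E1 : g =1 f.
    by move=> i; apply/val_inj/eqP; rewrite eqn_leq gf /= leqNgt gfE.
  have [hL _ _] := LU (tab t (ltW st) (lexx t)).
  rewrite /minor (_ : mxsub f g _ = mxsub f f (L t)) ?det_mxsub_lower1//.
  by apply/matrixP => i j; rewrite !mxE E1.
pose l := [arg max_(l > l0 | (g l < f l)%N) (l : nat)].
have [gl lmax] : (g l < f l)%N /\ forall j : 'I_k, (l < j)%N -> g j = f j :> nat.
  rewrite /l; case: arg_maxnP => //= i gi hi; split => // j ij.
  apply/eqP; rewrite eqn_leq gf /= leqNgt; apply/negP => /hi.
  by rewrite /= leqNgt ij.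
pose x := Ordinal (leq_ltn_trans gl (ltn_ord (f l))).
have xE : x = (g l).+1 :> nat by [].
have sr : sinc (raise g l x).
  move=> i j ij; rewrite /raise; case: eqP => [il|/eqP il]; case: eqP => [jl|/eqP jl].
  - by move: ij; rewrite il jl ltnn.
  - by rewrite lmax -?il// (leq_ltn_trans gl)// -il sf.
  - by rewrite xE ltnS ltnW// sg// -jl.
  - exact: sg.
have rf i : (raise g l x i <= f i)%N by rewrite /raise; case: eqP => // ->.
apply: le_lt_trans (tnn_s sf sg) _.
apply: (AC_increasing (flow_minor_AC f g).1 E0 as_ st tb) => u /andP[su ut] nE _.
have uab := tab u (ltW su) ut.
have [B [dLB B0 Bpos]] := flow_lowf uab nE.
have := der_minor_subdiag f g dLB B0.
move=> [_]; rewrite derive1E => ->.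
have nn (l' : 'I_k) (y : 'I_m) : y == (g l').+1 :> nat ->
    0 <= B y (g l') * minor f (raise g l' y) (L u).
  move=> /eqP yE; rewrite mulr_ge0//; first exact/ltW/Bpos.
  have [sr'|/minor_noninj->//] := raise_case sg yE.
  by apply: flow_tnn => //; rewrite ?(ltW su) ?(le_lt_trans ut).
rewrite (bigD1 l)//= ltr_wpDr//.
  by apply: sumr_ge0 => l' _; apply: sumr_ge0 => y; exact: nn.
rewrite (bigD1 x) ?xE//= ltr_wpDr//.
  by apply: sumr_ge0 => y /andP[yE _]; exact: nn.
rewrite mulr_gt0 ?Bpos//.
by apply: IH; rewrite ?(le_lt_trans ut)// (leq_trans (wt_raise xE)).
Qed.

End Flow.

(** At the first place where the two selections differ, a row or a column of
    the minor vanishes. *)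
Lemma tnn1 : tnn 1%:M.
Proof.
move=> k f g sf sg; rewrite /minor; have [fg|nfg] := pselect (f =1 g).
  have -> : mxsub f g (1%:M : 'M[R]_m) = mxsub f f 1%:M.
    by apply/matrixP => i j; rewrite !mxE -(fg j).
  by rewrite det_mxsub_lower1// => i j _; rewrite mxE.
have [i0 fg0] : exists i, f i != g i.
  by apply: contrapT => H; apply: nfg => i; apply/eqP/negPn/negP => h; apply: H; exists i.
pose i := [arg min_(i < i0 | f i != g i) (i : nat)].
have [fgi imin] : f i != g i /\ forall j : 'I_k, (j < i)%N -> f j = g j.
  rewrite /i; case: arg_minnP => // l hl hmin; split => // j jl.
  by apply/eqP/negPn/negP => /hmin; rewrite leqNgt jl.
have neq (u v : 'I_k -> 'I_m) : sinc v -> (u i < v i)%N ->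
    (forall j : 'I_k, (j < i)%N -> v j = u j) -> sinc u -> forall j, u i != v j.
  move=> sv uv E su j; have [ji|ij] := ltnP j i.
    by rewrite E//; apply/eqP => /(congr1 val)/= e; have := su _ _ ji; rewrite e ltnn.
  by apply/eqP => e; move: uv; rewrite e ltnNge (sinc_le sv ij).
have [lt|gt] : (f i < g i)%N \/ (g i < f i)%N.
  by apply/orP; rewrite -neq_ltn.
- rewrite (expand_det_row _ i) big1// => j _; rewrite !mxE.
  by rewrite (negbTE (neq f g sg lt _ sf j))// ?mul0r// => l li; rewrite imin.
- rewrite (expand_det_col _ i) big1// => j _; rewrite !mxE.
  by rewrite eq_sym (negbTE (neq g f sf gt _ sg j))// ?mul0r// => l li; rewrite imin.
Qed.

End TotalPositivity.

(** * The spin group and its covering map *)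

Section Clifford.
Variables (R : realType) (m : nat).
Notation N := #|{set 'I_m}|.
Notation Cl := (Clifford R m).
Notation gamma := (@gamma R m).
Notation cl_vec := (@cl_vec R m).
Implicit Types (i j k : 'I_m) (x y z : Cl) (v : 'rV[R]_m) (w : seq 'I_m).

Let mulr2n_inj x y : x *+ 2 = y *+ 2 -> x = y.
Proof.
have n2 : 2 != 0 :> R by rewrite pnatr_eq0.
move=> e; rewrite -[x]scale1r -[y]scale1r -(mulVf n2) -!scalerA.
by rewrite [2 *: x]scaler_nat [2 *: y]scaler_nat e.
Qed.

Lemma clAl (a : R) x y : (a *: x) * y = a *: (x * y).
Proof. by rewrite -!mulmxE scalemxAl. Qed.

Lemma clAr (a : R) x y : x * (a *: y) = a *: (x * y).
Proof. by rewrite -!mulmxE scalemxAr. Qed.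

Lemma gamma_sqr i : gamma i * gamma i = -1.
Proof.
apply: mulr2n_inj; have := gamma_clifford R i i; rewrite eqxx -mulr2n mulmxE => ->.
by rewrite raddfMn raddfN.
Qed.

Lemma gamma_anti i j : i != j -> gamma i * gamma j = - (gamma j * gamma i).
Proof.
move=> ij; have := gamma_clifford R i j; rewrite (negbTE ij) oppr0 mul0rn.
by rewrite raddf0 -mulmxE => /eqP; rewrite addr_eq0 => /eqP.
Qed.

Lemma card_low_toggle (B : {set 'I_m}) i :
  (-1) ^+ #|[pred k in i |: B | (k <= i)%N]| =
    - (-1) ^+ #|[pred k in B :\ i | (k <= i)%N]| :> R.
Proof.
rewrite (cardD1 i) /= !inE eqxx leqnn /= exprS mulN1r; congr (- _ ^+ _).
by apply: eq_card => k; rewrite !inE; case: eqP.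
Qed.

(** The generators permute the monomial basis up to signs and square to -1, so
    they are skew orthogonal matrices: on Spin, transposition is inversion. *)
Lemma gamma_tr i : (gamma i)^T = - gamma i.
Proof.
apply/matrixP => a b; rewrite !mxE /=.
move: (enum_val a) (enum_val b) => A B {a b}.
have E (C D : {set 'I_m}) : i \in C -> i \notin D -> (D == C :\ i) = (C == i |: D).
  by move=> iC iD; apply/eqP/eqP => ->; rewrite ?finset.setU1K ?finset.setD1K.
have S (C : {set 'I_m}) : i \in C ->
    (-1) ^+ #|[pred k in C | (k <= i)%N]| = - (-1) ^+ #|[pred k in C :\ i | (k <= i)%N]| :> R.
  move=> iC; rewrite -card_low_toggle (_ : i |: C = C)//.
  by apply/setP => x; rewrite !inE; case: eqP => [->|//]; rewrite iC.
case: (boolP (i \in A)) => iA; case: (boolP (i \in B)) => iB.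
- rewrite ifF; last by apply/eqP => e; move: iB; rewrite e !inE eqxx.
  by rewrite ifF ?oppr0//; apply/eqP => e; move: iA; rewrite e !inE eqxx.
- rewrite E//; case: eqP => [->|]; last by rewrite oppr0.
  by rewrite S ?inE ?eqxx// finset.setU1K.
- rewrite -E//; case: eqP => [->|]; last by rewrite oppr0.
  by rewrite [in RHS]S// opprK.
- rewrite ifF; last by apply/eqP => e; move: iB; rewrite e !inE eqxx.
  by rewrite ifF ?oppr0//; apply/eqP => e; move: iA; rewrite e !inE eqxx.
Qed.

Lemma card_set_gt0 : (0 < N)%N.
Proof. by apply/card_gt0P; exists finset.set0. Qed.

Lemma natN_neq0 : N%:R != 0 :> R.
Proof. by rewrite pnatr_eq0 -lt0n card_set_gt0. Qed.

(** Makes the generators orthogonal for the trace form, from which their linear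
    independence and the entries of Pi are read off. *)
Lemma tr_gamma2 i j : \tr (gamma i * gamma j) = - (i == j)%:R * N%:R.
Proof.
have [<-|ij] := eqVneq i j; first by rewrite gamma_sqr linearN /= mxtrace1 mulN1r.
rewrite oppr0 mul0r; have : \tr (gamma i * gamma j) = - \tr (gamma i * gamma j).
  by rewrite {1}gamma_anti// linearN /= -!mulmxE mxtrace_mulC.
by move=> /eqP; rewrite -addr_eq0 -mulr2n mulrn_eq0 /= => /eqP.
Qed.

Lemma cl_vecE v : cl_vec v = \sum_i v 0 i *: gamma i. Proof. by []. Qed.

Lemma cl_vec_delta i : cl_vec (delta_mx 0 i) = gamma i.
Proof.
rewrite cl_vecE (bigD1 i)//= mxE !eqxx scale1r big1 ?addr0// => j ji.
by rewrite mxE eqxx (negbTE ji) scale0r.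
Qed.

Lemma cl_vecD v v' : cl_vec (v + v') = cl_vec v + cl_vec v'.
Proof. by rewrite !cl_vecE -big_split; apply: eq_bigr => i _; rewrite mxE scalerDl. Qed.

Lemma cl_vecZ a v : cl_vec (a *: v) = a *: cl_vec v.
Proof. by rewrite !cl_vecE scaler_sumr; apply: eq_bigr => i _; rewrite mxE scalerA. Qed.

Lemma cl_vec_tr v : (cl_vec v)^T = - cl_vec v.
Proof.
rewrite cl_vecE linear_sum -sumrN; apply: eq_bigr => i _.
by rewrite linearZ /= gamma_tr scalerN.
Qed.

Definition dotv v v' : R := \sum_i v 0 i * v' 0 i.

Lemma cl_vec_clifford v v' :
  cl_vec v * cl_vec v' + cl_vec v' * cl_vec v = (- dotv v v' *+ 2)%:M.
Proof.
rewrite !cl_vecE !mulr_suml; under eq_bigr => i _ do rewrite mulr_sumr.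
under [X in _ + X]eq_bigr => i _ do rewrite mulr_sumr.
rewrite [X in _ + X]exchange_big -big_split /=.
transitivity (\sum_i (- (v 0 i * v' 0 i) *+ 2)%:M : Cl); last first.
  by rewrite -raddf_sum /= sumrMnl sumrN.
apply: eq_bigr => i _; rewrite -big_split (bigD1 i)//= big1 => [|j ji].
  rewrite !clAl !clAr !scalerA [v' 0 i * _]mulrC -scalerDr gamma_sqr.
  by rewrite addr0 -scalemx1 idmxE scalerDr scalerN mulr2n scalerDl scaleNr.
rewrite !clAl !clAr !scalerA [v' 0 j * _]mulrC -scalerDr.
by rewrite gamma_anti 1?eq_sym// addNr scaler0.
Qed.

Lemma cl_vec_sqr v : cl_vec v * cl_vec v = (- dotv v v)%:M.
Proof.
by apply: mulr2n_inj; rewrite mulr2n cl_vec_clifford raddfMn.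
Qed.

End Clifford.

Section SpinGroup.
Variables (R : realType) (m : nat).
Notation N := #|{set 'I_m}|.
Notation Cl := (Clifford R m).
Notation gamma := (@gamma R m).
Notation cl_vec := (@cl_vec R m).
Notation Pi := (@Pi R m).
Notation Spin := (@Spin R m).
Notation SO := (@SO R m).
Implicit Types (i j k : 'I_m) (x y z : Cl) (v : 'rV[R]_m) (P Q : 'M[R]_m).

Definition unitv v : Prop := \sum_i v 0 i ^+ 2 = 1.

Lemma unitv_dot v : unitv v -> dotv v v = 1.
Proof. by move=> <-; apply: eq_bigr => i _; rewrite expr2. Qed.

Lemma unitv_sqr v : unitv v -> cl_vec v * cl_vec v = -1.
Proof. by move=> /unitv_dot e; rewrite cl_vec_sqr e raddfN. Qed.

Lemma unitv_orth v : unitv v -> cl_vec v * (cl_vec v)^T = 1.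
Proof. by move=> uv; rewrite cl_vec_tr mulrN unitv_sqr// opprK. Qed.

Lemma orthC x : x * x^T = 1 -> x^T * x = 1.
Proof. by rewrite -!mulmxE -!idmxE => /mulmx1C. Qed.

Lemma orth_unit x : x * x^T = 1 -> x \in unitmx.
Proof. by rewrite -mulmxE -idmxE => /mulmx1_unit[]. Qed.

Lemma orth_inv x : x * x^T = 1 -> invmx x = x^T.
Proof.
move=> xx; have ux := orth_unit xx; rewrite -[RHS]mul1mx -(mulVmx ux) -mulmxA.
by move: xx; rewrite -mulmxE -idmxE => ->; rewrite mulmx1.
Qed.

Lemma trM x y : (x * y)^T = y^T * x^T.
Proof. by rewrite -!mulmxE trmx_mul. Qed.

Lemma tr1 : (1 : Cl)^T = 1. Proof. by rewrite -idmxE trmx1. Qed.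

Lemma Spin_orth z : Spin z -> z * z^T = 1.
Proof.
move=> [vs [_ uvs ->]]; elim: vs uvs => [|v vs IH] uvs; first by rewrite big_nil tr1 mulr1.
rewrite big_cons trM mulrA -(mulrA (cl_vec v)) IH; last first.
  by move=> w wvs; apply: uvs; rewrite inE wvs orbT.
by rewrite mulr1 unitv_orth//; apply: uvs; rewrite inE eqxx.
Qed.

Lemma Spin_unit z : Spin z -> z \in unitmx.
Proof. by move=> /Spin_orth/orth_unit. Qed.

Lemma Spin_inv z : Spin z -> invmx z = z^T.
Proof. by move=> /Spin_orth/orth_inv. Qed.

Lemma SpinM y z : Spin y -> Spin z -> Spin (y * z).
Proof.
move=> [vs [e1 u1 ->]] [ws [e2 u2 ->]]; exists (vs ++ ws); split.
- by rewrite size_cat oddD (negbTE e1) (negbTE e2).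
- by move=> v; rewrite mem_cat => /orP[/u1|/u2].
- by rewrite big_cat.
Qed.

Lemma Spin1 : Spin 1.
Proof. by exists [::]; split => //; rewrite big_nil. Qed.

Lemma Spin_vec2 v w : unitv v -> unitv w -> Spin (cl_vec v * cl_vec w).
Proof.
move=> uv uw; exists [:: v; w]; split => //; last by rewrite !big_cons big_nil mulr1.
by move=> u; rewrite !inE => /orP[]/eqP->.
Qed.

Lemma Spin_tr z : Spin z -> Spin z^T.
Proof.
move=> [vs [e u ->]]; exists (rev vs); split.
- by rewrite size_rev.
- by move=> v; rewrite mem_rev; exact: u.
- have E us : \prod_(v <- rev us) cl_vec v =
      (-1) ^+ size us *: (\prod_(v <- us) cl_vec v)^T.
    elim: us => [|u0 us IH]; first by rewrite !big_nil tr1 scale1r.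
    rewrite rev_cons -cats1 big_cat big_seq1 IH big_cons trM cl_vec_tr mulrN scalerN.
    by rewrite /= exprS mulN1r scaleNr opprK clAl.
  by rewrite E -signr_odd (negbTE e) scale1r.
Qed.

(** The rotation or reflection induced by conjugation, without division. *)
Definition isPi z P : Prop := forall j, z * gamma j = (\sum_i P i j *: gamma i) * z.

Lemma tr_gamma_sum i j (A : 'M[R]_m) :
  \tr (gamma i * \sum_k A k j *: gamma k) = - A i j * N%:R.
Proof.
rewrite mulr_sumr linear_sum (bigD1 i)//= clAr linearZ /= tr_gamma2 eqxx.
rewrite big1 ?addr0 ?mulrA ?mulrN1// => k ki.
by rewrite clAr linearZ /= tr_gamma2 eq_sym (negbTE ki) oppr0 mul0r mulr0.
Qed.

Lemma gamma_free P Q : (forall j, \sum_i P i j *: gamma i = \sum_i Q i j *: gamma i) -> P = Q.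
Proof.
move=> H; apply/matrixP => i j.
by have := tr_gamma_sum i j P; rewrite H tr_gamma_sum => /(mulIf (natN_neq0 R m)) /oppr_inj.
Qed.

Lemma isPi_Pi z P : z \in unitmx -> isPi z P -> Pi z = P.
Proof.
move=> uz zP; rewrite /Defs.Pi.
have zP' : forall j, z *m gamma j *m invmx z = \sum_i P i j *: gamma i.
  by move=> j; rewrite mulmxE zP -!mulmxE mulmxK.
apply: xget_unique => // Q zQ; apply: gamma_free => j; by rewrite -zQ zP'.
Qed.

Lemma isPi_lin z P v : isPi z P -> z * cl_vec v = cl_vec (v *m P^T) * z.
Proof.
move=> zP; rewrite !cl_vecE mulr_sumr.
under eq_bigr => j _ do rewrite clAr zP -clAl scaler_sumr.
rewrite -mulr_suml exchange_big; congr (_ * _); apply: eq_bigr => i _ /=.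
rewrite mxE scaler_suml; apply: eq_bigr => j _.
by rewrite scalerA mxE.
Qed.

Lemma isPiM y z P Q : isPi y P -> isPi z Q -> isPi (y * z) (P *m Q).
Proof.
move=> yP zQ j; rewrite -mulrA zQ mulrA.
have -> : \sum_i Q i j *: gamma i = cl_vec (\row_i Q i j).
  by rewrite cl_vecE; apply: eq_bigr => i _; rewrite mxE.
rewrite (isPi_lin _ yP) mulrA; congr (_ * _ * _).
by rewrite cl_vecE; apply: eq_bigr => i _; rewrite !mxE; congr (_ *: _);
  apply: eq_bigr => k _; rewrite !mxE mulrC.
Qed.

Lemma isPi1 : isPi 1 1%:M.
Proof.
move=> j; rewrite mul1r mulr1 (bigD1 j)//= mxE eqxx scale1r big1 ?addr0// => i ij.
by rewrite mxE (negbTE ij) scale0r.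
Qed.

(** Minus the reflection in the hyperplane orthogonal to the unit vector v. *)
Definition halfturn v : 'M[R]_m := 2 *: (v^T *m v) - 1%:M.

Lemma halfturnE v i j : halfturn v i j = 2 * (v 0 i * v 0 j) - (i == j)%:R.
Proof. by rewrite !mxE big_ord1 !mxE. Qed.

(** A unit vector v acts on vectors by w |-> v w v^-1, which fixes v and negates
    its orthogonal complement. *)
Lemma isPi_vec v : unitv v -> isPi (cl_vec v) (halfturn v).
Proof.
move=> uv j.
have delta : \sum_i (i == j)%:R *: gamma i = gamma j.
  rewrite (bigD1 j)//= eqxx scale1r big1 ?addr0// => i /negbTE->.
  by rewrite scale0r.
have -> : \sum_i halfturn v i j *: gamma i = (2 * v 0 j) *: cl_vec v - gamma j.
  rewrite cl_vecE scaler_sumr -delta -sumrB; apply: eq_bigr => i _.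
  by rewrite halfturnE scalerBl scalerA mulrA mulrAC.
rewrite mulrBl clAl unitv_sqr//.
have dotE : dotv v (delta_mx 0 j) = v 0 j.
  rewrite /dotv (bigD1 j)//= mxE !eqxx mulr1 big1 ?addr0// => i ij.
  by rewrite mxE eqxx (negbTE ij) mulr0.
apply: (canRL (addrK _)); rewrite -{1 2}cl_vec_delta cl_vec_clifford dotE.
by rewrite -scalemx1 idmxE scalerN -scaleNr; congr (_ *: _); rewrite mulr2n; ring.
Qed.

Lemma halfturn_tr v : (halfturn v)^T = halfturn v.
Proof.
apply/matrixP => i j; rewrite mxE !halfturnE eq_sym [v 0 j * _]mulrC; congr (_ - _).
Qed.

Lemma halfturn_orth v : unitv v -> halfturn v *m (halfturn v)^T = 1%:M.
Proof.
move=> uv; rewrite halfturn_tr /halfturn.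
have vv : v *m v^T = 1%:M.
  apply/matrixP => i j; rewrite !ord1 !mxE eqxx -[RHS](unitv_dot uv).
  by apply: eq_bigr => k _; rewrite mxE.
have QQ : (v^T *m v) *m (v^T *m v) = v^T *m v.
  by rewrite mulmxA -(mulmxA v^T) vv mulmx1.
move: (v^T *m v) QQ => Q QQ.
rewrite mulmxBr mulmxBl mulmx1 mul1mx -scalemxAl -scalemxAr QQ.
by apply/matrixP => i j; rewrite !mxE; ring.
Qed.

(** The determinant of 1 - 2 v^T v is found by factoring a bordered matrix in two
    ways. *)
Lemma det_halfturn v : unitv v -> \det (halfturn v) = (-1) ^+ m.+1.
Proof.
move=> uv; have -> : halfturn v = - (1%:M - (2 *: v^T) *m v).
  by rewrite opprB -scalemxAl.
rewrite -scaleN1r detZ exprS mulrC; congr (_ * _).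
(* the two block factorizations of A compare a determinant of size m with one of size 1 *)
pose A := block_mx 1%:M v (2 *: v^T) 1%:M : 'M[R]_(1 + m).
have E1 : A = block_mx 1%:M 0 (2 *: v^T) 1%:M *m block_mx 1%:M v 0 (1%:M - (2 *: v^T) *m v).
  by rewrite mulmx_block !mul1mx ?mulmx1 ?mul0mx ?mulmx0 ?addr0 [_ *m v + _]addrC subrK.
have E2 : A = block_mx (1%:M - v *m (2 *: v^T)) v 0 1%:M *m block_mx 1%:M 0 (2 *: v^T) 1%:M.
  by rewrite mulmx_block ?mul1mx ?mulmx1 ?mul0mx ?mulmx0 ?add0r ?addr0 subrK.
have : \det (1%:M - (2 *: v^T) *m v) = \det A by rewrite E1 det_mulmx det_lblock det_ublock !det1 !mul1r.
rewrite E2 det_mulmx det_lblock det_ublock !det1 !mulr1 => ->.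
rewrite -scalemxAr [_ *m _](_ : _ = 1%:M); last first.
  apply/matrixP => i j; rewrite !ord1 !mxE eqxx -[RHS](unitv_dot uv).
  by apply: eq_bigr => k _; rewrite mxE.
by rewrite -{1}[1%:M]scale1r -scalerBl detZ det1 mulr1 expr1; ring.
Qed.

(** In odd dimension -1 has determinant -1 and halfturns are rotations, in even
    dimension they are reflections; an even number of them is a rotation in
    both cases. *)
Lemma Spin_isPi_SO z : Spin z -> exists2 P, isPi z P & SO P.
Proof.
move=> [vs [e uvs ->]].
have [P [zP PP dP]] : exists P, [/\ isPi (\prod_(v <- vs) cl_vec v) P, P *m P^T = 1%:M
    & \det P = (-1) ^+ (m.+1 * size vs)].
  elim: vs uvs {e} => [|v vs IH] uvs.
    exists 1%:M; rewrite big_nil det1 muln0 expr0 trmx1 mulmx1; split => //; exact: isPi1.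
  have [|P [zP PP dP]] := IH.
    by move=> w wvs; apply: uvs; rewrite inE wvs orbT.
  have uv : unitv v by apply: uvs; rewrite inE eqxx.
  exists (halfturn v *m P); split.
  - by rewrite big_cons; apply: isPiM => //; exact: isPi_vec.
  - by rewrite trmx_mul mulmxA -(mulmxA _ P) PP mulmx1 halfturn_orth.
  - by rewrite det_mulmx dP det_halfturn// -exprD /= mulnS.
exists P => //; split => //; rewrite dP -signr_odd oddM (negbTE e) andbF.
by [].
Qed.

Lemma Pi_isPi z : Spin z -> isPi z (Pi z).
Proof.
by move=> hz; have [P zP _] := Spin_isPi_SO hz; rewrite (isPi_Pi _ zP)//; exact: Spin_unit.
Qed.

Lemma Pi_SO z : Spin z -> SO (Pi z).
Proof.
by move=> hz; have [P zP hP] := Spin_isPi_SO hz; rewrite (isPi_Pi _ zP)//; exact: Spin_unit.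
Qed.

Lemma PiM y z : Spin y -> Spin z -> Pi (y * z) = Pi y *m Pi z.
Proof.
move=> hy hz; apply: isPi_Pi; first exact/Spin_unit/SpinM.
by apply: isPiM; exact: Pi_isPi.
Qed.

Lemma Pi1 : Pi 1 = 1%:M.
Proof. by apply: isPi_Pi; [exact/Spin_unit/Spin1|exact: isPi1]. Qed.

Lemma Pi_tr z : Spin z -> Pi z^T = (Pi z)^T.
Proof.
move=> hz; have [PP _] := Pi_SO hz.
have : Pi z^T *m Pi z = 1%:M by rewrite -PiM ?orthC ?Pi1//; [exact: Spin_orth|exact: Spin_tr].
move=> e; rewrite -[LHS]mulmx1 -PP mulmxA e mul1mx//.
Qed.

Lemma Pi_entry z i j : Spin z -> Pi z i j = - \tr (gamma i * (z * gamma j * z^T)) / N%:R.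
Proof.
move=> hz; rewrite (Pi_isPi hz) -mulrA (Spin_orth hz) mulr1.
by rewrite tr_gamma_sum !mulNr opprK mulfK ?natN_neq0.
Qed.

(** Every orthogonal matrix is a product of reflections: the reflection in the
    bisector of e_k and g e_k brings the k-th column of g into place without
    disturbing the previous ones. *)
Lemma orth_reflections (g : 'M[R]_m) : g *m g^T = 1%:M ->
  exists vs : seq 'rV[R]_m, (forall v, v \in vs -> unitv v) /\
    g = \big[mulmx/1%:M]_(v <- vs) (- halfturn v).
Proof.
have [d dm] : exists d, (m <= d)%N by exists m.
have H : forall k : nat, (m - d <= k)%N -> forall g : 'M[R]_m, g *m g^T = 1%:M ->
    (forall i j, (j < k)%N -> g i j = (i == j)%:R) ->
  exists vs : seq 'rV[R]_m, (forall v, v \in vs -> unitv v) /\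
    g = \big[mulmx/1%:M]_(v <- vs) (- halfturn v); last first.
  by move=> gg; apply: (H 0%N _ _ gg) => //; move: dm; rewrite -subn_eq0 => /eqP->.
elim: d {dm} => [|d IH] k kd {}g gg gk.
  exists [::]; split => //; rewrite big_nil; apply/matrixP => i j.
  by rewrite mxE gk// (leq_trans (ltn_ord j))// -(subn0 m).
have [mk|km] := leqP m k.
  exists [::]; split => //; rewrite big_nil; apply/matrixP => i j.
  by rewrite mxE gk// (leq_trans (ltn_ord j)).
have kd1 : (m - d <= k.+1)%N by move: kd km; lia.
pose kk := Ordinal km.
have [gE|gne] := pselect (forall i, g i kk = (i == kk)%:R).
  apply: (IH k.+1 kd1) => // i j; rewrite ltnS leq_eqVlt => /predU1P[jk|/gk//].
  by rewrite (_ : j = kk)//; apply/val_inj.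
have tgg : g^T *m g = 1%:M by apply: mulmx1C.
have colg (a b : 'I_m) : \sum_l g l a * g l b = (a == b)%:R.
  have /matrixP/(_ a b) := tgg; rewrite !mxE => <-.
  by apply: eq_bigr => l _; rewrite mxE.
pose v0 : 'rV[R]_m := \row_i (g i kk - (i == kk)%:R).
pose q := \sum_i v0 0 i ^+ 2.
have qE : q = 2 * (1 - g kk kk).
  rewrite /q (eq_bigr (fun i => g i kk * g i kk + (i == kk)%:R * (1 - 2 * g i kk))); last first.
    by move=> i _; rewrite !mxE; case: eqP => _ /=; ring.
  rewrite big_split /= colg eqxx (bigD1 kk)//= eqxx big1 ?addr0; last first.
    by move=> i /negbTE->; rewrite mul0r.
  by rewrite /= !mulr1n; ring.
have q0 : q != 0.
  apply/eqP => q0; apply: gne => i; apply/eqP; rewrite -subr_eq0.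
  move/eqP: q0; rewrite psumr_eq0 => [/allP/(_ i (mem_index_enum _))|? _]; last exact: sqr_ge0.
  by rewrite sqrf_eq0 mxE.
have qpos : 0 < q by rewrite lt_neqAle eq_sym q0 sumr_ge0// => i _; exact: sqr_ge0.
have s2 : Num.sqrt q ^+ 2 = q by rewrite sqr_sqrtr// ltW.
have s0 : Num.sqrt q != 0 by rewrite gt_eqF// sqrtr_gt0.
pose v := (Num.sqrt q)^-1 *: v0.
have uv : unitv v.
  rewrite /unitv (eq_bigr (fun i => q^-1 * v0 0 i ^+ 2)); last first.
    by move=> i _; rewrite mxE exprMn exprVn s2.
  by rewrite -mulr_sumr mulVf.
have hh : (- halfturn v) *m (- halfturn v) = 1%:M.
  by rewrite mulNmx mulmxN opprK -{2}halfturn_tr halfturn_orth.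
pose g' := (- halfturn v) *m g.
have g'E i j : g' i j = g i j - 2 / q * v0 0 i * \sum_l v0 0 l * g l j.
  rewrite mxE (eq_bigr (fun l => (i == l)%:R * g l j - 2 / q * v0 0 i * (v0 0 l * g l j))).
    rewrite sumrB -mulr_sumr (bigD1 i)//= eqxx mul1r big1 ?addr0// => l li.
    by rewrite eq_sym (negbTE li) mul0r.
  move=> l _; rewrite mxE halfturnE [v 0 i]mxE [v 0 l]mxE -[in RHS]s2.
  by field.
have [||vs [uvs g'vs]] := IH k.+1 kd1 g'.
- rewrite /g' trmx_mul mulmxA -(mulmxA _ g) gg mulmx1.
  by rewrite linearN /= halfturn_tr.
- move=> i j; rewrite ltnS leq_eqVlt => /predU1P[jk|jk].
    have -> : j = kk by apply/val_inj.
    rewrite g'E (eq_bigr (fun l => g l kk * g l kk - (l == kk)%:R * g l kk)); last first.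
      by move=> l _; rewrite mxE mulrBl.
    rewrite sumrB colg eqxx (bigD1 kk)//= eqxx mul1r big1 ?addr0; last first.
      by move=> l /negbTE->; rewrite mul0r.
    rewrite mulr1n (_ : 1 - g kk kk = q / 2); last by rewrite qE; field.
    by rewrite mxE; field.
  rewrite g'E (gk i j jk) (eq_bigr (fun l => v0 0 l * (l == j)%:R)); last first.
    by move=> l _; rewrite gk.
  rewrite (bigD1 j)//= eqxx mulr1 big1 ?addr0; last by move=> l /negbTE->; rewrite mulr0.
  have jk' : (j == kk) = false by apply/negbTE/eqP => e; move: jk; rewrite e ltnn.
  have -> : v0 0 j = 0.
    rewrite mxE jk' subr0; have := colg j kk; rewrite jk'.
    rewrite (bigD1 j)//= gk// eqxx mul1r big1 ?addr0// => l lj.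
    by rewrite gk// (negbTE lj) mul0r.
  by rewrite mulr0 subr0.
exists (v :: vs); split.
  by move=> w; rewrite inE => /predU1P[->//|/uvs].
by rewrite big_cons -g'vs /g' mulmxA hh mul1mx.
Qed.

(** The determinant makes the number of reflections even, so the signs between
    reflections and halfturns cancel. *)
Lemma Pi_surj (g : 'M[R]_m) : SO g -> exists2 z, Spin z & Pi z = g.
Proof.
move=> [gg dg]; have [vs [uvs gvs]] := orth_reflections gg.
have det_refl v : unitv v -> \det (- halfturn v) = -1.
  by move=> uv; rewrite -scaleN1r detZ det_halfturn// exprS mulN1r mulrN -expr2 sqrr_sign.
have ev : ~~ odd (size vs).
  have E us : (forall v, v \in us -> unitv v) ->
      \det (\big[mulmx/1%:M]_(v <- us) (- halfturn v)) = (-1) ^+ size us.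
    elim: us => [|u us IH] uus; first by rewrite big_nil det1.
    rewrite big_cons det_mulmx IH => [|w wus]; last by apply: uus; rewrite inE wus orbT.
    by rewrite det_refl ?exprS//; apply: uus; rewrite inE eqxx.
  move: dg; rewrite gvs E// -signr_odd; case: (odd _) => //=; rewrite expr1 => e.
  by exfalso; move: e {gg gvs}; lra.
exists (\prod_(v <- vs) cl_vec v); first by exists vs.
apply: isPi_Pi.
  by apply: Spin_unit; exists vs.
have E us : (forall v, v \in us -> unitv v) -> isPi (\prod_(v <- us) cl_vec v)
    ((-1) ^+ size us *: \big[mulmx/1%:M]_(v <- us) (- halfturn v)).
  elim: us => [|u us IH] uus; first by rewrite !big_nil scale1r; exact: isPi1.
  rewrite !big_cons /= exprS mulN1r scaleNr mulNmx scalerN opprK scalemxAr.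
  apply: isPiM; first by apply: isPi_vec; apply: uus; rewrite inE eqxx.
  by apply: IH => w wus; apply: uus; rewrite inE wus orbT.
by have := E _ uvs; rewrite -signr_odd (negbTE ev) scale1r -gvs.
Qed.

End SpinGroup.

Section Kernel.
Variables (R : realType) (m : nat).
Notation N := #|{set 'I_m}|.
Notation Cl := (Clifford R m).
Notation gamma := (@gamma R m).
Notation cl_vec := (@cl_vec R m).
Notation Pi := (@Pi R m).
Notation Spin := (@Spin R m).
Notation SO := (@SO R m).
Implicit Types (i j k : 'I_m) (x y z : Cl) (v : 'rV[R]_m) (w : seq 'I_m).

Definition gword w : Cl := \prod_(i <- w) gamma i.

Lemma gword_cat w w' : gword (w ++ w') = gword w * gword w'.
Proof. by rewrite /gword big_cat. Qed.

Lemma gword_cons i w : gword (i :: w) = gamma i * gword w.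
Proof. by rewrite /gword big_cons. Qed.

Lemma gamma_gword i w :
  gamma i * gword w = (-1) ^+ (size w + count_mem i w) *: (gword w * gamma i).
Proof.
elim: w => [|j w IH]; first by rewrite /gword big_nil mulr1 mul1r scale1r.
rewrite gword_cons /= [in LHS]mulrA; have [->|ji] := eqVneq j i.
  rewrite -[LHS]mulrA [in LHS]IH clAr mulrA; congr (_ *: _).
  by rewrite add1n addnS addSn !exprS !mulN1r opprK.
rewrite gamma_anti 1?eq_sym// mulNr -[X in - X]mulrA IH clAr mulrA.
by rewrite add0n addSn exprS mulN1r scaleNr.
Qed.

(** Equal letters can be brought together, up to sign, and then cancel. *)
Lemma gword_even w : (forall i, ~~ odd (count_mem i w)) -> exists c : R, gword w = c%:M.
Proof.
move: {2}(size w) (leqnn (size w)) => s; elim: s w => [|s IH] w.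
  by rewrite leqn0 => /nilP-> _; exists 1; rewrite /gword big_nil.
case: w => [|i w] sw ev; first by exists 1; rewrite /gword big_nil.
have iw : i \in w.
  by have := ev i; rewrite /= eqxx -has_pred1 has_count /=; case: (count_mem i w).
case/splitPr: iw sw ev => w1 w2 sw ev.
have [||c cE] := IH (w1 ++ w2).
- by move: sw; rewrite /= !size_cat /= addnS ltnS; apply: leq_trans.
- move=> j; have := ev j; rewrite /= !count_cat /=.
  by rewrite !oddD; do 3![case: (odd _)].
rewrite gword_cons gword_cat gword_cons mulrA gamma_gword clAl -mulrA (mulrA (gamma i)).
rewrite gamma_sqr mulN1r mulrN -gword_cat cE.
exists (- (-1) ^+ (size w1 + count_mem i w1) * c).
by rewrite scalerN -scaleNr -scalemx1 scalerA scalemx1.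
Qed.

(** The even subalgebra, as linear combinations of words of even length. *)
Definition evenC x : Prop := exists l : seq (R * seq 'I_m),
  (forall p, p \in l -> ~~ odd (size p.2)) /\ x = \sum_(p <- l) p.1 *: gword p.2.

Lemma evenC1 : evenC 1.
Proof.
exists [:: (1, [::])]; split; first by move=> p; rewrite inE => /eqP->.
by rewrite big_seq1 scale1r /gword big_nil.
Qed.

Lemma evenCD x y : evenC x -> evenC y -> evenC (x + y).
Proof.
move=> [l [el ->]] [l' [el' ->]]; exists (l ++ l'); split; last by rewrite big_cat.
by move=> p; rewrite mem_cat => /orP[/el|/el'].
Qed.

Lemma evenCZ a x : evenC x -> evenC (a *: x).
Proof.
move=> [l [el ->]]; exists [seq (a * p.1, p.2) | p <- l]; split.
  by move=> p /mapP[q ql ->] /=; exact: el.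
by rewrite big_map scaler_sumr; apply: eq_bigr => p _; rewrite scalerA.
Qed.

Lemma evenC0 : evenC 0.
Proof. by exists [::]; split => //; rewrite big_nil. Qed.

Lemma evenC_sum (I : Type) (r : seq I) (F : I -> Cl) :
  (forall a, evenC (F a)) -> evenC (\sum_(a <- r) F a).
Proof.
by move=> H; elim: r => [|a r IH]; rewrite ?big_nil ?big_cons; [exact: evenC0|exact: evenCD].
Qed.

Lemma evenC_word w w' x : ~~ odd (size w + size w') -> evenC x -> evenC (gword w * x * gword w').
Proof.
move=> e [l [el ->]]; rewrite mulr_sumr mulr_suml.
exists [seq (p.1, w ++ p.2 ++ w') | p <- l]; split.
  move=> p /mapP[q ql ->] /=; rewrite !size_cat addnCA oddD (negbTE e) addbF.
  exact: el.
rewrite big_map; apply: eq_bigr => p _ /=.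
by rewrite clAr clAl !gword_cat mulrA.
Qed.

Lemma evenC_vec2 v v' x : evenC x -> evenC (cl_vec v * x * cl_vec v').
Proof.
move=> ex; rewrite !cl_vecE mulr_suml mulr_suml; apply: evenC_sum => i.
rewrite mulr_sumr; apply: evenC_sum => j; rewrite !clAl clAr; do 2!apply: evenCZ.
have := @evenC_word [:: i] [:: j] x isT ex.
by rewrite /gword !big_seq1.
Qed.

Lemma evenC_Spin z x : Spin z -> evenC x -> evenC (z * x).
Proof.
move=> [vs [e _ ->]] ex; move: {2}(size vs) (leqnn (size vs)) => s.
elim: s vs e => [|s IH] [|v [|v' vs]] //= e sv; rewrite ?big_nil ?mul1r//.
rewrite !big_cons mulrA -!mulrA.
rewrite negbK in e; have := IH vs e (ltnW sv).
move: (_ * x) => y ey; rewrite cl_vecE mulr_suml; apply: evenC_sum => i.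
rewrite cl_vecE mulr_suml mulr_sumr; apply: evenC_sum => j.
rewrite clAl clAl clAr; do 2!apply: evenCZ.
have := @evenC_word [:: i; j] [::] y isT ey.
by rewrite /gword !big_cons !big_nil !mulr1 mulrA.
Qed.

(** The average of x and its conjugate by gamma i, as gamma i ^-1 = - gamma i. *)
Definition avg i x : Cl := 2^-1 *: (x - gamma i * x * gamma i).

Lemma avgD i x y : avg i (x + y) = avg i x + avg i y.
Proof. by rewrite /avg mulrDr mulrDl -scalerDr opprD addrACA. Qed.

Lemma avgZ i a x : avg i (a *: x) = a *: avg i x.
Proof. by rewrite /avg clAr clAl -scalerBr !scalerA mulrC. Qed.

Lemma avg0 i : avg i 0 = 0.
Proof. by rewrite /avg mulr0 mul0r subrr scaler0. Qed.

Let halfD x : 2^-1 *: (x + x) = x.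
Proof.
rewrite scalerDr -scalerDl (_ : 2^-1 + 2^-1 = 1 :> R) ?scale1r//.
by field.
Qed.

Lemma avg_fix i x : gamma i * x = x * gamma i -> avg i x = x.
Proof.
by move=> c; rewrite /avg c -mulrA gamma_sqr mulrN1 opprK halfD.
Qed.

Lemma avg_gword i w : ~~ odd (size w) ->
  avg i (gword w) = if odd (count_mem i w) then 0 else gword w.
Proof.
move=> ew; rewrite /avg gamma_gword clAl -mulrA gamma_sqr mulrN1 scalerN opprK.
rewrite -signr_odd oddD (negbTE ew) addFb; case: (odd _).
  by rewrite expr1 scaleN1r subrr scaler0.
by rewrite expr0 scale1r halfD.
Qed.

(** Averaging over conjugation by each of the gamma i fixes a central element,
    but kills every word of even length in which some letter occurs an odd
    number of times; the remaining words are scalars. *)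
Lemma even_central_scalar x : evenC x -> (forall i, gamma i * x = x * gamma i) ->
  exists c : R, x = c%:M.
Proof.
move=> [l [el xE]] cx.
pose A (s : seq 'I_m) y := foldr avg y s.
have AD s y z : A s (y + z) = A s y + A s z by elim: s => //= i s ->; rewrite avgD.
have AZ s a y : A s (a *: y) = a *: A s y by elim: s => //= i s ->; rewrite avgZ.
have A0 s : A s 0 = 0 by elim: s => //= i s ->; exact: avg0.
have Afix s : A s x = x by elim: s => //= i s ->; exact: avg_fix.
have Aw s w : ~~ odd (size w) ->
    A s (gword w) = if has (fun i => odd (count_mem i w)) s then 0 else gword w.
  move=> ew; elim: s => //= i s ->; case: (has _ s); last by rewrite orbF avg_gword.
  by rewrite orbT avg0.
pose s := enum 'I_m.
have : forall p, p \in l -> exists c : R, A s (p.1 *: gword p.2) = c%:M.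
  move=> p pl; rewrite AZ Aw ?el//; case: hasP => [_|H].
    by exists 0; rewrite scaler0 raddf0.
  have [i|c ->] := @gword_even p.2; last by exists (p.1 * c); rewrite -scale_scalar_mx.
  by apply/negP => h; apply: H; exists i; rewrite ?mem_enum.
rewrite -(Afix s) xE; elim: l {el xE} => [|p l IH] H.
  by exists 0; rewrite big_nil A0 raddf0.
rewrite big_cons AD.
have [c ->] := H p (mem_head _ _); have [|c' ->] := IH.
  by move=> q ql; apply: H; rewrite inE ql orbT.
by exists (c + c'); rewrite raddfD.
Qed.

Definition rotvec (g : 'M[R]_m) i : Cl := cl_vec (\row_k g k i).

Definition twist (g : 'M[R]_m) i x : Cl := - (rotvec g i * x * gamma i).

(** The sum of all the products of distinct twists, applied to 1. For g in SO it
    is fixed by each twist, and is therefore a multiple of the preimages of g in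
    Spin; being polynomial in g, it provides a continuous local section of the
    covering where it is nonzero. *)
Definition intertwiner (g : 'M[R]_m) : Cl :=
  foldr (fun i x => x + twist g i x) 1 (enum 'I_m).

Lemma evenC_intertwiner g : evenC (intertwiner g).
Proof.
rewrite /intertwiner; elim: (enum 'I_m) => [|i s IH] /=; first exact: evenC1.
apply: evenCD => //; rewrite /twist -scaleN1r; apply: evenCZ.
by rewrite -(cl_vec_delta R i); exact: evenC_vec2.
Qed.

Lemma intertwiner1 : exists2 c : R, 0 < c & intertwiner 1%:M = c%:M.
Proof.
rewrite /intertwiner; elim: (enum 'I_m) => [|i s [c c0 /= ->]] /=; first by exists 1.
exists (c + c); first by rewrite addr_gt0.
rewrite /twist (_ : rotvec 1%:M i = gamma i); last first.
  rewrite /rotvec -cl_vec_delta; congr cl_vec.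
  by apply/rowP => k; rewrite !mxE eqxx eq_sym.
rewrite -scalemx1 idmxE clAr mulr1 clAl gamma_sqr scalerN opprK raddfD /=.
by rewrite -scalemx1 idmxE.
Qed.

Section Intertwining.
Variable g : 'M[R]_m.
Hypothesis gg : g^T *m g = 1%:M.

Let rot_cliff i j : rotvec g i * rotvec g j + rotvec g j * rotvec g i = (- (i == j)%:R *+ 2)%:M.
Proof.
rewrite cl_vec_clifford (_ : dotv _ _ = (i == j)%:R)//.
have /matrixP/(_ i j) := gg; rewrite !mxE => <-.
by apply: eq_bigr => k _; rewrite !mxE.
Qed.

Let rot_sqr i : rotvec g i * rotvec g i = -1.
Proof.
rewrite /rotvec cl_vec_sqr (_ : dotv _ _ = 1) ?raddfN//.
have /matrixP/(_ i i) := gg; rewrite !mxE eqxx mulr1n => <-.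
by apply: eq_bigr => k _; rewrite !mxE.
Qed.

Let rot_anti i j : i != j -> rotvec g i * rotvec g j = - (rotvec g j * rotvec g i).
Proof.
move=> ij; have := rot_cliff i j; rewrite (negbTE ij) oppr0 mul0rn raddf0 => /eqP.
by rewrite addr_eq0 => /eqP.
Qed.

Let twistD i x y : twist g i (x + y) = twist g i x + twist g i y.
Proof. by rewrite /twist mulrDr mulrDl opprD. Qed.

Let twistK i x : twist g i (twist g i x) = x.
Proof.
rewrite /twist mulrN mulNr opprK !mulrA rot_sqr -mulrA gamma_sqr.
by rewrite mulrN1 mulN1r opprK.
Qed.

Let twistC i j x : twist g i (twist g j x) = twist g j (twist g i x).
Proof.
have [->//|ij] := eqVneq i j.
rewrite /twist !mulrN !mulNr !opprK.
have E (a b c d : Cl) : a * (b * x * c) * d = (a * b) * x * (c * d) by rewrite !mulrA.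
have ji : j != i by rewrite eq_sym.
by rewrite !E (rot_anti ij) (gamma_anti R ji) mulrN !mulNr opprK.
Qed.

Lemma intertwinerP i : rotvec g i * intertwiner g = intertwiner g * gamma i.
Proof.
have fixed : twist g i (intertwiner g) = intertwiner g.
  have : i \in enum 'I_m by rewrite mem_enum.
  rewrite /intertwiner; elim: (enum 'I_m) => // j s IH; rewrite inE => /predU1P[<-|is_] /=.
    by rewrite twistD twistK addrC.
  by rewrite twistD twistC IH.
by rewrite -{2}fixed /twist mulNr -!mulrA gamma_sqr !mulrN1 mulrN opprK.
Qed.

End Intertwining.

(** For g = Pi z, the element z^-1 (intertwiner g) is even and commutes with all
    the gamma i. *)
Lemma intertwiner_Spin z : Spin z -> exists c : R, intertwiner (Pi z) = c *: z.
Proof.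
move=> hz; have [PP _] := Pi_SO hz.
have zz := Spin_orth hz; have zz' := orthC zz.
have [|i|c cE] := @even_central_scalar (z^T * intertwiner (Pi z)).
- by apply: evenC_Spin; [exact: Spin_tr|exact: evenC_intertwiner].
- rewrite -[RHS]mulrA -intertwinerP; last exact: mulmx1C.
  rewrite /rotvec cl_vecE !mulrA; congr (_ * _).
  have := Pi_isPi hz i => /(congr1 (fun y => z^T * y * z^T)).
  rewrite -!mulrA zz mulr1 !mulrA zz' mul1r => ->.
  by congr (_ * _); apply: eq_bigr => k _; rewrite mxE.
- exists c; rewrite -[LHS]mul1r -zz -mulrA cE.
  by rewrite -scalemx1 idmxE clAr mulr1.
Qed.

(** Normalized so as to be an orthogonal matrix, like the elements of Spin. *)
Definition spin_sec (g : 'M[R]_m) : Cl :=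
  (Num.sqrt (\tr (intertwiner g * (intertwiner g)^T) / N%:R))^-1 *: intertwiner g.

Lemma spin_secP z : Spin z -> intertwiner (Pi z) != 0 ->
  spin_sec (Pi z) = z \/ spin_sec (Pi z) = - z.
Proof.
move=> hz; rewrite /spin_sec; have [c ->] := intertwiner_Spin hz => cz0.
have c0 : c != 0 by apply: contra cz0 => /eqP->; rewrite scale0r.
have -> : \tr (c *: z * (c *: z)^T) / N%:R = c ^+ 2.
  rewrite linearZ /= clAl clAr scalerA (Spin_orth hz) linearZ /= mxtrace1 mulfK ?natN_neq0//.
rewrite sqrtr_sqr scalerA; have [cpos|cneg] := ltrP 0 c.
  by left; rewrite gtr0_norm// mulVf// scale1r.
by right; rewrite ler0_norm// invrN mulNr mulVf// scaleN1r.
Qed.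

End Kernel.

(** * Plane rotations and the generators *)

Section PlanarRotation.
Variables (R : realType) (m : nat).
Notation Cl := (Clifford R m).
Notation gamma := (@gamma R m).
Notation cl_vec := (@cl_vec R m).
Implicit Types (a b i j k : 'I_m) (t : R).

(** The rotation by the angle t in the plane of e_a and e_b. *)
Definition planar a b t : 'M[R]_m := \matrix_(i, k)
  if k == a then (i == a)%:R * cos t + (i == b)%:R * sin t
  else if k == b then (i == b)%:R * cos t - (i == a)%:R * sin t else (i == k)%:R.

(** The half angle lift of the plane rotation, a product of two unit vectors. *)
Definition spin_planar a b t : Cl :=
  (cos (t / 2))%:M + (sin (t / 2) *: (gamma a * gamma b) : Cl).

Lemma gamma2_sqr a b : a != b -> (gamma a * gamma b) * (gamma a * gamma b) = -1.
Proof.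
move=> ab; have ba : b != a by rewrite eq_sym.
rewrite mulrA -(mulrA (gamma a)) (gamma_anti R ba) mulrN mulNr mulrA gamma_sqr.
by rewrite mulN1r mulNr opprK gamma_sqr.
Qed.

Let u a b t : 'rV[R]_m := - cos (t / 2) *: delta_mx 0 a + sin (t / 2) *: delta_mx 0 b.

Lemma spin_planarE a b t : spin_planar a b t = cl_vec (delta_mx 0 a) * cl_vec (u a b t).
Proof.
rewrite cl_vecD !cl_vecZ !cl_vec_delta mulrDr !clAr gamma_sqr.
by rewrite scaleNr scalerN opprK -idmxE scalemx1.
Qed.

Let unit_delta a : unitv (delta_mx 0 a : 'rV[R]_m).
Proof.
rewrite /unitv (bigD1 a)//= mxE !eqxx expr1n big1 ?addr0// => i /negbTE ia.
by rewrite mxE ia andbF expr0n.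
Qed.

Let unit_u a b t : a != b -> unitv (u a b t).
Proof.
move=> ab; rewrite /unitv.
have ba : (b == a) = false by rewrite eq_sym (negbTE ab).
rewrite (bigD1 a)//= (bigD1 b) ?ba//= big1 ?addr0; last first.
  by move=> i /andP[/negbTE ia /negbTE ib]; rewrite !mxE ia ib !andbF !mulr0 addr0 expr0n.
rewrite !mxE !eqxx (negbTE ab) ba /= !mulr0 !mulr1 addr0 add0r sqrrN.
exact: cos2Dsin2.
Qed.

Lemma spin_planar_Spin a b t : a != b -> Spin (spin_planar a b t).
Proof. by move=> ab; rewrite spin_planarE; apply: Spin_vec2; [exact: unit_delta|exact: unit_u]. Qed.

(** The plane rotation is the product of two halfturns. *)
Lemma Pi_planar a b t : a != b -> Pi (spin_planar a b t) = planar a b t.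
Proof.
move=> ab; apply: isPi_Pi; first exact/Spin_unit/spin_planar_Spin.
suff -> : planar a b t = halfturn (delta_mx 0 a) *m halfturn (u a b t).
  rewrite spin_planarE; apply: isPiM; apply: isPi_vec; [exact: unit_delta|exact: unit_u].
apply/matrixP => i k; rewrite [RHS]mxE.
have -> : \sum_j halfturn (delta_mx 0 a) i j * halfturn (u a b t) j k =
    (if i == a then 1 else -1) * halfturn (u a b t) i k.
  rewrite (bigD1 i)//= big1 ?addr0; last first.
    move=> j ji; rewrite halfturnE !mxE eqxx /=.
    have [ja|_] := eqVneq j a; last by rewrite mulr0 mulr0 eq_sym (negbTE ji) subr0 mul0r.
    by rewrite -ja eq_sym (negbTE ji) mul0r mulr0 subr0 mul0r.
  congr (_ * _); rewrite halfturnE !mxE !eqxx /=; case: (i == a) => /=; ring.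
have ba : (b == a) = false by rewrite eq_sym (negbTE ab).
have cs := cos2Dsin2 (t / 2).
have ct : cos t = cos (t / 2) ^+ 2 - sin (t / 2) ^+ 2 by rewrite {1}[t]splitr cosD !expr2.
have st : sin t = 2 * (sin (t / 2) * cos (t / 2)).
  by rewrite {1}[t]splitr sinD [cos _ * _]mulrC mulr_natl mulr2n.
rewrite halfturnE !mxE eqxx /= ct st; move: (sin (t / 2)) (cos (t / 2)) cs => s c cs.
rewrite (eq_sym i k); have ck : ~~ ((k == a) && (k == b)).
  by apply/negP => /andP[/eqP-> ]; rewrite (negbTE ab).
have ci : ~~ ((i == a) && (i == b)).
  by apply/negP => /andP[/eqP-> ]; rewrite (negbTE ab).
have e1 : (k == a) -> (k == i) = (i == a) by move=> /eqP->; rewrite eq_sym.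
have e2 : (k == b) -> (k == i) = (i == b) by move=> /eqP->; rewrite eq_sym.
have e3 : (i == a) -> (k == i) = (k == a) by move=> /eqP->.
have e4 : (i == b) -> (k == i) = (k == b) by move=> /eqP->.
move: (k == i) (k == a) (k == b) (i == a) (i == b) ck ci e1 e2 e3 e4.
move=> [] [] [] [] [] //= _ _ e1 e2 e3 e4;
  try (by have := e1 isT); try (by have := e2 isT); try (by have := e3 isT);
  try (by have := e4 isT); rewrite ?mulr1n ?mulr0n; nra.
Qed.

Lemma spin_planar0 a b : spin_planar a b 0 = 1.
Proof. by rewrite /spin_planar mul0r cos0 sin0 scale0r addr0 idmxE. Qed.

End PlanarRotation.

Section Exponential.
Variables (R : realType) (n : nat).
Notation Cl := (Clifford R n.+1).
Notation gamma := (@gamma R n.+1).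
Implicit Types (j : 'I_n) (t : R).

Definition lo j : 'I_n.+1 := widen_ord (leqnSn n) j.
Definition hi j : 'I_n.+1 := lift ord0 j.

Lemma lo_neq_hi j : lo j != hi j.
Proof. by apply/eqP => /(congr1 val) /=; rewrite /bump /=; lia. Qed.

(** Of the double sum only the two terms with the indices lo j and hi j remain. *)
Lemma spin_lie_so_basis j : spin_lie (so_basis R j) = 2^-1 *: (gamma (lo j) * gamma (hi j)) :> Cl.
Proof.
have lh := lo_neq_hi j; have hl : hi j != lo j by rewrite eq_sym.
have one (F : 'I_n.+1 -> Cl) a : (forall i, i != a -> F i = 0) -> \sum_i F i = F a.
  by move=> H; rewrite (bigD1 a)//= big1 ?addr0// => i ia; rewrite H.
have two (F : 'I_n.+1 -> Cl) a b : b != a -> (forall i, i != a -> i != b -> F i = 0) ->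
    \sum_i F i = F a + F b.
  by move=> ba H; rewrite (bigD1 a)//= (bigD1 b)//= big1 ?addr0// => i /andP[ia ib]; rewrite H.
rewrite /spin_lie (two _ _ _ hl); last first.
  move=> i /negbTE i1 /negbTE i2; rewrite big1// => k _.
  by rewrite !mxE i1 i2 !andbF subr0 scale0r.
rewrite (one _ (hi j)) => [|k /negbTE kh]; last first.
  by rewrite !mxE kh (negbTE lh) !andbF subr0 scale0r.
rewrite (one _ (lo j)) => [|k /negbTE kl]; last first.
  by rewrite !mxE kl (negbTE hl) !andbF subr0 scale0r.
rewrite !mxE !eqxx (negbTE lh) (negbTE hl) /= subr0 sub0r scale1r scaleN1r.
rewrite !mulmxE (gamma_anti R hl) opprK -[X in _ *: (X + X)]scale1r -scalerDl scalerA.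
by congr (_ *: _); field.
Qed.

(** As B^2 = -1, the even and odd terms of the exponential series are those of
    the cosine and of the sine. *)
Lemma exp_imaginary (B : Cl) t : B * B = -1 -> cl_exp (t *: B) = (cos t)%:M + (sin t *: B : Cl).
Proof.
move=> BB; apply: cvg_lim => //.
have powZ l : (t *: B) ^+ l = t ^+ l *: (B ^+ l).
  elim: l => [|l IH]; first by rewrite !expr0 scale1r.
  by rewrite !exprS IH clAl clAr scalerA.
have pow k : (t *: B) ^+ k = (t ^+ k * ((~~ odd k)%:R * (-1) ^+ k./2)) *: (1%:M : Cl) +
    (t ^+ k * ((odd k)%:R * (-1) ^+ k.-1./2)) *: B.
  have BB2 : B ^+ 2 = (-1) *: (1%:M : Cl) by rewrite expr2 BB scaleN1r idmxE.
  have ev l : B ^+ l.*2 = ((-1) ^+ l) *: (1%:M : Cl).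
    elim: l => [|l IH]; first by rewrite !expr0 scale1r idmxE.
    rewrite doubleS -addn2 exprD IH BB2 clAl clAr scalerA -exprSr idmxE mulr1.
    by [].
  rewrite powZ; have -> : B ^+ k = (-1) ^+ k./2 *: (B ^+ odd k).
    by rewrite -{1}(odd_double_half k) exprD ev clAr idmxE mulr1.
  case: (boolP (odd k)) => ok /=.
    rewrite expr1 mul0r mulr0 scale0r add0r scalerA mul1r.
    by have -> : k.-1./2 = k./2 by rewrite -{1}(odd_double_half k) ok add1n /= doubleK.
  by rewrite expr0 mul0r mulr0 scale0r addr0 scalerA idmxE mul1r.
have -> : series (fun k => (k`!%:R : R)^-1 *: (t *: B) ^+ k) =
    (fun k => series (cos_coeff t) k *: (1%:M : Cl) + series (sin_coeff t) k *: B).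
  apply/funext => k; rewrite /series /= !scaler_suml -big_split; apply: eq_bigr => l _ /=.
  rewrite pow scalerDr !scalerA /cos_coeff /sin_coeff /=.
  by congr (_ *: _ + _ *: _); rewrite [LHS]mulrC; congr (_ / _); rewrite mulrC.
have cc : series (cos_coeff t) @ \oo --> cos t.
  by rewrite cos.unlock; exact: is_cvg_series_cos_coeff.
have cs : series (sin_coeff t) @ \oo --> sin t.
  by rewrite sin.unlock; exact: is_cvg_series_sin_coeff.
rewrite -[(cos t)%:M]scalemx1.
apply: cvgD; [exact: (@cvgZr_tmp R Cl nat \oo _ _ _ 1%:M cc)|exact: (@cvgZr_tmp R Cl nat \oo _ _ _ B cs)].
Qed.

Lemma acute_genE j : acute_gen R j = spin_planar (lo j) (hi j) (pi / 2).
Proof.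
rewrite /acute_gen /alpha spin_lie_so_basis scalerA exp_imaginary//.
exact/gamma2_sqr/lo_neq_hi.
Qed.

End Exponential.

(** * Signed permutations and reduced words *)

Section SignedPermutations.
Variables (T : realType) (m : nat).
Implicit Types (P Q L : 'M[T]_m) (s r : 'S_m).

Lemma smxE P s i k : smx P s -> P i k = P i (s i) * (k == s i)%:R.
Proof.
move=> /(_ i) h; have E x : P i x = row i P 0 x by rewrite mxE.
rewrite !E; case: h => ->; rewrite !mxE !eqxx; case: eqP => _ /=;
  by rewrite ?mulr1 ?mulr0 ?oppr0.
Qed.

Lemma smx_sqr P s i : smx P s -> P i (s i) ^+ 2 = 1.
Proof.
move=> /(_ i) h; have -> : P i (s i) = row i P 0 (s i) by rewrite mxE.
by case: h => ->; rewrite !mxE !eqxx /= ?sqrrN expr1n.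
Qed.

Lemma sqr1_pm (x : T) : x ^+ 2 = 1 -> x = 1 \/ x = -1.
Proof. by move=> /eqP; rewrite sqrf_eq1 => /orP[]/eqP; [left|right]. Qed.

Lemma smxP P s : (forall i k, P i k = P i (s i) * (k == s i)%:R) ->
  (forall i, P i (s i) ^+ 2 = 1) -> smx P s.
Proof.
move=> PE P2 j; have [e|e] := sqr1_pm (P2 j); [left|right];
  by apply/rowP => k; rewrite !mxE PE e eqxx ?mul1r ?mulN1r.
Qed.

Lemma smx1 : smx (1%:M : 'M[T]_m) (1%g : 'S_m).
Proof. by move=> j; left; apply/rowP => k; rewrite !mxE perm1 eqxx eq_sym. Qed.

Lemma smxM P Q s r : smx P s -> smx Q r -> smx (P *m Q) (s * r)%g.
Proof.
move=> hP hQ.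
have E i k : (P *m Q) i k = P i (s i) * Q (s i) k.
  rewrite mxE (bigD1 (s i))//= big1 ?addr0// => x /negbTE xs.
  by rewrite (smxE _ _ hP) xs mulr0 mul0r.
apply: smxP => [i k|i]; rewrite !E permM; first by rewrite (smxE _ _ hQ) mulrA.
by rewrite exprMn (smx_sqr _ hP) (smx_sqr _ hQ) mulr1.
Qed.

(** Otherwise the minor has a zero row or a zero column. *)
Lemma smx_minor_neq0 P s k (f g : 'I_k -> 'I_m) : smx P s -> minor f g P != 0 ->
  (forall a, exists b, g b = s (f a)) /\ (forall b, exists a, s (f a) = g b).
Proof.
move=> hP; rewrite /minor => nz; split => [a|b].
  apply: contrapT => H; move/eqP: nz; apply.
  rewrite (expand_det_row _ a) big1// => b _; rewrite mxE (smxE _ _ hP).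
  by case: eqP => [e|]; [case: H; exists b|rewrite mulr0 mul0r].
apply: contrapT => H; move/eqP: nz; apply.
rewrite (expand_det_col _ b) big1// => a _; rewrite mxE (smxE _ _ hP).
by case: eqP => [e|]; [case: H; exists a|rewrite mulr0 mul0r].
Qed.

Lemma det_col_linear k (A B C : 'M[T]_k) x a b :
  (forall i, A i x = a * B i x + b * C i x) ->
  (forall i y, y != x -> B i y = A i y /\ C i y = A i y) ->
  \det A = a * \det B + b * \det C.
Proof.
move=> Ax Ay; rewrite -(det_tr A) -(det_tr B) -(det_tr C).
apply: (@determinant_multilinear _ _ _ _ _ x).
- by apply/rowP => i; rewrite !mxE.
- by apply/matrixP => i j; rewrite !mxE; have [] := Ay j (lift x i) _; rewrite 1?eq_sym ?neq_lift.
- by apply/matrixP => i j; rewrite !mxE; have [] := Ay j (lift x i) _; rewrite 1?eq_sym ?neq_lift.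
Qed.

(** These are the minors of Q that occur when the southwest minors of Q L are
    expanded by the Cauchy-Binet formula. *)
Definition bottom_nonneg Q : Prop := forall (i : 'I_m) (g : 'I_i.+1 -> 'I_m),
  sinc g -> 0 <= minor (@bot m i) g Q.

Lemma top_le (i : 'I_m) (g : 'I_i.+1 -> 'I_m) : sinc g -> forall a, (top a <= g a)%N.
Proof.
move=> sg [a ai]; rewrite /=; elim: a ai => // a IH ai.
by apply: leq_ltn_trans (IH (ltnW ai)) _; apply: sg.
Qed.

(** All terms of the expansion are nonnegative, and they do not all vanish
    since the last i+1 rows of Q are linearly independent. *)
Lemma bottom_nonneg_sw Q L i : bottom_nonneg Q -> Q \in unitmx -> tpos L ->
  0 < sw i (Q *m L).
Proof.
move=> hQ uQ hL.
have E : mxsub (@bot m i) (@top m i) (Q *m L) = rowsub (@bot m i) Q *m colsub (@top m i) L.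
  by apply/matrixP => a b; rewrite !mxE; apply: eq_bigr => x _; rewrite !mxE.
have mE (g : 'I_i.+1 -> 'I_m) : \det (colsub g (rowsub (@bot m i) Q)) = minor (@bot m i) g Q.
  by congr (\det _); apply/matrixP => a b; rewrite !mxE.
have mL (g : 'I_i.+1 -> 'I_m) : \det (rowsub g (colsub (@top m i) L)) = minor g (@top m i) L.
  by congr (\det _); apply/matrixP => a b; rewrite !mxE.
have posL g : sinc g -> 0 < minor g (@top m i) L.
  by move=> sg; apply: hL => //; exact: top_le.
have [g0 sg0 g0Q] : exists2 g0, sinc g0 & minor (@bot m i) g0 Q != 0.
  apply: contrapT => H.
  have : \det (rowsub (@bot m i) Q *m colsub (@bot m i) (invmx Q)) = 0.
    apply: det_mulmx_eq0 => g sg; rewrite mE [minor _ _ _](_ : _ = 0) ?mul0r//.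
    by apply/eqP/negPn/negP => h; apply: H; exists g.
  have -> : rowsub (@bot m i) Q *m colsub (@bot m i) (invmx Q) = 1%:M.
    transitivity (mxsub (@bot m i) (@bot m i) (Q *m invmx Q)).
      by apply/matrixP => a b; rewrite !mxE; apply: eq_bigr => x _; rewrite !mxE.
    rewrite mulmxV//; apply/matrixP => a b; rewrite !mxE.
    by rewrite (inj_eq (sinc_inj (@bot_sinc m i))).
  by rewrite det1 => /eqP; rewrite oner_eq0.
rewrite /sw /minor E; apply: (det_mulmx_gt0 (f0 := g0)) => //.
  by move=> g sg; rewrite mE mL mulr_ge0 ?hQ ?ltW ?posL.
by rewrite mE mL mulr_gt0 ?posL// lt_neqAle eq_sym g0Q hQ.
Qed.

End SignedPermutations.

Section RotateColumns.
Variables (T : realType) (n : nat).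
Notation m := n.+1.
Implicit Types (P Q L : 'M[T]_m) (s r : 'S_m) (j : 'I_n) (t : T).

Definition rotmx j t : 'M[T]_m := planar (lo j) (hi j) t.

Lemma hiE j : hi j = (lo j).+1 :> nat. Proof. by []. Qed.

Lemma rot_mulE Q j t i k : (Q *m rotmx j t) i k =
  if k == lo j then cos t * Q i (lo j) + sin t * Q i (hi j)
  else if k == hi j then cos t * Q i (hi j) - sin t * Q i (lo j) else Q i k.
Proof.
have lh := lo_neq_hi j; have hl : hi j != lo j by rewrite eq_sym.
have two (F : 'I_m -> T) : (forall x, x != lo j -> x != hi j -> F x = 0) ->
    \sum_x F x = F (lo j) + F (hi j).
  by move=> H; rewrite (bigD1 (lo j))//= (bigD1 (hi j))//= big1 ?addr0// => x /andP[a b]; rewrite H.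
rewrite mxE; have [->|kl] := eqVneq k (lo j).
  rewrite two => [|x /negbTE xl /negbTE xh]; last by rewrite mxE eqxx xl xh !mul0r addr0 mulr0.
  by rewrite !mxE !eqxx (negbTE lh) (negbTE hl) /= !mul0r !mul1r addr0 add0r; congr (_ + _); rewrite mulrC.
have [->|kh] := eqVneq k (hi j).
  rewrite two => [|x /negbTE xl /negbTE xh]; last by rewrite mxE (negbTE hl) eqxx xl xh !mul0r subr0 mulr0.
  by rewrite !mxE !eqxx (negbTE lh) (negbTE hl) /= !mul0r !mul1r subr0 sub0r; ring.
rewrite (bigD1 k)//= mxE (negbTE kl) (negbTE kh) eqxx mulr1 big1 ?addr0// => x /negbTE xk.
by rewrite mxE (negbTE kl) (negbTE kh) xk mulr0.
Qed.

Lemma SO_rot j t : SO (rotmx j t).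
Proof. by rewrite /rotmx -Pi_planar ?lo_neq_hi//; apply/Pi_SO/spin_planar_Spin/lo_neq_hi. Qed.

Lemma smx_rot j : smx (rotmx j (pi / 2)) (gen j).
Proof.
have lh := lo_neq_hi j; have hl : hi j != lo j by rewrite eq_sym.
have E i k : rotmx j (pi / 2) i k =
    if k == lo j then (i == hi j)%:R else if k == hi j then - (i == lo j)%:R else (i == k)%:R.
  by rewrite mxE cos_pihalf sin_pihalf !mulr0 !mulr1 add0r sub0r.
have gl : gen j (lo j) = hi j by rewrite /gen tpermL.
have gh : gen j (hi j) = lo j by rewrite /gen tpermR.
have gx x : x != lo j -> x != hi j -> gen j x = x.
  by move=> xl xh; rewrite /gen tpermD// eq_sym.
have C i : [\/ i = lo j, i = hi j | i != lo j /\ i != hi j].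
  have [->|il] := eqVneq i (lo j); first by constructor 1.
  by have [->|ih] := eqVneq i (hi j); [constructor 2|constructor 3].
apply: smxP => [i k|i]; have [->|->|[il ih]] := C i; rewrite ?gl ?gh ?gx// !E ?eqxx ?(negbTE lh) ?(negbTE hl) ?(negbTE il) ?(negbTE ih) //=;
  rewrite ?sqrrN ?expr1n// ?mulN1r ?mul1r.
- by case: (eqVneq k (lo j)) => [->|_]; rewrite ?(negbTE lh) ?oppr0//; case: ifP => // _; rewrite oppr0.
- by case: (eqVneq k (lo j)) => // kl; case: (eqVneq k (hi j)) => _; rewrite ?oppr0.
- have [->|kl] := eqVneq k (lo j); first by rewrite eq_sym (negbTE il).
  have [->|kh] := eqVneq k (hi j); first by rewrite eq_sym (negbTE ih) oppr0.
  by rewrite eq_sym.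
Qed.

(** Along an ascent only the columns lo j and hi j interact: a selection that
    contains hi j but not lo j cannot lose its sign, since replacing hi j by
    lo j gives a minor that vanishes. *)
Lemma bottom_nonneg_rot Q s j t : smx Q s -> ((s^-1)%g (lo j) < (s^-1)%g (hi j))%N ->
  0 <= t <= pi / 2 -> bottom_nonneg Q -> bottom_nonneg (Q *m rotmx j t).
Proof.
move=> hQ asc /andP[t0 t1] nQ i g sg.
have ct : 0 <= cos t by apply: cos_ge0_pihalf; rewrite t1 andbT (le_trans _ t0)// oppr_le0 divr_ge0 ?pi_ge0.
have st : 0 <= sin t.
  by apply: sin_ge0_pi; rewrite t0 (le_trans t1)// ler_pdivrMr// ler_peMr ?pi_ge0// ler1n.
have lh := lo_neq_hi j; have hl : hi j != lo j by rewrite eq_sym.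
have gi := sinc_inj sg.
have subE (A : 'M[T]_m) k (f h : 'I_k -> 'I_m) a b : mxsub f h A a b = A (f a) (h b) by rewrite mxE.
have [[x xl]|nl] := pselect (exists x, g x = lo j);
    have [[y yh]|nh] := pselect (exists y, g y = hi j).
- have -> : minor (@bot m i) g (Q *m rotmx j t) = minor (@bot m i) g Q * minor g g (rotmx j t).
    rewrite /minor (@mxsub_mul_support _ _ _ _ _ _ _ g) ?det_mulmx// => k a b H.
    rewrite [rotmx _ _ _ _]mxE.
    have kl : (k == lo j) = false by apply/eqP => e; move: (H x); rewrite xl e eqxx.
    have kh : (k == hi j) = false by apply/eqP => e; move: (H y); rewrite yh e eqxx.
    have kb : (k == g b) = false by rewrite eq_sym (negbTE (H b)).
    by rewrite kl kh kb /= !mul0r addr0 subr0; case: ifP => _; [|case: ifP => _]; rewrite mulr0.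
  have xy : x != y by apply/eqP => e; move: lh; rewrite -xl -yh e eqxx.
  have -> : minor g g (rotmx j t) = 1.
    have -> : minor g g (rotmx j t) = \det (planar x y t).
      congr (\det _); apply/matrixP => a b; rewrite !mxE -xl -yh !(inj_eq gi).
      by [].
    by rewrite -Pi_planar//; have [] := Pi_SO (spin_planar_Spin t xy).
  by rewrite mulr1 nQ.
- pose g' a := if a == x then hi j else g a.
  have sg' : sinc g'.
    move=> a b ab; rewrite /g'; case: eqP => [ax|/eqP ax]; case: eqP => [bx|/eqP bx].
    + by move: ab; rewrite ax bx ltnn.
    + have := sg _ _ ab; rewrite hiE ax xl => lb; rewrite ltn_neqAle lb andbT; apply/eqP => e.
      by apply: nh; exists b; apply/val_inj; rewrite /= -e.
    + by have := sg _ _ ab; rewrite bx xl => /leqW.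
    + exact: sg.
  have -> : minor (@bot m i) g (Q *m rotmx j t) =
      cos t * minor (@bot m i) g Q + sin t * minor (@bot m i) g' Q.
    apply: (@det_col_linear _ _ _ _ _ x) => [a|a b bx].
      by rewrite !subE rot_mulE xl eqxx /g' eqxx.
    rewrite !subE rot_mulE /g' (negbTE bx); split; case: eqP => [e|_].
    + by move: bx; rewrite -(inj_eq gi) xl e eqxx.
    + by case: eqP => // e; case: nh; exists b.
    + by move: bx; rewrite -(inj_eq gi) xl e eqxx.
    + by case: eqP => // e; case: nh; exists b.
  by rewrite addr_ge0// mulr_ge0// nQ.
- pose g' a := if a == y then lo j else g a.
  have -> : minor (@bot m i) g (Q *m rotmx j t) =
      cos t * minor (@bot m i) g Q + (- sin t) * minor (@bot m i) g' Q.
    apply: (@det_col_linear _ _ _ _ _ y) => [a|a b bx].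
      by rewrite !subE rot_mulE yh (negbTE hl) eqxx /g' eqxx mulNr.
    rewrite !subE rot_mulE /g' (negbTE bx); split; case: eqP => [e|_].
    + by case: nl; exists b.
    + by case: eqP => // e; move: bx; rewrite -(inj_eq gi) yh e eqxx.
    + by case: nl; exists b.
    + by case: eqP => // e; move: bx; rewrite -(inj_eq gi) yh e eqxx.
  have -> : minor (@bot m i) g' Q = 0.
    apply/eqP/negPn/negP => /(smx_minor_neq0 hQ)[H1 H2].
    have [a ay] := H2 y; rewrite /g' eqxx in ay.
    have ae : bot a = (s^-1)%g (lo j) by rewrite -ay permK.
    have [b be] : exists b : 'I_i.+1, bot b = (s^-1)%g (hi j).
      by apply: botP; apply: leq_trans (ltnW asc); rewrite -ae bot_ge.
    have [c] := H1 b; rewrite be permKV /g'; case: eqP => [_ e|cy e].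
      by move: lh; rewrite e eqxx.
    by apply: cy; apply: gi; rewrite e yh.
  by rewrite mulr0 addr0 mulr_ge0// nQ.
- rewrite [minor _ _ _](_ : _ = minor (@bot m i) g Q) ?nQ//.
  congr (\det _); apply/matrixP => a b; rewrite [LHS]mxE [RHS]mxE rot_mulE.
  case: eqP => [e|_]; first by case: nl; exists b.
  by case: eqP => [e|//]; case: nh; exists b.
Qed.

Lemma bottom_nonneg1 : bottom_nonneg (1%:M : 'M[T]_m).
Proof. by move=> i g sg; apply: tnn1 => //; exact: bot_sinc. Qed.

End RotateColumns.

Section ReducedWords.
Variable n : nat.
Notation m := n.+1.
Implicit Types (s r : 'S_m) (j : 'I_n) (w : seq 'I_n).

Definition ascent s j : bool := ((s^-1)%g (lo j) < (s^-1)%g (hi j))%N.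

(** Exchanging two neighbouring values preserves the order of all other pairs. *)
Lemma gen_lt j (x y : 'I_m) : ~ (x = lo j /\ y = hi j) -> ~ (x = hi j /\ y = lo j) ->
  (gen j x < gen j y)%N = (x < y)%N.
Proof.
move=> n1 n2; rewrite /gen -/(lo j) -/(hi j).
have hl := hiE j.
have [xl|xl|nxl nxh] := tpermP (lo j) (hi j) x; have [yl|yl|nyl nyh] := tpermP (lo j) (hi j) y;
  rewrite ?xl ?yl ?ltnn//.
- by case: n1.
- have : val y <> hi j by move=> e; apply: nyh; apply/val_inj.
  have : val y <> lo j by move=> e; apply: nyl; apply/val_inj.
  by rewrite /=; move: (hiE j) => /= ->; lia.
- by case: n2.
- have : val y <> hi j by move=> e; apply: nyh; apply/val_inj.
  have : val y <> lo j by move=> e; apply: nyl; apply/val_inj.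
  by rewrite /=; move: (hiE j) => /= ->; lia.
- have : val x <> hi j by move=> e; apply: nxh; apply/val_inj.
  have : val x <> lo j by move=> e; apply: nxl; apply/val_inj.
  by rewrite /=; move: (hiE j) => /= ->; lia.
- have : val x <> hi j by move=> e; apply: nxh; apply/val_inj.
  have : val x <> lo j by move=> e; apply: nxl; apply/val_inj.
  by rewrite /=; move: (hiE j) => /= ->; lia.
Qed.

(** The new inversion is the pair of positions of lo j and hi j. *)
Lemma inversions_ascent s j : ascent s j -> inversions (s * gen j)%g = (inversions s).+1.
Proof.
rewrite /ascent => asc.
pose p0 := ((s^-1)%g (lo j), (s^-1)%g (hi j)).
rewrite /inversions (cardD1 p0) [X in (X + _)%N](_ : _ = 1%N); last first.
  rewrite inE /= asc !permM !permKV /gen tpermL tpermR.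
  by rewrite -/(lo j) -/(hi j) hiE ltnSn.
rewrite add1n; congr _.+1; apply: eq_card => -[a b]; rewrite !inE /=.
rewrite !permM; case: eqP => [[-> ->]|np] /=.
  by rewrite asc !permKV hiE /= ltnNge leqnSn.
have [ab|] := ltnP a b => //=; apply: gen_lt => -[e1 e2].
  by move: ab asc; rewrite -e1 -e2 !permK => /ltnW; rewrite leqNgt => /negbTE->.
by apply: np; rewrite /p0 -e1 -e2 !permK.
Qed.

Lemma genK j : (gen j * gen j = 1)%g. Proof. exact: tperm2. Qed.

Lemma descent_gen s j : ~~ ascent s j -> ascent (s * gen j)%g j.
Proof.
rewrite /ascent -leqNgt => d; rewrite invMg !permM tpermV tpermL tpermR.
rewrite ltn_neqAle d andbT; apply/eqP => /val_inj/perm_inj e.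
by move: (lo_neq_hi j); rewrite /lo /hi e eqxx.
Qed.

Lemma inversions_descent s j : ~~ ascent s j -> inversions s = (inversions (s * gen j)%g).+1.
Proof.
by move=> d; rewrite -(inversions_ascent (descent_gen d)) -mulgA genK mulg1.
Qed.

(** A word is ascending from s when each of its letters increases the number
    of inversions. *)
Fixpoint ascending s w : bool :=
  if w is j :: w' then ascent s j && ascending (s * gen j)%g w' else true.

(** A letter changes the number of inversions by one, so only an ascending word
    can add its length. *)
Lemma inversions_word s w : (inversions (s * \prod_(j <- w) gen j)%g <= inversions s + size w)%N
  /\ (inversions (s * \prod_(j <- w) gen j)%g = (inversions s + size w)%N -> ascending s w).
Proof.
elim: w s => [|j w IH] s /=; first by rewrite big_nil mulg1 addn0.
rewrite big_cons mulgA; have [H1 H2] := IH (s * gen j)%g.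
have [asc|/inversions_descent e] := boolP (ascent s j).
  by rewrite addnS -addSn -(inversions_ascent asc); split => // /H2.
rewrite e; split; first by apply: leq_trans H1 _; lia.
by move=> E; move: H1; rewrite E; lia.
Qed.

Lemma inversions1 : inversions (1%g : 'S_m) = 0%N.
Proof.
apply: eq_card0 => -[a b]; rewrite !inE /= !perm1.
by case: ltnP => //= ab; rewrite ltnNge ltnW.
Qed.

Lemma reduced_ascending s w : reduced_word s w -> ascending 1%g w.
Proof.
move=> [sw zw]; have [_] := inversions_word 1%g w; apply.
by rewrite mul1g -sw inversions1 add0n zw.
Qed.

(** The inverse of s is increasing, so its values exceed their arguments, and
    their sums agree. *)
Lemma no_descent s : (forall j, ascent s j) -> s = 1%g.
Proof.
move=> H; have inc : sinc (s^-1)%g.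
  move=> [a am] [b bm]; rewrite /=; elim: b bm => // b IH bm.
  have bn : (b < n)%N by rewrite -ltnS.
  have := H (Ordinal bn); rewrite /ascent.
  have -> : lo (Ordinal bn) = Ordinal (ltnW bm) by apply/val_inj.
  have -> : hi (Ordinal bn) = Ordinal bm by apply/val_inj.
  move=> h; rewrite ltnS leq_eqVlt => /predU1P[ab|ab].
    by rewrite (_ : Ordinal am = Ordinal (ltnW bm))//; apply/val_inj.
  exact: ltn_trans (IH (ltnW bm) ab) h.
have ge (a : 'I_m) : (a <= (s^-1)%g a)%N.
  case: a => a am; rewrite [nat_of_ord (Ordinal am)]/=; elim: a am => // a IH am.
  by apply: leq_ltn_trans (IH (ltnW am)) _; apply: inc.
apply: invg_inj; rewrite invg1; apply/permP => a; rewrite perm1; apply/val_inj/eqP.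
have [_ E] := leqif_sum (fun a (_ : xpredT a) => leqif_eq (ge a)).
move: E; rewrite (reindex_inj (@perm_inj _ (s^-1)%g)) /= eqxx => /esym/forallP/(_ a).
by rewrite eq_sym.
Qed.

(** Multiplying by the generator of a descent decreases the number of
    inversions. *)
Lemma reduced_word_exists s : exists w, reduced_word s w.
Proof.
have [k] := ubnP (inversions s); elim: k s => // k IH s ks.
have [H|] := pselect (forall j, ascent s j).
  by exists [::]; split; [rewrite big_nil (no_descent H)|rewrite (no_descent H) inversions1].
move=> /existsNP[j /negP d]; have e := inversions_descent d.
have [|w [sw zw]] := IH (s * gen j)%g; first by rewrite -e.
exists (rcons w j); split; last by rewrite size_rcons zw e.
have e2 : s = (s * gen j * gen j)%g by rewrite -mulgA genK mulg1.
by rewrite {1}e2 sw -cats1 big_cat big_seq1.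
Qed.

Lemma some_reduced_wordP s : reduced_word s (some_reduced_word s).
Proof. by have [w hw] := reduced_word_exists s; exact: xgetPex (ex_intro _ w hw). Qed.

End ReducedWords.

(** * Probing a cell by totally positive matrices *)

Section Probe.
Variables (T : realType) (n : nat).
Notation m := n.+1.
Implicit Types (P Q L U V Y : 'M[T]_m) (s : 'S_m) (i : 'I_m) (t : T).

(** The exponential exp (t N) of the matrix N = subdiag, by its entries: the
    total positivity of lam t comes from the flow, its behaviour for small t
    from the entries. *)
Definition lam t : 'M[T]_m := \matrix_(i, j)
  if (j <= i)%N then t ^+ (i - j) / ((i - j)`!)%:R else 0.

Definition subdiag : 'M[T]_m := \matrix_(i, j) (i == j.+1 :> nat)%:R.

Lemma lower1_lam t : lower1 (lam t).
Proof.
move=> i j ij; rewrite mxE; have [->|ne] := eqVneq i j.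
  by rewrite leqnn subnn expr0 fact0 divr1.
by rewrite leqNgt ltn_neqAle ij andbT val_eqE ne.
Qed.

Lemma lead_lower1 L i : lower1 L -> lead i L = 1.
Proof. by move=> hL; apply: det_mxsub_lower1 => //; exact: top_sinc. Qed.

Lemma lowf_lower1 L : lower1 L -> lowf L = L.
Proof. by move=> hL; rewrite -{1}[L]mulmx1 lowf_LU//; [exact: upper1|move=> i; rewrite mxE eqxx oner_neq0]. Qed.

Lemma lam0 : lam 0 = 1%:M.
Proof.
apply/matrixP => i j; rewrite !mxE; case: leqP => ij.
  rewrite expr0n subn_eq0; have [->|ne] := eqVneq i j; first by rewrite leqnn subnn divr1.
  by rewrite leqNgt ltn_neqAle ij andbT val_eqE eq_sym ne mul0r.
by case: eqP ij => // ->; rewrite ltnn.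
Qed.

Lemma der_X t k : der t (fun x : T => x ^+ k) (k%:R * t ^+ k.-1).
Proof.
elim: k => [|k IH]; first by rewrite mul0r; apply: der_ext (der_cst t 1) => x; rewrite expr0.
have := derM IH (is_derive_id t 1); rewrite /der => h.
have -> : k.+1%:R * t ^+ k.+1.-1 = k%:R * t ^+ k.-1 * t + t ^+ k * 1.
  by case: k {IH h} => [|k]; rewrite /= ?expr0 ?mul0r ?add0r// -mulrA -exprSr mulr1 -natr1 mulrDl mul1r.
by apply: der_ext h => x; rewrite exprSr.
Qed.

Lemma mxder_lam t : mxder t lam (lam t *m subdiag).
Proof.
move=> i j.
have -> : (lam t *m subdiag) i j = if (j < i)%N then t ^+ (i - j).-1 / ((i - j).-1`!)%:R else 0.
  rewrite mxE; case: ltnP => ji.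
    have jm : (j.+1 < m)%N by apply: leq_ltn_trans ji (ltn_ord i).
    rewrite (bigD1 (Ordinal jm))//= big1 ?addr0; last first.
      move=> k kj; rewrite [subdiag _ _]mxE (_ : (k == j.+1 :> nat) = false) ?mulr0//.
      by apply/negbTE; apply: contra kj => /eqP e; apply/eqP/val_inj.
    by rewrite !mxE /= eqxx mulr1 ji subnS.
  rewrite big1// => k _; rewrite !mxE; case: eqP => [e|_]; last by rewrite mulr0.
  by rewrite e ltnNge ji mul0r.
have -> : (if (j < i)%N then t ^+ (i - j).-1 / ((i - j).-1`!)%:R else 0) =
    if (j <= i)%N then ((i - j)%:R * t ^+ (i - j).-1) * ((i - j)`!)%:R^-1 + t ^+ (i - j) * 0 else 0 :> T.
  rewrite mulr0 addr0; case: (ltngtP j i) => // [ji|->]; last by rewrite subnn !mul0r.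
  have k0 : (0 < i - j)%N by rewrite subn_gt0.
  case: (i - j)%N k0 => // k _ /=; rewrite factS natrM invfM mulrA [_ * t ^+ k]mulrC mulfK ?pnatr_eq0//.
case: (leqP j i) => ji.
  by apply: der_ext (derM (der_X t (i - j)) (der_cst t ((i - j)`!)%:R^-1)) => x; rewrite mxE ji.
by apply: der_ext (der_cst t 0) => x; rewrite mxE leqNgt ji.
Qed.

Lemma bounded_AC_id (a b : T) : bounded_AC a b id.
Proof.
split; last first.
  exists (`|a| + `|b|) => t /andP[at_ tb].
  rewrite ler_norml; apply/andP; split.
    apply: le_trans (ltW at_); rewrite lerNl; apply: le_trans (ler_norm _) _.
    by rewrite normrN lerDl.
  by apply: le_trans (ltW tb) _; apply: le_trans (ler_norm _) _; rewrite lerDr.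
move=> e e0; exists e => // N l r lr _; apply: le_lt_trans.
apply: ler_sum => i _; have [_ h _] := lr i.
by rewrite ger0_norm ?subr_ge0.
Qed.

Lemma lam_falg (X : Type) (K : (X -> T) -> Prop) (f : X -> T) : funalg K -> K f ->
  mxK K (fun x => lam (f x)).
Proof.
move=> KA Kf i j; case: (boolP (j <= i)%N) => ji; under eq_fun do rewrite mxE ?ji ?(negbTE ji);
  last exact: (falg_cst KA).
by apply: (falgM KA); [exact: falgX|exact: (falg_cst KA)].
Qed.

(** This is the flow of the constant coefficient N, started at the identity. *)
Lemma tpos_lam t : 0 < t -> tpos (lam t).
Proof.
move=> t0; rewrite -(lowf_lower1 (lower1_lam t)).
apply: (@flow_tpos _ _ (-1) (t + 1) 1 lam set0 _ _ _ _ _ 0) => //.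
- exact: lam_falg (bounded_AC_falg _ _) (bounded_AC_id _ _).
- by move=> u _ i; rewrite lead_lower1//; exact: lower1_lam.
- exact: negligible_set0.
- move=> u _ _; exists subdiag; split; first exact: mxder_lam.
    by move=> i j ij; rewrite mxE gtn_eqF.
  by move=> i j e; rewrite mxE e eqxx.
- by rewrite lowf_lower1 ?lam0; [exact: tnn1|move=> i j _; rewrite mxE].
- by rewrite ltrDl.
Qed.

(** Conjugation by the diagonal matrix of the powers of t turns lam 1 into
    lam t. *)
Lemma lam_homog i (f : 'I_i.+1 -> 'I_m) t :
  minor f (@top m i) (lam t) * \prod_(a < i.+1) t ^+ top a =
  t ^+ (\sum_a f a) * minor f (@top m i) (lam 1).
Proof.
pose A := diag_mx (\row_a t ^+ top a) : 'M[T]_i.+1.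
pose B := diag_mx (\row_a t ^+ f a) : 'M[T]_i.+1.
have -> : \prod_(a < i.+1) t ^+ top a = \det A.
  by rewrite det_diag; apply: eq_bigr => a _; rewrite mxE.
have -> : t ^+ (\sum_a f a) = \det B.
  by rewrite det_diag expr_sum; apply: eq_bigr => a _; rewrite mxE.
rewrite /minor -!det_mulmx; congr (\det _); apply/matrixP => a b.
rewrite mul_mx_diag mul_diag_mx !mxE; case: ifP => ba; last by rewrite mul0r mulr0.
by rewrite expr1n mulrAC -exprD subnK// mulrA mulr1.
Qed.

Definition coef i Y (f : {ffun 'I_i.+1 -> 'I_m}) : T :=
  minor (@bot m i) f Y * minor f (@top m i) (lam 1).

(** The Cauchy-Binet formula, cleared of denominators, as a polynomial in t. *)
Lemma sw_lam i Y t : (i.+1`!)%:R * sw i (Y *m lam t) * \prod_(a < i.+1) t ^+ top a =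
  \sum_(f : {ffun 'I_i.+1 -> 'I_m}) coef Y f * t ^+ (\sum_a f a).
Proof.
have -> : sw i (Y *m lam t) = \det (rowsub (@bot m i) Y *m colsub (@top m i) (lam t)).
  by congr (\det _); apply/matrixP => a b; rewrite !mxE; apply: eq_bigr => x _; rewrite !mxE.
rewrite Cauchy_Binet mulr_suml; apply: eq_bigr => f _.
have -> : \det (colsub f (rowsub (@bot m i) Y)) = minor (@bot m i) f Y.
  by congr (\det _); apply/matrixP => a b; rewrite !mxE.
have -> : \det (rowsub f (colsub (@top m i) (lam t))) = minor f (@top m i) (lam t).
  by congr (\det _); apply/matrixP => a b; rewrite !mxE.
by rewrite -mulrA lam_homog /coef -mulrA [X in _ * X = _]mulrC.
Qed.

(** Some term of the Leibniz formula is nonzero. *)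
Lemma upper_minor_neq0 k (f g : 'I_k -> 'I_m) V : upper V -> minor f g V != 0 ->
  exists p : 'S_k, forall a, (f a <= g (p a))%N.
Proof.
move=> hV nz; apply: contrapT => H; move/eqP: nz; apply; apply: big1 => p _.
have [a ga] : exists a, (g (p a) < f a)%N.
  by apply: contrapT => H'; apply: H; exists p => a; rewrite leqNgt; apply/negP => h; apply: H'; exists a.
by rewrite (bigD1 a)//= mxE hV// mul0r mulr0.
Qed.

Lemma upper_minor_sum k (f g : 'I_k -> 'I_m) V : upper V -> minor f g V != 0 ->
  (\sum_a f a <= \sum_a g a)%N /\
  ((\sum_a f a = \sum_a g a)%N -> exists p : 'S_k, forall a, f a = g (p a)).
Proof.
move=> hV nz; have [p fp] := upper_minor_neq0 hV nz.
rewrite [X in (_ <= X)%N](reindex_inj (@perm_inj _ p)) [X in _ = X -> _](reindex_inj (@perm_inj _ p)).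
have [le e] := leqif_sum (fun a (_ : xpredT a) => leqif_eq (fp a)); split => // E.
exists p => a; move: e; rewrite E eqxx => /esym/forallP/(_ a)/eqP.
by move=> /val_inj.
Qed.

(** Up to a factor that does not depend on f, the coefficient of the selection f
    is a minor of the upper triangular V with rows k0 = s o bot times a minor of
    lam 1. The first vanishes unless some permutation of f dominates k0; so the sum
    d0 of the indices of k0 is the lowest degree. The selections of degree d0 that
    contribute are the permutations of k0, and they all have the same
    coefficient. *)
Lemma coef_double_coset i P s U V (hP : smx P s) (hU : posup U) (hV : posup V) :
  let d0 := (\sum_(a < i.+1) s (bot a))%N in
  (forall f : {ffun 'I_i.+1 -> 'I_m}, (\sum_a f a < d0)%N -> coef (U *m P *m V) f = 0) /\
  \sum_(f : {ffun 'I_i.+1 -> 'I_m} | (\sum_a f a == d0)%N) coef (U *m P *m V) f != 0.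
Proof.
set Y := U *m P *m V => d0.
pose u := \det (mxsub (@bot m i) (@bot m i) U).
have u0 : 0 < u by rewrite /u (det_mxsub_upper (@bot_sinc m i) hU.1); apply: prodr_gt0 => a _; exact: hU.2.
pose e := \prod_(a < i.+1) P (bot a) (s (bot a)).
have e0 : e != 0.
  by apply/prodf_neq0 => a _; apply/eqP => h; have := smx_sqr (bot a) hP; rewrite h expr0n => /eqP; rewrite eq_sym oner_eq0.
have YE k (f : 'I_i.+1 -> 'I_m) : k = (fun a => s (bot a)) ->
    minor (@bot m i) f Y = u * e * minor k f V.
  move=> ->; rewrite /minor /Y -mulmxA (mxsub_upper_mul _ _ hU.1) det_mulmx -/u -mulrA; congr (_ * _).
  have -> : mxsub (@bot m i) f (P *m V) = diag_mx (\row_a P (bot a) (s (bot a))) *m mxsub (fun a => s (@bot m i a)) f V.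
    apply/matrixP => a b; rewrite mul_diag_mx !mxE (bigD1 (s (bot a)))//= big1 ?addr0// => x xs.
    by rewrite (smxE _ _ hP) (negbTE xs) mulr0 mul0r.
  by rewrite det_mulmx det_diag; congr (_ * _); apply: eq_bigr => a _; rewrite mxE.
pose k0 (a : 'I_i.+1) := s (@bot m i a).
have k0i : injective k0 by move=> a b /perm_inj/(sinc_inj (@bot_sinc m i)).
have [p sh] := sort_sinc k0i; pose h := [ffun a => k0 (p a)].
have dh : (\sum_a h a)%N = d0.
  by rewrite /d0 [RHS](reindex_inj (@perm_inj _ p)); apply: eq_bigr => a _; rewrite ffunE.
have sh' : sinc h by move=> a b ab; rewrite !ffunE; exact: sh.
have hp : (h : _ -> _) = k0 \o p by apply/funext => a; rewrite ffunE.
have coefP (q : 'S_i.+1) (g f : {ffun 'I_i.+1 -> 'I_m}) : (forall a, g a = f (q a)) ->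
    coef Y g = coef Y f.
  move=> gf; have gE : (g : _ -> _) = f \o q by apply/funext => a; rewrite gf.
  rewrite /coef gE /minor.
  have -> : mxsub (@bot m i) (f \o q) Y = colsub (f \o q) (rowsub (@bot m i) Y) by apply/matrixP => a b; rewrite !mxE.
  have -> : mxsub (f \o q) (@top m i) (lam 1) = rowsub (f \o q) (colsub (@top m i) (lam 1)) by apply/matrixP => a b; rewrite !mxE.
  rewrite det_colsub_perm det_rowsub_perm mulrACA -expr2 sqrr_sign mul1r.
  by congr (_ * _); congr (\det _); apply/matrixP => a b; rewrite !mxE.
have ch : coef Y h != 0.
  rewrite /coef mulf_neq0//; last first.
    rewrite gt_eqF//; apply: tpos_lam => //; exact: top_le.
  have -> : minor (@bot m i) h Y = u * e * ((-1) ^+ p * minor h h V).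
    rewrite (YE k0)//; congr (_ * _).
    have -> : minor h h V = \det (rowsub (k0 \o p) (colsub h V)).
      by congr (\det _); apply/matrixP => a b; rewrite !mxE hp.
    rewrite det_rowsub_perm mulrA -expr2 sqrr_sign mul1r.
    by congr (\det _); apply/matrixP => a b; rewrite !mxE.
  apply: mulf_neq0; first by rewrite mulf_neq0// gt_eqF.
  rewrite mulf_neq0 ?signr_eq0// gt_eqF// /minor (det_mxsub_upper sh' hV.1).
  by apply: prodr_gt0 => a _; exact: hV.2.
split => [f fd|].
  rewrite /coef (YE k0)// (_ : minor k0 f V = 0) ?mulr0 ?mul0r//.
  apply/eqP/negPn/negP => /(upper_minor_sum hV.1)[le _].
  by move: fd; rewrite ltnNge le.
suff H : 0 < (\sum_(f : {ffun 'I_i.+1 -> 'I_m} | (\sum_a f a == d0)%N) coef Y f) * coef Y h.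
  by apply/eqP => E; move: H; rewrite E mul0r ltxx.
rewrite (bigD1 h) ?dh//= mulrDl ltr_wpDr//; last first.
  by rewrite lt_neqAle eq_sym mulf_neq0//= -expr2 sqr_ge0.
rewrite mulr_suml; apply: sumr_ge0 => f /andP[/eqP fd _].
have [->|nz] := eqVneq (coef Y f) 0; first by rewrite mul0r.
have : minor k0 f V != 0 by apply: contra nz => /eqP E; rewrite /coef (YE k0)// E mulr0 mul0r.
move=> /(upper_minor_sum hV.1)[_ /(_ (esym fd))[q fq]].
rewrite -(coefP (p * q)%g h f) ?sqr_ge0 -?expr2 ?sqr_ge0//.
by move=> a; rewrite ffunE permM fq.
Qed.

End Probe.

Section EntrywiseContinuity.
Variables (R : realType) (X : topologicalType).

Lemma mx_continuous p q (F : X -> 'M[R]_(p, q)) x :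
  mxK (fun f : X -> R => {for x, continuous f}) F -> {for x, continuous F}.
Proof.
move=> cF A [P Px PA]; near=> y; apply: PA => i j.
by move: (i) (j); near: y; do 2 apply: filter_forall => ?; apply: cF; exact: Px.
Unshelve. all: by end_near. Qed.

End EntrywiseContinuity.

Section LocalSigns.
Variables (T : realType) (n : nat).
Notation m := n.+1.
Implicit Types (P Q L U V Y : 'M[T]_m) (s : 'S_m) (i : 'I_m) (t : T).

Definition Up_coset P : set 'M[T]_m :=
  [set Y | exists U V, [/\ posup U, posup V & Y = U *m P *m V]].

(** The degree d0 of the lowest term is constant on the double coset, its
    coefficient is continuous, and the coefficients of the other terms are
    bounded near Y0; so t can be chosen independently of Y. *)
Lemma probe_sign P s Y0 i : smx P s -> Up_coset P Y0 ->
  exists2 e : T, e != 0 & \forall Y \near nbhs Y0 & t \near (0 : T)^'+,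
    Up_coset P Y -> 0 < sw i (Y *m lam n t) * e.
Proof.
move=> hP [U [V [hU hV Y0E]]].
pose d0 := (\sum_(a < i.+1) s (bot a))%N.
pose c Y := \sum_(f : {ffun 'I_i.+1 -> 'I_m} | (\sum_a f a == d0)%N) coef Y f.
pose r Y := \sum_(f : {ffun 'I_i.+1 -> 'I_m} | (d0 < \sum_a f a)%N) `|coef Y f|.
have c0 : c Y0 != 0 by have [_] := coef_double_coset i hP hU hV; rewrite -Y0E.
exists (c Y0) => //.
have contid : mxK (fun f : 'M[T]_m -> T => {for Y0, continuous f}) id.
  by move=> a b; exact: coord_continuous.
have CF := @continuous_falg T 'M[T]_m Y0.
have cf (f : {ffun 'I_i.+1 -> 'I_m}) : {for Y0, continuous (fun Y => coef Y f)}.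
  by apply: (falgM CF); [apply: (falg_minor CF)|exact: (falg_cst CF)].
have cc : {for Y0, continuous c} by apply: (falg_sum CF) => f _; exact: cf.
have cr : {for Y0, continuous r}.
  apply: (falg_sum CF) => f _.
  by apply: (@continuous_comp _ _ _ (fun Y => coef Y f) Num.norm); [exact: cf|exact: norm_continuous].
pose k0 := c Y0 ^+ 2.
have k0p : 0 < k0 by rewrite exprn_even_gt0.
have r0 : 0 <= r Y0 by apply: sumr_ge0 => f _; exact: normr_ge0.
pose K := (r Y0 + 1) * `|c Y0|.
have Kp : 0 < K by rewrite mulr_gt0 ?normr_gt0// ltr_wpDl.
(* t K < k0 / 2 makes the terms of higher degree smaller than the first one *)
exists ([set Y | k0 / 2 < c Y * c Y0 /\ r Y < r Y0 + 1],
        [set t | 0 < t /\ t < Num.min 1 (k0 / 2 / K)]) => /=.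
  split; last first.
    near=> t; split; near: t; first exact: nbhs_right_gt.
    by apply: nbhs_right_lt; rewrite lt_min ltr01 !divr_gt0.
  near=> Y; split; near: Y.
    have ccc : {for Y0, continuous (fun Y => c Y * c Y0)} by apply: (falgM CF) => //; exact: (falg_cst CF).
    apply: (cvgr_gt _ ccc); rewrite -expr2 -/k0.
    by rewrite ltr_pdivrMr// ltr_pMr// ltr1n.
  by apply: (cvgr_lt _ cr); rewrite ltrDl.
move=> [Y t] /= [[cY rY] [t0]]; rewrite lt_min => /andP[t1 tK] [U' [V' [hU' hV' YE]]].
have [low _] := coef_double_coset i hP hU' hV'; rewrite -YE -/d0 in low.
pose W := (i.+1`!)%:R * \prod_(a < i.+1) t ^+ top a.
have W0 : 0 < W by rewrite mulr_gt0 ?ltr0n ?fact_gt0// prodr_gt0// => a _; exact: exprn_gt0.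
pose rest := \sum_(f : {ffun 'I_i.+1 -> 'I_m} | (d0 < \sum_a f a)%N) coef Y f * t ^+ (\sum_a f a - d0.+1).
have E : W * sw i (Y *m lam n t) = t ^+ d0 * (c Y + t * rest).
  rewrite /W mulrAC sw_lam (bigID (fun f : {ffun 'I_i.+1 -> 'I_m} => (\sum_a f a == d0)%N)) /= mulrDr; congr (_ + _).
    by rewrite mulr_sumr; apply: eq_bigr => f /eqP->; rewrite mulrC.
  rewrite (bigID (fun f : {ffun 'I_i.+1 -> 'I_m} => (d0 < \sum_a f a)%N)) /= [X in _ + X]big1 ?addr0; last first.
    move=> f /andP[ne]; rewrite -leqNgt leq_eqVlt (negbTE ne) /= => /low->.
    by rewrite mul0r.
  rewrite (eq_bigl (fun f : {ffun 'I_i.+1 -> 'I_m} => (d0 < \sum_a f a)%N)); last first.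
    by move=> f; case: ltnP => h; rewrite ?andbF// gtn_eqF.
  rewrite mulrA -exprSr mulr_sumr; apply: eq_bigr => f h.
  by rewrite mulrCA -exprD subnKC.
have restr : `|rest| <= r Y.
  apply: le_trans (ler_norm_sum _ _ _) _; apply: ler_sum => f _.
  by rewrite normrM ler_piMr// normrX exprn_ile1// ger0_norm ?(ltW t0)// ltW.
rewrite -(pmulr_rgt0 _ W0) mulrA E -mulrA pmulr_rgt0 ?exprn_gt0// mulrDl.
have : `|t * rest * c Y0| < k0 / 2.
  rewrite !normrM (ger0_norm (ltW t0)) -mulrA.
  have : `|rest| * `|c Y0| <= K by rewrite ler_wpM2r// (le_trans restr)// ltW.
  move=> /(ler_wpM2l (ltW t0)) h; apply: le_lt_trans h _.
  by rewrite -ltr_pdivlMr.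
rewrite ltr_norml => /andP[h _].
by rewrite -(subrr (k0 / 2)) ltrD.
Unshelve. all: by end_near. Qed.

Lemma probe_sign_all P s Y0 : smx P s -> Up_coset P Y0 ->
  exists2 e : 'I_m -> T, (forall i, e i != 0) & \forall Y \near nbhs Y0 & t \near (0 : T)^'+,
    Up_coset P Y -> forall i, 0 < sw i (Y *m lam n t) * e i.
Proof.
move=> hP hY.
have H i := probe_sign i hP hY.
pose e i := s2val (cid2 (H i)).
exists e => [i|]; first exact: (s2valP (cid2 (H i))).
pose f i := [set z : 'M[T]_m * T | Up_coset P z.1 -> 0 < sw i (z.1 *m lam n z.2) * e i].
have : filter_prod (nbhs Y0) (0 : T)^'+ [set z | forall i, f i z].
  have FF : Filter (filter_prod (nbhs Y0) (0 : T)^'+) by apply: filter_prod_filter.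
  apply: (@filter_forall _ _ f _ FF) => i; exact: (s2valP' (cid2 (H i))).
by apply: filterS => -[Y t] /= h dY i; exact: h.
Qed.

End LocalSigns.

(** * Connectedness in the spin group *)

Section LocallyConstant.
Variable X : topologicalType.

(** The points of A where P holds form an open and closed subset of A. *)
Lemma locally_constant (A : set X) (P : X -> Prop) x y : connected A ->
  (forall a, A a -> \forall b \near a, A b -> (P a <-> P b)) -> A x -> A y -> P x -> P y.
Proof.
move=> cA loc Ax Ay Px.
suff E : A `&` P = A by have [] : (A `&` P) y by rewrite E.
apply: cA; first by exists x.
- exists (interior [set b | A b -> P b]); first exact: open_interior.
  apply/seteqP; split => a [Aa]; first by move=> Pa; split => //; apply: filterS (loc a Aa) => b /[apply] -[h _]; exact: h.
  by move=> /nbhs_singleton/(_ Aa).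
- exists (~` interior [set b | A b -> ~ P b]); first exact/open_closedC/open_interior.
  apply/seteqP; split => a [Aa]; first by move=> Pa; split => // /nbhs_singleton/(_ Aa).
  move=> h; split => //; apply: contrapT => nPa; apply: h.
  by apply: filterS (loc a Aa) => b /[apply] -[_ h] /h.
Qed.

End LocallyConstant.

Section ContinuousFamilies.
Variables (R : realType) (X : topologicalType) (x : X).
Notation K := (fun f : X -> R => {for x, continuous f}).
Let KA : funalg K := @continuous_falg R X x.

(** The columns of gs M would vanish, as 0^-1 = 0, but they are unit vectors. *)
Lemma gs_norm_neq0 m (M : 'M[R]_m) j : M \in unitmx ->
  Num.sqrt (\sum_k gs_pre M k j ^+ 2) != 0.
Proof.
move=> uM; apply/eqP => s0; have /matrixP/(_ j j) := gs_orth uM.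
rewrite !mxE eqxx big1 => [/eqP|k _]; first by rewrite eq_sym oner_eq0.
by rewrite !mxE s0 invr0 mulr0 mul0r.
Qed.

Lemma inv_cont (f : X -> R) : K f -> f x != 0 -> K (fun y => (f y)^-1).
Proof. by move=> cf f0; apply: continuousV. Qed.

Lemma sqrt_cont (f : X -> R) : K f -> K (fun y => Num.sqrt (f y)).
Proof. by move=> cf; apply: (@continuous_comp _ _ _ f Num.sqrt) => //; exact: sqrt_continuous. Qed.

Lemma gs_cont m (F : X -> 'M[R]_m) : mxK K F -> F x \in unitmx -> mxK K (fun y => gs (F y)).
Proof.
move=> cF uF.
have cL i : K (fun y => (lead i ((F y)^T *m F y))^-1).
  apply: inv_cont; last by rewrite gt_eqF// lead_gram_gt0.
  by apply: (falg_minor KA); apply: (mxKM KA) => //; exact: mxK_tr.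
apply: (mxK_gs KA) => // j; apply: inv_cont; last exact: gs_norm_neq0.
apply: sqrt_cont; apply: (falg_sum KA) => k _; apply: (falgX KA).
exact: (mxK_gs_pre KA).
Qed.

End ContinuousFamilies.

Section SpinFamilies.
Variables (R : realType) (m : nat) (X : Type) (K : (X -> R) -> Prop).
Hypothesis KA : funalg K.
Notation Cl := (Clifford R m).
Notation gamma := (@gamma R m).

Lemma falg_tr p (F : X -> 'M[R]_p) : mxK K F -> K (fun x => \tr (F x)).
Proof. by move=> KF; apply: (falg_sum KA) => i _; exact: KF. Qed.

Lemma mxK_mul (F G : X -> Cl) : mxK K F -> mxK K G -> mxK K (fun x => F x * G x).
Proof. exact: (mxKM KA). Qed.

Lemma mxK_intertwiner (F : X -> 'M[R]_m) : mxK K F -> mxK K (fun x => intertwiner (F x)).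
Proof.
move=> KF; rewrite /intertwiner; elim: (enum 'I_m) => [|i s IH] /=; first exact: (mxK_cst KA).
have Krot : mxK K (fun x => rotvec (F x) i : Cl).
  rewrite /rotvec; apply: (mxK_sum KA) => k; apply: (mxKZ KA); last exact: (mxK_cst KA).
  by under eq_fun do rewrite mxE; exact: KF.
apply: (mxKD KA) => //; rewrite /twist => a b.
under eq_fun do rewrite mxE; apply: (falgN KA).
by apply: mxK_mul; [exact: mxK_mul|exact: (mxK_cst KA)].
Qed.

(** The covering map as a polynomial, which makes its continuity, absolute
    continuity and differentiability evident; it differs from Pi outside Spin. *)
Definition poly_Pi (z : Cl) : 'M[R]_m :=
  \matrix_(i, j) (- \tr (gamma i * (z * gamma j * z^T)) / #|{set 'I_m}|%:R).

Lemma poly_PiE z : Spin z -> poly_Pi z = Pi z.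
Proof. by move=> hz; apply/matrixP => i j; rewrite mxE Pi_entry. Qed.

Lemma mxK_poly_Pi (F : X -> Cl) : mxK K F -> mxK K (fun x => poly_Pi (F x)).
Proof.
move=> KF i j; under eq_fun do rewrite mxE.
apply: (falgM KA); last exact: (falg_cst KA).
apply: (falgN KA); apply: falg_tr; apply: mxK_mul; first exact: (mxK_cst KA).
apply: mxK_mul; first by apply: mxK_mul => //; exact: (mxK_cst KA).
exact: mxK_tr.
Qed.

End SpinFamilies.

Section LocalSection.
Variables (R : realType) (n : nat).
Notation m := n.+1.
Notation Cl := (Clifford R m).
Implicit Types (h : 'M[R]_m) (u x y z : Cl).

(** Defined on matrices instead of rotations: the neighbourhoods of 1 in the
    space of matrices contain segments, and lifting these gives paths in Spin. *)
Definition lift_gs h : Cl := spin_sec (gs h).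

(** The positive trace selects the lift near 1 among the two lifts. *)
Definition liftable h : Prop := 0 < \det h /\ 0 < \tr (intertwiner (gs h)).

Lemma det_unit h : 0 < \det h -> h \in unitmx.
Proof. by move=> h0; rewrite unitmxE unitfE gt_eqF. Qed.

Lemma gs_SO h : 0 < \det h -> SO (gs h).
Proof.
by move=> h0; split; [exact/mulmx1C/gs_orth/det_unit|exact: det_gs (det_unit h0) h0].
Qed.

Lemma SpinN z : Spin z -> Spin (- z).
Proof.
move=> hz; rewrite -mulrN1 -(gamma_sqr R (ord0 : 'I_m)) -cl_vec_delta.
apply: SpinM => //; apply: Spin_vec2; rewrite /unitv (bigD1 ord0)//= mxE !eqxx expr1n big1 ?addr0//;
  by move=> i /negbTE ia; rewrite mxE ia andbF expr0n.
Qed.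

Lemma PiN z : Spin z -> Pi (- z) = Pi z.
Proof.
move=> hz; apply: isPi_Pi; first exact/Spin_unit/SpinN.
by move=> j; rewrite mulNr mulrN Pi_isPi.
Qed.

Lemma lift_gs_Spin h : liftable h -> Spin (lift_gs h) /\ Pi (lift_gs h) = gs h.
Proof.
move=> [d0 t0]; have [z hz zE] := Pi_surj (gs_SO d0).
have i0 : intertwiner (Pi z) != 0.
  by apply/eqP => e; move: t0; rewrite -zE e linear0 ltxx.
rewrite /lift_gs -zE; have [->|->] := spin_secP hz i0; first by [].
by split; [exact: SpinN|exact: PiN].
Qed.

Lemma lift_gs_tr h : liftable h -> 0 <= \tr (lift_gs h).
Proof.
move=> [_ t0]; rewrite /lift_gs /spin_sec linearZ /= mulr_ge0 ?(ltW t0)// invr_ge0 sqrtr_ge0.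
Qed.

Lemma lift_gsK u : Spin u -> 0 < \tr u -> liftable (Pi u) -> lift_gs (Pi u) = u.
Proof.
move=> hu u0 lu; have t1 := lift_gs_tr lu; case: lu => d0 t0; have [uu _] := Pi_SO hu.
move: t0 t1; rewrite /lift_gs gs_id ?det_unit//; last exact: mulmx1C.
move=> t0; have i0 : intertwiner (Pi u) != 0.
  by apply/eqP => e; move: t0; rewrite e linear0 ltxx.
have [->//|->] := spin_secP hu i0.
by rewrite linearN /= oppr_ge0 leNgt u0.
Qed.

Lemma lift_gs_cont (X : topologicalType) (F : X -> 'M[R]_m) (a : X) :
  mxK (fun f : X -> R => {for a, continuous f}) F -> liftable (F a) ->
  mxK (fun f : X -> R => {for a, continuous f}) (fun b => lift_gs (F b)).
Proof.
move=> cF la; have [d0 t0] := la; have KA := @continuous_falg R X a.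
have cG := gs_cont cF (det_unit d0); have cI := mxK_intertwiner KA cG.
apply: (mxKZ KA) => //; apply: inv_cont.
  apply: sqrt_cont; apply: (falgM KA); last exact: (falg_cst KA).
  apply: (falg_tr KA); apply: (mxK_mul KA) => //; exact: mxK_tr.
have [+ _] := lift_gs_Spin la; rewrite /lift_gs /spin_sec => /Spin_orth h.
apply/eqP => e; move: h; rewrite e invr0 scale0r mul0r => /(congr1 mxtrace).
by rewrite linear0 -idmxE mxtrace1 => /esym/eqP; rewrite (negbTE (natN_neq0 R m)).
Qed.

Lemma tr_scalar_gt0 (c : R) : 0 < c -> 0 < \tr (c%:M : Cl).
Proof. by move=> c0; rewrite mxtrace_scalar pmulrn_lgt0// card_set_gt0. Qed.

Lemma gs1 : gs (1%:M : 'M[R]_m) = 1%:M.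
Proof. by rewrite gs_id ?unitmx1// trmx1 mulmx1. Qed.

Lemma liftable1 : liftable (1%:M : 'M[R]_m).
Proof.
by split; rewrite ?det1 ?ltr01// gs1; have [c c0 ->] := intertwiner1 R m; exact: tr_scalar_gt0.
Qed.

Lemma lift_gs1 : lift_gs 1%:M = 1.
Proof.
rewrite -{1}(Pi1 R m); apply: lift_gsK; [exact: Spin1| |rewrite Pi1; exact: liftable1].
by rewrite -idmxE; apply: tr_scalar_gt0.
Qed.

Lemma liftable_near (X : topologicalType) (F : X -> 'M[R]_m) (a : X) :
  mxK (fun f : X -> R => {for a, continuous f}) F -> liftable (F a) ->
  \forall b \near a, liftable (F b).
Proof.
move=> cF [d0 t0]; have KA := @continuous_falg R X a.
have cd := falg_det KA cF.
have ct := falg_tr KA (mxK_intertwiner KA (gs_cont cF (det_unit d0))).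
by near=> b; split; near: b; [exact: (cvgr_gt _ cd)|exact: (cvgr_gt _ ct)].
Unshelve. all: by end_near. Qed.

End LocalSection.

Section Paths.
Variables (R : realType) (n : nat).
Notation m := n.+1.
Notation Cl := (Clifford R m).
Notation Pi := (@Pi R m).
Implicit Types (h P Q : 'M[R]_m) (u x y z : Cl) (S : set 'M[R]_m).
Notation cont t := (fun f : R -> R => {for t, continuous f}).

Lemma path_component (A : set Cl) (f : R -> Cl) a b :
  (forall t, a <= t <= b -> mxK (cont t) f) -> (forall t, a <= t <= b -> A (f t)) ->
  forall s t, a <= s <= b -> a <= t <= b -> connected_component A (f s) (f t).
Proof.
move=> cf Af s t hs ht; exists (f @` `[a, b]); last by exists t; rewrite //= in_itv.
split; first by exists s; rewrite //= in_itv.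
  by move=> _ [r /= hr <-]; apply: Af; rewrite in_itv in hr.
apply: connected_continuous_connected; first exact: segment_connected.
apply: continuous_in_subspaceT => r; rewrite inE /= in_itv => hr.
by apply: mx_continuous; exact: cf.
Qed.

Definition Spin_over S : set Cl := [set z | Spin z /\ S (Pi z)].

Lemma component_sub (X : topologicalType) (A B : set X) (p q : X) : A `<=` B ->
  connected_component A p q -> connected_component B p q.
Proof. by move=> AB [C [Cx CA cC] Cy]; exists C => //; split => //; exact: subset_trans CA AB. Qed.

(** For y near x, the segment from 1 to Pi (x^-1 y) is orthonormalized and
    lifted to a path from 1 to x^-1 y. *)
Lemma near_component S x : Spin x ->
  (\forall h \near (1%:M : 'M[R]_m), S (Pi x *m gs h)) ->
  \forall y \near x, Spin y -> connected_component (Spin_over S) x y.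
Proof.
move=> hx nS.
have n1 : \forall h \near (1%:M : 'M[R]_m), liftable h.
  apply: (@liftable_near _ _ _ id); last exact: liftable1.
  by move=> i j; exact: coord_continuous.
have [d /= d0 dP] := (nbhs_ballP _ _).1 (filterI n1 nS).
have cu : mxK (fun f : Cl -> R => {for x, continuous f}) (fun y => x^T * y).
  have KA := @continuous_falg R Cl x.
  by apply: (mxK_mul KA); [exact: (mxK_cst KA)|move=> i j; exact: coord_continuous].
have xx := orthC (Spin_orth hx).
have ct := falg_tr (@continuous_falg R Cl x) cu.
have cp := mx_continuous (mxK_poly_Pi (@continuous_falg R Cl x) cu).
near=> y => hy; pose u := x^T * y.
have hu : Spin u by apply: SpinM => //; exact: Spin_tr.
have xu : x * u = y by rewrite /u mulrA Spin_orth// mul1r.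
have tu : 0 < \tr u.
  by rewrite /u; near: y; apply: (cvgr_gt _ ct); rewrite xx -idmxE; exact: tr_scalar_gt0.
have bu : ball (1%:M : 'M[R]_m) d (Pi u).
  rewrite -poly_PiE// /u; near: y.
  apply: cp; rewrite xx poly_PiE; last exact: Spin1.
  by rewrite Pi1; exact: nbhsx_ballx.
pose h r : 'M[R]_m := (1 - r) *: 1%:M + r *: Pi u.
have bh r : 0 <= r <= 1 -> ball (1%:M : 'M[R]_m) d (h r).
  move=> /andP[r0 r1]; move: bu; rewrite -!ball_normE /ball_ /=; apply: le_lt_trans.
  have -> : 1%:M - h r = r *: (1%:M - Pi u).
    by rewrite /h scalerBl scale1r scalerBr; apply/matrixP => i j; rewrite !mxE; ring.
  by rewrite normrZ ger0_norm// ler_piMl.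
have ch t : mxK (cont t) h.
  have KA := @continuous_falg R R t.
  have cid_ : {for t, continuous (id : R -> R)} by exact: cvg_id.
  apply: (mxKD KA); apply: (mxKZ KA) => //; try exact: (mxK_cst KA).
  by apply: (falgD KA); [exact: (falg_cst KA)|exact: (falgN KA)].
have -> : y = x * lift_gs (h 1).
  by rewrite /h subrr scale0r add0r scale1r lift_gsK//; have [] := dP _ bu.
have {1}-> : x = x * lift_gs (h 0).
  by rewrite /h subr0 scale1r scale0r addr0 lift_gs1 mulr1.
apply: (path_component (a := 0) (b := 1) (f := fun r => x * lift_gs (h r))); rewrite ?lexx ?ler01//.
  move=> t ht; apply: (mxK_mul (@continuous_falg R R t)); first exact: (mxK_cst (@continuous_falg R R t)).
  by apply: lift_gs_cont => //; have [] := dP _ (bh t ht).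
move=> t ht; have [lt St] := dP _ (bh t ht); have [hl pl] := lift_gs_Spin lt.
by split; [exact: SpinM|rewrite PiM// pl].
Unshelve. all: by end_near. Qed.

(** The t reached by a lift form an open and closed subset of [0, 1], by means
    of the local section near each c t0. *)
Lemma path_lift S (c : R -> 'M[R]_m) y : Spin y -> Pi y = c 0 ->
  (forall t, 0 <= t <= 1 -> [/\ mxK (cont t) c, SO (c t) & S (c t)]) ->
  exists y', Pi y' = c 1 /\ connected_component (Spin_over S) y y'.
Proof.
move=> hy y0 hc.
pose P t := exists y', Pi y' = c t /\ connected_component (Spin_over S) y y'.
have P0 : P 0.
  exists y; split => //; apply: connected_component_refl; split => //.
  by rewrite y0; have [] := hc 0 _; rewrite ?lexx ?ler01.
have I0 : `[0, 1]%classic (0 : R) by rewrite /= in_itv /= lexx ler01.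
have I1 : `[0, 1]%classic (1 : R) by rewrite /= in_itv /= lexx ler01.
suff : P 1 by [].
apply: (locally_constant (P := P) (@segment_connected R 0 1) _ I0 I1 P0) => t0.
rewrite /= in_itv /= => ht0; have [ct0 [ctt dt0] _] := hc t0 ht0.
have ctt' := mulmx1C ctt.
pose F t := (c t0)^T *m c t.
have cF t : 0 <= t <= 1 -> mxK (cont t) F.
  move=> ht; have KA := @continuous_falg R R t; have [h _ _] := hc t ht.
  by apply: (mxKM KA) => //; exact: (mxK_cst KA).
have lF : \forall t \near t0, liftable (F t).
  by apply: liftable_near; [exact: cF|rewrite /F ctt'; exact: liftable1].
have [d /= d0 dP] := (nbhs_ballP _ _).1 lF.
have gF t : 0 <= t <= 1 -> gs (F t) = F t.
  move=> ht; have [_ [tt dt] _] := hc t ht; apply: gs_id.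
    by rewrite det_unit// /F det_mulmx det_tr dt0 dt mulr1.
  by rewrite /F trmx_mul trmxK mulmxA -(mulmxA _ (c t0)) ctt mulmx1; exact: mulmx1C.
have step z t : 0 <= t <= 1 -> ball t0 d t -> Spin z -> Pi z = c t0 ->
    connected_component (Spin_over S) z (z * lift_gs (F t)) /\ Pi (z * lift_gs (F t)) = c t.
  move=> ht bt hz zt0.
  have L r : 0 <= r <= 1 -> ball t0 d r -> Spin (z * lift_gs (F r)) /\ Pi (z * lift_gs (F r)) = c r.
    move=> hr br; have [h1 h2] := lift_gs_Spin (dP _ br).
    by split; [exact: SpinM|rewrite PiM// h2 gF// zt0 /F mulmxA ctt mul1mx].
  split; last by have [] := L t ht bt.
  have {1}-> : z = z * lift_gs (F t0) by rewrite /F ctt' lift_gs1 mulr1.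
  have br r : Num.min t0 t <= r <= Num.max t0 t -> 0 <= r <= 1 /\ ball t0 d r.
    move: bt; rewrite -!ball_normE /ball_ /= => bt.
    move: ht ht0 => /andP[a1 a2] /andP[a3 a4].
    rewrite ge_min le_max => /andP[/orP b1 /orP b2].
    move: bt; rewrite !ltr_norml => /andP[b3 b4].
    by split; apply/andP; case: b1 => b1; case: b2 => b2; split; lra.
  apply: (path_component (a := Num.min t0 t) (b := Num.max t0 t) (f := fun r => z * lift_gs (F r))).
  - move=> r /br[hr rb]; have KA := @continuous_falg R R r.
    apply: (mxK_mul KA); first exact: (mxK_cst KA).
    by apply: lift_gs_cont; [exact: cF|exact: dP].
  - by move=> r /br[hr rb]; have [h1 h2] := L r hr rb; split => //; rewrite h2; have [] := hc r hr.
  - by rewrite ge_min le_max !lexx.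
  - by rewrite ge_min le_max !lexx !orbT.
exists d => //= t bt; rewrite in_itv /= => ht; split => -[z [zt yz]].
  have [hz _] := connected_component_sub yz.
  have [h1 h2] := step z t ht bt hz zt.
  by exists (z * lift_gs (F t)); split => //; exact: connected_component_trans h1.
have [hz _] := connected_component_sub yz.
have [h1 h2] := lift_gs_Spin (dP _ bt); have hw' := Spin_tr h1.
pose z0 := z * (lift_gs (F t))^T.
have hz0 : Spin z0 by exact: SpinM.
have z0t : Pi z0 = c t0.
  rewrite PiM// Pi_tr// h2 gF// zt /F trmx_mul trmxK mulmxA.
  by have [_ [tt _] _] := hc t ht; rewrite tt mul1mx.
have [h3 _] := step z0 t ht bt hz0 z0t.
exists z0; split => //; apply: connected_component_trans yz _.
apply: connected_component_sym; move: h3.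
by rewrite {2}/z0 -mulrA orthC ?mulr1//; exact: Spin_orth.
Qed.

End Paths.

(** * Signed Bruhat cells *)

Section Cells.
Variables (R : realType) (n : nat).
Notation m := n.+1.
Notation Cl := (Clifford R m).
Notation Pi := (@Pi R m).
Implicit Types (h P Q M : 'M[R]_m) (u x y z : Cl) (S : set 'M[R]_m) (e : 'I_m -> R).
Notation cont t := (fun f : R -> R => {for t, continuous f}).

Lemma Bru_component z0 z :
  Bru z0 z <-> connected_component (Spin_over (Up_coset (Pi z0))) z0 z.
Proof.
split; apply: component_sub => y [hy].
  by move=> [_ [U [V [hU hV yE]]]]; split => //; exists U, V.
by move=> [U [V [hU hV yE]]]; split => //; split; [exact: Pi_SO|exists U, V].
Qed.

Definition signed e : set 'M[R]_m := [set Q | forall i, 0 < sw i Q * e i].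

Lemma signed_eq e a Q : signed e Q -> signed a Q -> signed e = signed a.
Proof.
have H (b c d x : R) : 0 < x * b -> 0 < x * c -> 0 < d * b -> 0 < d * c.
  move=> h1 h2 h3; have := mulr_gt0 (mulr_gt0 h1 h2) h3.
  have -> : ((x * b) * (x * c)) * (d * b) = (x * b) ^+ 2 * (d * c) by ring.
  by rewrite pmulr_rgt0// exprn_gt0.
by move=> he ha; apply/seteqP; split => M hM i; apply: H (hM i); [exact: he|exact: ha|exact: ha|exact: he].
Qed.

(** A sign pattern is a whole open double coset. *)
Lemma signed_dc P e : signed e P -> signed e = Up_coset P.
Proof.
move=> eP; apply/seteqP; split => Q.
  move=> hQ; apply: same_sw_double_coset => i.
  have : 0 < (sw i Q * e i) * (sw i P * e i) by apply: mulr_gt0; [exact: hQ|exact: eP].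
  rewrite mulrACA -expr2 pmulr_lgt0// lt_neqAle sqr_ge0 andbT eq_sym sqrf_eq0.
  by apply/eqP => e0; have := eP i; rewrite e0 mulr0 ltxx.
move=> [U [V [hU hV ->]]] i; have [c c0 ->] := sw_posup i P hU hV.
by rewrite -mulrA mulr_gt0.
Qed.

Lemma signed_gs e Q M : M \in unitmx -> signed e (Q *m M) <-> signed e (Q *m gs M).
Proof.
move=> uM; have [U hU ME] := gs_posup uM.
have E i : exists2 c, 0 < c & sw i (Q *m M) = c * sw i (Q *m gs M).
  rewrite {1}ME mulmxA -{1}[Q *m gs M]mul1mx; apply: sw_posup => //; exact: posup1.
split => h i; have := h i; have [c c0 ->] := E i; rewrite -mulrA; first by rewrite pmulr_rgt0.
by move=> ?; rewrite mulr_gt0.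
Qed.

Lemma signed_near e Q : signed e Q -> \forall h \near (1%:M : 'M[R]_m), signed e (Q *m gs h).
Proof.
move=> eQ; apply: (@filter_forall _ _ (fun i (h : 'M[R]_m) => 0 < sw i (Q *m gs h) * e i) _ (nbhs_filter (1%:M : 'M[R]_m))) => i.
have KA := @continuous_falg R 'M[R]_m 1%:M.
have cg : mxK (fun f : 'M[R]_m -> R => {for 1%:M, continuous f}) (fun h => gs h).
  by apply: (@gs_cont _ _ _ _ id); [move=> a b; exact: coord_continuous|exact: unitmx1].
have c : {for (1%:M : 'M[R]_m), continuous (fun h => sw i (Q *m gs h) * e i)}.
  apply: (falgM KA); last exact: (falg_cst KA).
  by apply: (falg_minor KA); apply: (mxKM KA) => //; exact: (mxK_cst KA).
by apply: (cvgr_gt _ c); rewrite gs1 mulmx1.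
Qed.

(** In the Bruhat decomposition Pi z = U P V the triangular factors are moved
    to 1 along segments; the orthonormalized path from Pi z to P stays in the
    double coset, and lifts. *)
Lemma cell_exists z : Spin z -> exists z0, tBplus z0 /\ Bru z0 z.
Proof.
move=> hz; have [zz dz] := Pi_SO hz; have uz : Pi z \in unitmx by rewrite det_unit ?dz.
have [U [P [s [V [hU hV hP zE]]]]] := Bruhat_exists uz.
have PP : P *m P^T = 1%:M.
  apply/matrixP => i j; rewrite !mxE (bigD1 (s i))//= big1 ?addr0 => [|k /negbTE ks]; last first.
    by rewrite (smxE _ _ hP) ks mulr0 mul0r.
  rewrite mxE (smxE j _ hP) (inj_eq perm_inj); have [->|ij] := eqVneq i j; last by rewrite !mulr0.
  by rewrite mulr1 -expr2 (smx_sqr _ hP).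
have dP : 0 < \det P.
  have e : 0 < \det U * \det P * \det V by rewrite -!det_mulmx -zE dz ltr01.
  by move: e; rewrite (pmulr_lgt0 _ (det_posup hV)) (pmulr_rgt0 _ (det_posup hU)).
have gP : gs P = P by apply: gs_id; [exact: det_unit|exact: mulmx1C].
pose W t := (1 - t) *: U + t *: 1%:M : 'M[R]_m.
pose W' t := (1 - t) *: V + t *: 1%:M : 'M[R]_m.
pose c t := gs (W t *m P *m W' t).
have W1 : W 1 = 1%:M by rewrite /W subrr scale0r add0r scale1r.
have W'1 : W' 1 = 1%:M by rewrite /W' subrr scale0r add0r scale1r.
have c1 : c 1 = P by rewrite /c W1 W'1 mul1mx mulmx1.
have c0 : Pi z = c 0.
  rewrite /c /W /W' subr0 !scale1r !scale0r !addr0 -zE gs_id//; exact: mulmx1C.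
have hc t : 0 <= t <= 1 -> [/\ mxK (cont t) c, SO (c t) & Up_coset P (c t)].
  move=> ht; have pW : posup (W t) by apply: posup_convex => //; exact: posup1.
  have pW' : posup (W' t) by apply: posup_convex => //; exact: posup1.
  have d0 : 0 < \det (W t *m P *m W' t) by rewrite !det_mulmx !mulr_gt0// det_posup.
  split; last first.
  - have [X hX E] := gs_posup (det_unit d0).
    exists (W t), (W' t *m invmx X); split; first exact: pW.
      by apply: posupM; [exact: pW'|exact: posupV].
    rewrite mulmxA -[c t](mulmxK (posup_unit hX)); congr (_ *m _).
    by rewrite /c -E.
  - exact: gs_SO.
  have KA := @continuous_falg R R t.
  have cid_ : {for t, continuous (id : R -> R)} by exact: cvg_id.
  have c1t : {for t, continuous (fun s : R => 1 - s)}.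
    by apply: (falgD KA); [exact: (falg_cst KA)|exact: (falgN KA)].
  apply: gs_cont; last exact: det_unit.
  by apply: (mxKM KA); [apply: (mxKM KA); last exact: (mxK_cst KA)|];
    apply: (mxKD KA); apply: (mxKZ KA) => //; exact: (mxK_cst KA).
have [z0 [z0P zz0]] := path_lift hz c0 hc.
have [hz0 _] := connected_component_sub zz0; rewrite c1 in z0P.
exists z0; split; last by rewrite Bru_component z0P; exact: connected_component_sym.
split => //; rewrite /preimage /= z0P; split; first by exists s.
by rewrite -gP det_gs// det_unit.
Qed.

(** The probe: right multiplication by tau t acts on double cosets as right
    multiplication by lam t. *)
Definition tau t : Cl := lift_gs (lam n t).

Lemma tau_liftable : exists2 d : R, 0 < d & forall t, 0 <= t <= d -> liftable (lam n t).
Proof.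
have lF : \forall t \near (0 : R), liftable (lam n t).
  apply: liftable_near; last by rewrite lam0; exact: liftable1.
  by apply: (@lam_falg R n R _ id (@continuous_falg R R 0)); exact: cvg_id.
have [d /= d0 dP] := (nbhs_ballP _ _).1 lF; exists (d / 2); first by rewrite divr_gt0.
move=> t /andP[t0 td]; apply: dP; rewrite /= -ball_normE /ball_ /= sub0r normrN ger0_norm//.
by apply: le_lt_trans td _; rewrite ltr_pdivrMr// ltr_pMr// ltr1n.
Qed.

Lemma tau_cont t : liftable (lam n t) -> mxK (cont t) tau.
Proof.
by move=> lt; apply: lift_gs_cont => //; apply: (@lam_falg R n R _ id (@continuous_falg R R t)); exact: cvg_id.
Qed.

Lemma tau0 : tau 0 = 1. Proof. by rewrite /tau lam0 lift_gs1. Qed.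

Lemma lam_unit (t : R) : lam n t \in unitmx.
Proof. by rewrite det_unit// lower1_unit; [exact: ltr01|exact: lower1_lam]. Qed.

Lemma Spin_tau y t : Spin y -> liftable (lam n t) ->
  Spin (y * tau t) /\ Pi (y * tau t) = Pi y *m gs (lam n t).
Proof.
by move=> hy lt; have [h1 h2] := lift_gs_Spin lt; split; [exact: SpinM|rewrite PiM// h2].
Qed.

Lemma over_tau e y t : Spin y -> liftable (lam n t) -> signed e (Pi y *m lam n t) ->
  Spin_over (signed e) (y * tau t).
Proof.
move=> hy lt h; have [h1 h2] := Spin_tau hy lt; split => //.
by rewrite h2; have [f _] := signed_gs e (Pi y) (lam_unit t); exact: f.
Qed.

Lemma tau_path e y a b : Spin y ->
  (forall t, a <= t <= b -> liftable (lam n t) /\ signed e (Pi y *m lam n t)) ->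
  forall s t, a <= s <= b -> a <= t <= b ->
  connected_component (Spin_over (signed e)) (y * tau s) (y * tau t).
Proof.
move=> hy H; apply: (path_component (f := fun t => y * tau t)) => t /H[lt st]; last exact: over_tau.
have KA := @continuous_falg R R t.
by apply: (mxK_mul KA); [exact: (mxK_cst KA)|exact: tau_cont].
Qed.

Definition germ e y0 y : Prop := exists2 d : R, 0 < d &
  forall t, 0 < t <= d -> connected_component (Spin_over (signed e)) y0 (y * tau t).

(** Near y1 the probes y tau t lie in one sign pattern for all t <= t1, with t1
    independent of y; at t = t1 the points y1 tau t1 and y tau t1 are close
    together in an open set, hence in the same component. *)
Lemma germ_locally_constant e y0 P s y1 : smx P s -> Spin_over (Up_coset P) y1 ->
  \forall y \near y1, Spin_over (Up_coset P) y -> (germ e y0 y1 <-> germ e y0 y).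
Proof.
move=> hP [h1 d1]; have [a a0 [[Q B] /= [nQ nB] QB]] := probe_sign_all hP d1.
have [b /= b0 bP] := (nbhs_ballP _ _).1 nB.
have [c c0 cP] := tau_liftable.
pose t1 := Num.min c (b / 2).
have t10 : 0 < t1 by rewrite lt_min c0 divr_gt0.
have smallP t : 0 < t <= t1 -> liftable (lam n t) /\ B t.
  rewrite le_min => /andP[t0 /andP[tc tb]]; split; first by apply: cP; rewrite (ltW t0).
  apply: bP => //=; rewrite -ball_normE /ball_ /= sub0r normrN gtr0_norm//.
  by apply: le_lt_trans tb _; rewrite ltr_pdivrMr// ltr_pMr// ltr1n.
have signP y : Spin_over (Up_coset P) y -> Q (Pi y) -> forall t, 0 < t <= t1 ->
    liftable (lam n t) /\ signed a (Pi y *m lam n t).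
  by move=> [hy dy] Qy t ht; have [lt Bt] := smallP t ht; split => // i; exact: (QB (Pi y, t)).
have t1t1 : 0 < t1 <= t1 by rewrite t10 lexx.
have Q1 : Q (Pi y1) by exact: nbhs_singleton nQ.
have [l1 s1] := signP y1 (conj h1 d1) Q1 t1 t1t1.
have [ht1 Pt1] := Spin_tau h1 l1.
have [_ o1] := over_tau h1 l1 s1.
have nc := near_component ht1 (signed_near o1).
(* the germs are compared at the common parameter t1 *)
have transfer y y' : Spin_over (Up_coset P) y -> Q (Pi y) ->
    Spin_over (Up_coset P) y' -> Q (Pi y') ->
    connected_component (Spin_over (signed a)) (y * tau t1) (y' * tau t1) ->
    germ e y0 y -> germ e y0 y'.
  move=> oy Qy oy' Qy' yy' [d d0 dP].
  have path x : Spin_over (Up_coset P) x -> Q (Pi x) -> forall t, 0 < t <= t1 ->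
      connected_component (Spin_over (signed a)) (x * tau t) (x * tau t1).
    move=> ox Qx t ht; have /andP[t0 tt] := ht.
    have H r : t <= r <= t1 -> liftable (lam n r) /\ signed a (Pi x *m lam n r).
      by move=> /andP[tr rt]; apply: (signP x ox Qx); rewrite (lt_le_trans t0 tr) rt.
    have e1 : t <= t <= t1 by rewrite lexx tt.
    have e2 : t <= t1 <= t1 by rewrite lexx tt.
    exact: (tau_path ox.1 H e1 e2).
  have [td tt] : 0 < Num.min d t1 <= d /\ 0 < Num.min d t1 <= t1.
    by split; rewrite lt_min d0 t10 ge_min lexx ?orbT.
  have c1 := dP _ td.
  have [_ sg1] := connected_component_sub c1.
  have [_ sg2] := connected_component_sub (connected_component_sym (path y oy Qy _ tt)).
  have EA : Spin_over (signed a) `<=` Spin_over (signed e).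
    by move=> w [hw sw]; split => //; rewrite (signed_eq sg1 sg2).
  exists t1; first exact: t10.
  move=> t ht.
  have c2 := component_sub EA (path y oy Qy _ tt).
  have c3 := component_sub EA yy'.
  have c4 := connected_component_sym (component_sub EA (path y' oy' Qy' _ ht)).
  exact: (connected_component_trans c1 (connected_component_trans c2 (connected_component_trans c3 c4))).
have KA := @continuous_falg R Cl y1.
have cid_ : mxK (fun f : Cl -> R => {for y1, continuous f}) (fun y => y).
  by move=> i j; exact: coord_continuous.
have ct := mx_continuous (mxK_mul KA cid_ (mxK_cst KA (tau t1))).
have cp := mx_continuous (mxK_poly_Pi KA cid_).
have nearQ : \forall y \near y1, Q (poly_Pi y) by apply: cp; rewrite poly_PiE.
have nearc := ct _ nc.
near=> y => oy; have [hy dy] := oy.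
have Qy : Q (Pi y) by rewrite -poly_PiE//; near: y.
have [ly sy] := signP y oy Qy t1 t1t1.
have cc : connected_component (Spin_over (signed a)) (y1 * tau t1) (y * tau t1).
  have [hyt _] := Spin_tau hy ly; move: hyt; near: y; exact: nearc.
split; first exact: transfer.
by apply: transfer => //; exact: connected_component_sym.
Unshelve. all: by end_near. Qed.

(** A cell is connected, and the germ is locally constant on it. *)
Lemma germ_Bru e y0 z0 z s : smx (Pi z0) s -> Spin z0 -> Bru z0 z ->
  germ e y0 z0 -> germ e y0 z.
Proof.
move=> hs hz0 /Bru_component zz0.
have zc : Spin_over (Up_coset (Pi z0)) z0.
  by split => //; exists 1%:M, 1%:M; rewrite mul1mx mulmx1; split => //; exact: posup1.
apply: (locally_constant (P := germ e y0) (component_connected (A := Spin_over (Up_coset (Pi z0))) (x := z0)) _ _ zz0).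
  move=> y1 /connected_component_sub hy1; have := germ_locally_constant e y0 hs hy1.
  by apply: filterS => y h /connected_component_sub; exact: h.
exact: connected_component_refl.
Qed.

End Cells.

Section AscendingPaths.
Variables (R : realType) (n : nat).
Notation m := n.+1.
Notation Cl := (Clifford R m).
Notation Pi := (@Pi R m).
Implicit Types (P Q D L : 'M[R]_m) (x y z q : Cl) (s r : 'S_m) (w : seq 'I_n).
Notation cont t := (fun f : R -> R => {for t, continuous f}).

Lemma acute_gen_Spin (j : 'I_n) : Spin (acute_gen R j).
Proof. by rewrite acute_genE; exact/spin_planar_Spin/lo_neq_hi. Qed.

Lemma Pi_acute_gen (j : 'I_n) : Pi (acute_gen R j) = rotmx j (pi / 2).
Proof. by rewrite acute_genE Pi_planar ?lo_neq_hi. Qed.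

Lemma spin_planar_cont (a b : 'I_m) (t : R) : mxK (cont t) (fun th : R => spin_planar a b th).
Proof.
have KA := @continuous_falg R R t.
have h2 : {for t, continuous (fun x : R => x / 2)}.
  by apply: (falgM KA); [exact: cvg_id|exact: (falg_cst KA)].
have cc : {for t, continuous (fun x : R => cos (x / 2))}.
  by apply: (@continuous_comp _ _ _ (fun x : R => x / 2) cos) => //; exact: continuous_cos.
have cs : {for t, continuous (fun x : R => sin (x / 2))}.
  by apply: (@continuous_comp _ _ _ (fun x : R => x / 2) sin) => //; exact: continuous_sin.
have -> : (fun th : R => spin_planar a b th) = (fun th => cos (th / 2) *: (1%:M : Cl) +
    (sin (th / 2) *: (gamma R a * gamma R b) : Cl)).
  by apply/funext => th; rewrite scalemx1.
by apply: (mxKD KA); apply: (mxKZ KA) => //; exact: (mxK_cst KA).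
Qed.

Variable D : 'M[R]_m.
Hypothesis diagD : is_diag_mx D.
Hypothesis unitD : forall i, D i i != 0.

Definition diag_sign (i : 'I_m) : R := \prod_(a < i.+1) D (bot a) (bot a).

Let D_upper : upper D.
Proof. by move=> i j ji; apply: (is_diag_mxP diagD); rewrite gtn_eqF. Qed.

Lemma diag_sign_neq0 i : diag_sign i != 0.
Proof. by apply/prodf_neq0 => a _. Qed.

Lemma sw_diag i Q : sw i (D *m Q) = diag_sign i * sw i Q.
Proof.
rewrite -{1}[D *m Q]mulmx1 (sw_upper _ _ D_upper (@upper1 _ _)) [X in _ * X]big1 ?mulr1// => a _.
by rewrite mxE eqxx.
Qed.

(** The signs of D enter each southwest minor as a common factor. *)
Lemma signed_diag Q : (forall i, 0 < sw i Q) -> signed diag_sign (D *m Q).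
Proof.
move=> h i; rewrite sw_diag mulrAC -expr2 mulr_gt0//.
by rewrite lt_neqAle sqr_ge0 andbT eq_sym sqrf_eq0 diag_sign_neq0.
Qed.

Lemma smx_unit Q s : smx Q s -> Q \in unitmx.
Proof.
move=> hQ; suff QQ : Q *m Q^T = 1%:M by have [] := mulmx1_unit QQ.
apply/matrixP => i j; rewrite !mxE (bigD1 (s i))//= big1 ?addr0 => [|k /negbTE ks]; last first.
  by rewrite (smxE _ _ hQ) ks mulr0 mul0r.
rewrite mxE (smxE j _ hQ) (inj_eq perm_inj); have [->|ij] := eqVneq i j; last by rewrite !mulr0.
by rewrite mulr1 -expr2 (smx_sqr _ hQ).
Qed.

Lemma signed_bottom Q s t : smx Q s -> bottom_nonneg Q -> 0 < t ->
  signed diag_sign (D *m Q *m lam n t).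
Proof.
move=> hQ nQ t0; rewrite -mulmxA; apply: signed_diag => i.
by apply: bottom_nonneg_sw => //; [exact: smx_unit hQ|exact: tpos_lam].
Qed.

(** Rotating through the letters of an ascending word keeps the bottom minors
    nonnegative, so that the probe stays in one open cell. *)
Lemma word_path w s y Q : Spin y -> Pi y = D *m Q -> smx Q s -> bottom_nonneg Q ->
  ascending s w -> exists Q',
  [/\ Spin (y * \prod_(j <- w) acute_gen R j),
      Pi (y * \prod_(j <- w) acute_gen R j) = D *m Q',
      smx Q' (s * \prod_(j <- w) gen j)%g, bottom_nonneg Q' &
      forall t, 0 < t -> liftable (lam n t) ->
        connected_component (Spin_over (signed diag_sign)) (y * tau n t)
          (y * \prod_(j <- w) acute_gen R j * tau n t)].
Proof.
elim: w s y Q => [|j w IH] s y Q hy yQ hQ nQ.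
  move=> _; exists Q; rewrite !big_nil mulr1 mulg1; split => // t t0 lt.
  apply: connected_component_refl; apply: over_tau => //; rewrite yQ.
  exact: signed_bottom hQ nQ t0.
move=> /= /andP[asc ascw].
have rotP t : 0 <= t <= pi / 2 -> bottom_nonneg (Q *m rotmx j t).
  by move=> ht; exact: bottom_nonneg_rot hQ asc ht nQ.
have p2 : 0 <= (pi : R) / 2 by rewrite divr_ge0 ?pi_ge0.
have hyj : Spin (y * acute_gen R j) by apply: SpinM => //; exact: acute_gen_Spin.
have yjQ : Pi (y * acute_gen R j) = D *m (Q *m rotmx j (pi / 2)).
  by rewrite PiM// ?Pi_acute_gen ?yQ ?mulmxA//; exact: acute_gen_Spin.
have hQj := smxM hQ (smx_rot R j).
have nQj : bottom_nonneg (Q *m rotmx j (pi / 2)) by apply: rotP; rewrite p2 lexx.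
have [Q' [h1 h2 h3 h4 h5]] := IH _ _ _ hyj yjQ hQj nQj ascw.
exists Q'; rewrite !big_cons !mulrA mulgA; split => // t t0 lt.
apply: connected_component_trans (h5 t t0 lt).
pose f th := y * spin_planar (lo j) (hi j) th * tau n t.
have -> : y * tau n t = f 0 by rewrite /f spin_planar0 mulr1.
rewrite acute_genE -/(f (pi / 2)).
have e1 : (0 : R) <= (0 : R) <= (pi : R) / 2 by apply/andP; split => //; exact: lexx.
have e2 : (0 : R) <= (pi : R) / 2 <= (pi : R) / 2 by apply/andP; split => //; exact: lexx.
apply: (path_component _ _ e1 e2) => th hth.
  have KA := @continuous_falg R R th.
  apply: (mxK_mul KA); last exact: (mxK_cst KA).
  by apply: (mxK_mul KA); [exact: (mxK_cst KA)|exact: spin_planar_cont].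
have hp := spin_planar_Spin th (lo_neq_hi j).
apply: over_tau => //; first exact: SpinM.
rewrite PiM// Pi_planar ?lo_neq_hi// yQ -!mulmxA; apply: signed_diag => i.
rewrite mulmxA; apply: bottom_nonneg_sw; [exact: rotP| |exact: tpos_lam].
rewrite unitmx_mul (smx_unit hQ) /=; have [rr _] := SO_rot j th.
by have [] := mulmx1_unit rr.
Qed.

(** The southwest blocks of a signed permutation matrix of eta are themselves
    signed permutation matrices. *)
Lemma sw_eta_neq0 Q i : smx Q (eta n) -> sw i Q != 0.
Proof.
move=> hQ; pose p := perm (@rev_ord_inj i.+1).
have -> : sw i Q = \det (diag_mx (\row_a Q (@bot m i a) (eta n (bot a))) *m perm_mx p).
  congr (\det _); apply/matrixP => a b; rewrite mul_diag_mx !mxE (smxE (bot a) (top b) hQ).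
  suff -> : (top b == eta n (bot a)) = (p a == b) by [].
  by rewrite /eta /p !permE /bot rev_ordK -!val_eqE /= eq_sym.
rewrite det_mulmx det_perm mulf_neq0 ?signr_eq0// det_diag; apply/prodf_neq0 => a _.
rewrite mxE; apply/eqP => e; have := smx_sqr (bot a) hQ.
by rewrite e expr0n => /eqP; rewrite eq_sym oner_eq0.
Qed.

(** Both z0 and y0 are reached from q by ascending words; at y0 itself the
    probe can be removed, as y0 lies in an open cell. *)
Lemma germ_word w w' q : Spin q -> Pi q = D ->
  ascending 1%g w -> ascending 1%g w' -> (\prod_(j <- w') gen j)%g = eta n ->
  let y0 := q * \prod_(j <- w') acute_gen R j in
  Spin y0 /\ signed diag_sign (Pi y0) /\
  exists2 Q, [/\ Pi (q * \prod_(j <- w) acute_gen R j) = D *m Q, Q \in unitmx & bottom_nonneg Q] &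
  germ diag_sign y0 (q * \prod_(j <- w) acute_gen R j).
Proof.
move=> hq qD aw aw' we y0.
have qD1 : Pi q = D *m 1%:M by rewrite mulmx1.
have [Q [h1 h2 h3 h4 h5]] := word_path hq qD1 (@smx1 R m) (@bottom_nonneg1 R n) aw.
have [Q' [h1' h2' h3' h4' h5']] := word_path hq qD1 (@smx1 R m) (@bottom_nonneg1 R n) aw'.
rewrite mul1g we in h3'.
have sgQ' i : 0 < sw i Q' by rewrite lt_neqAle eq_sym sw_eta_neq0//= h4'//; exact: top_sinc.
have s0 : signed diag_sign (Pi y0) by rewrite h2'; exact: signed_diag.
split; first exact: h1'.
split; first exact: s0.
exists Q; first by split => //; exact: smx_unit h3.
have [d d0 dP] := tau_liftable R n; exists d => // t /andP[t0 td].
have lt : liftable (lam n t) by apply: dP; rewrite (ltW t0).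
have H (r : R) : 0 <= r <= t -> liftable (lam n r) /\ signed diag_sign (Pi y0 *m lam n r).
  move=> /andP[r0 rt]; split; first by apply: dP; rewrite r0 (le_trans rt).
  have [->|rn] := eqVneq r 0; first by rewrite lam0 mulmx1.
  rewrite h2'; apply: signed_bottom h3' h4' _.
  by rewrite lt_neqAle eq_sym rn.
have e1 : (0 : R) <= (0 : R) <= t by rewrite lexx ltW.
have e2 : 0 <= t <= t by rewrite lexx ltW.
have := tau_path h1' H e1 e2; rewrite tau0 mulr1 => c1.
have c2 := connected_component_sym (h5' t t0 lt).
exact: (connected_component_trans c1 (connected_component_trans c2 (h5 t t0 lt))).
Qed.

End AscendingPaths.

(** * Locally convex curves *)

Section ConvexCurve.
Variables (R : realType) (n : nat).
Notation m := n.+1.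
Notation Cl := (Clifford R m).
Notation Pi := (@Pi R m).
Notation gamma := (@gamma R m).
Notation cont t := (fun f : R -> R => {for t, continuous f}).

Lemma mx_entry_norm p q (M : 'M[R]_(p, q)) i j : `|M i j| <= `|M|.
Proof.
rewrite [leRHS]/Num.Def.normr /= mx_normrE.
exact: (le_bigmax _ (fun ij : 'I_p * 'I_q => `|M ij.1 ij.2|) (i, j)).
Qed.

(** The rows of an orthogonal matrix are unit vectors. *)
Lemma Spin_entry_le1 (z : Cl) i j : Spin z -> `|z i j| <= 1.
Proof.
move=> /Spin_orth/matrixP/(_ i i); rewrite -mulmxE -idmxE !mxE eqxx => e.
rewrite -ler_sqr ?nnegrE// expr1n real_normK ?num_real// -[1]e (bigD1 j)//= mxE expr2 lerDl.
by apply: sumr_ge0 => k _; rewrite mxE -expr2 sqr_ge0.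
Qed.

Lemma curve_bounded_AC a b (Gam : R -> Cl) : (forall t, a < t < b -> Spin (Gam t)) ->
  abs_continuous a b Gam -> mxK (bounded_AC a b) Gam.
Proof.
move=> hS hA i j; split; last by exists 1 => t /hS h; exact: Spin_entry_le1.
move=> e /hA[d d0 H]; exists d => // N l r lr tr sd.
apply: le_lt_trans (H N l r lr tr sd); apply: ler_sum => k _.
by apply: le_trans (mx_entry_norm _ i j); rewrite !mxE.
Qed.

(** The definition for a single interval. *)
Lemma bounded_AC_continuous a b (f : R -> R) t : bounded_AC a b f -> a < t < b ->
  {for t, continuous f}.
Proof.
move=> [Af _] /andP[at_ tb]; apply/cvgrPdist_lt => e e0; have [d d0 H] := Af _ e0.
near=> s.
have sab : a < s < b by apply/andP; split; near: s; [exact: lt_nbhsr|exact: lt_nbhsl].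
have sd : `|t - s| < d.
  by near: s; apply/nbhs_ballP; exists d => // s; rewrite -ball_normE.
have trivI (A : 'I_1 -> set R) : trivIset setT A.
  by move=> i j _ _ _; rewrite !ord1.
have /andP[as_ sb] := sab.
have := H 1%N (fun=> Num.min t s) (fun=> Num.max t s).
rewrite !big_ord1; have [ts|st] := leP t s => h.
  rewrite distrC; apply: h => //; move: sd; rewrite ler0_norm ?subr_le0// opprB; exact.
by apply: h => //; [move=> _; split => //; exact: ltW|move: sd; rewrite gtr0_norm ?subr_gt0].
Unshelve. all: by end_near. Qed.

Lemma mxder_tr p q t (F : R -> 'M[R]_(p, q)) dF : mxder t F dF -> mxder t (fun x => (F x)^T) dF^T.
Proof. by move=> h i j; rewrite mxE; apply: der_ext (h j i) => x; rewrite mxE. Qed.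

Lemma der_tr p t (F : R -> 'M[R]_p) dF : mxder t F dF -> der t (fun x => \tr (F x)) (\tr dF).
Proof. by move=> h; apply: der_sum => i; exact: h. Qed.

(** Differentiating z |-> z gamma_j z^T along z' = z x turns right
    multiplication by x in the spin group into right multiplication by the
    matrix of ad x. *)
Lemma mxder_poly_Pi t (Gam : R -> Cl) (x : Cl) (S : 'M[R]_m) :
  mxder t Gam (Gam t * x) -> x^T = - x ->
  (forall j, x * gamma j - gamma j * x = \sum_i S i j *: gamma i) ->
  mxder t (fun u => poly_Pi (Gam u)) (poly_Pi (Gam t) *m S).
Proof.
move=> dG xT ad i j.
have d1 := mxderM (mxder_cst t (gamma i)) (mxderM (mxderM dG (mxder_cst t (gamma j))) (mxder_tr dG)).
rewrite mul0mx add0r mulmx0 addr0 in d1.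
have := derM (derM (der_cst t (-1)) (der_tr d1)) (der_cst t (#|{set 'I_m}|%:R^-1)).
rewrite mul0r add0r mulr0 addr0 => d2.
have -> : (poly_Pi (Gam t) *m S) i j = -1 * \tr (gamma i *m (Gam t * x *m gamma j *m (Gam t)^T +
    Gam t *m gamma j *m (Gam t * x)^T)) * #|{set 'I_m}|%:R^-1.
  have -> : Gam t * x *m gamma j *m (Gam t)^T + Gam t *m gamma j *m (Gam t * x)^T =
      \sum_k S k j *: (Gam t * gamma k * (Gam t)^T).
    rewrite trM xT !mulmxE mulNr !mulrN.
    transitivity (Gam t * (x * gamma j - gamma j * x) * (Gam t)^T).
      by rewrite mulrBr mulrBl !mulrA.
    rewrite ad mulr_sumr mulr_suml; apply: eq_bigr => k _.
    by rewrite clAr clAl.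
  rewrite mulmx_sumr linear_sum /= mxE mulr_sumr mulr_suml; apply: eq_bigr => k _.
  by rewrite mxE -scalemxAr linearZ /= mulmxE; ring.
apply: der_ext d2 => u; rewrite mxE mulN1r.
by rewrite !mulmxE.
Qed.

Variables (eps : R) (Gam : R -> Cl).
Hypothesis eps0 : 0 < eps.
Hypothesis hGam : locally_convex_curve (- eps) eps Gam.

Let GS t : - eps < t < eps -> Spin (Gam t). Proof. by have [h _ _] := hGam; exact: h. Qed.

Lemma curve_AC : mxK (bounded_AC (- eps) eps) Gam.
Proof. by apply: curve_bounded_AC; [exact: GS|have [] := hGam]. Qed.

Lemma curve_cont t : - eps < t < eps -> mxK (cont t) Gam.
Proof. by move=> ht i j; exact: bounded_AC_continuous (curve_AC i j) ht. Qed.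

(** The velocity of the image curve in SO is the combination of the so_basis j
    with the same positive coefficients. *)
Lemma curve_der_Pi t : - eps < t < eps -> derivable Gam t 1 -> exists S : 'M[R]_m,
  [/\ mxder t (fun u => poly_Pi (Gam u)) (poly_Pi (Gam t) *m S),
      forall i j : 'I_m, (j.+1 < i)%N -> S i j = 0 &
      forall i j : 'I_m, i = j.+1 :> nat -> 0 < S i j].
Proof.
move=> ht dG; have [_ _ /(_ t ht dG)[kap kap0 E]] := hGam.
set x := \sum_j _ in E; have hS := GS ht.
pose S := \sum_j kap j *: so_basis R j.
have SE (i j : 'I_m) : (j < i)%N -> S i j = \sum_k kap k * ((i == hi k) && (j == lo k))%:R.
  move=> ji; rewrite summxE; apply: eq_bigr => k _; rewrite !mxE -/(lo k) -/(hi k).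
  have [/andP[/eqP ei /eqP ej]|_] := boolP ((i == lo k) && (j == hi k)); last by rewrite subr0.
  by move: ji; rewrite ei ej hiE ltnNge leqnSn.
exists S; split.
- apply: (@mxder_poly_Pi _ _ x).
  + have -> : Gam t * x = derive1 Gam t by rewrite -E -mulmxE mulKVmx// Spin_unit.
    move=> i j; have /derivable_mxP/(_ i j) dij := dG.
    rewrite derive1E derive_mx// mxE; exact: derivableP.
  + rewrite /x linear_sum -sumrN; apply: eq_bigr => k _.
    rewrite linearZ /= spin_lie_so_basis linearZ /= trM !gamma_tr mulrNN.
    by rewrite (gamma_anti R (_ : hi k != lo k)) ?scalerN// eq_sym lo_neq_hi.
  + move=> j; rewrite /x mulr_suml mulr_sumr -sumrB.
    transitivity (\sum_k kap k *: \sum_i so_basis R k i j *: gamma i).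
      apply: eq_bigr => k _; rewrite clAl clAr -scalerBr -spin_lieP//.
      by rewrite /so_basis linearB /= !trmx_delta opprB.
    rewrite /S; under eq_bigr => k _ do rewrite scaler_sumr.
    rewrite exchange_big; apply: eq_bigr => i _ /=.
    by rewrite summxE scaler_suml; apply: eq_bigr => k _; rewrite scalerA [in RHS]mxE.
- move=> i j ij; rewrite SE ?(ltn_trans _ ij)// big1// => k _.
  have [/andP[/eqP ei /eqP ej]|_] := boolP (_ && _); last by rewrite mulr0.
  by move: ij; rewrite ei ej hiE ltnn.
- move=> i j ij; rewrite SE ?ij//.
  have jn : (j < n)%N by rewrite -ltnS -ij.
  have ej : j == lo (Ordinal jn) by apply/eqP/val_inj.
  have ei : i == hi (Ordinal jn) by apply/eqP/val_inj; rewrite /= ij.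
  rewrite (bigD1 (Ordinal jn))//= ei ej mulr1 ltr_wpDr// sumr_ge0// => k _.
  by rewrite mulr_ge0 ?ler0n// ltW.
Qed.

End ConvexCurve.

Section CurveGerm.
Variables (R : realType) (n : nat).
Notation m := n.+1.
Notation Cl := (Clifford R m).
Notation Pi := (@Pi R m).
Notation cont t := (fun f : R -> R => {for t, continuous f}).

(** A bound by the sum of the inverses avoids the choice of a minimum. *)
Lemma uniform_lower_bound (a : 'I_m -> R) : (forall i, 0 < a i) ->
  exists2 c, 0 < c & forall i, c < a i.
Proof.
move=> a0; have s0 : 0 <= \sum_i (a i)^-1 by apply: sumr_ge0 => i _; rewrite invr_ge0 ltW.
have p0 : 0 < 1 + \sum_i (a i)^-1 by rewrite ltr_pwDl.
exists (1 + \sum_i (a i)^-1)^-1; first by rewrite invr_gt0.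
move=> i; rewrite -[ltRHS]invrK ltf_pV2 ?posrE ?invr_gt0//.
rewrite (bigD1 i)//= addrCA ltrDl ltr_pwDl// sumr_ge0// => k _.
by rewrite invr_ge0 ltW.
Qed.

Lemma lead_posup (V : 'M[R]_m) i : posup V -> 0 < lead i V.
Proof.
move=> hV; rewrite /lead /minor (det_mxsub_upper (@top_sinc m i) hV.1).
by apply: prodr_gt0 => a _; exact: hV.2.
Qed.

Lemma lowf_posup (V : 'M[R]_m) : posup V -> lowf V = 1%:M.
Proof.
move=> hV; rewrite -{1}[V]mul1mx lowf_LU//; first by move=> i j _; rewrite mxE.
  exact: hV.1.
by move=> i; exact: posup_neq0.
Qed.

Variables (eps : R) (Gam : R -> Cl).
Hypothesis eps0 : 0 < eps.
Hypothesis hGam : locally_convex_curve (- eps) eps Gam.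
Variables (y0 : Cl) (D Q U V : 'M[R]_m).
Hypothesis diagD : is_diag_mx D.
Hypothesis unitD : forall i, D i i != 0.
Hypothesis unitQ : Q \in unitmx.
Hypothesis nnQ : bottom_nonneg Q.
Hypothesis hU : posup U.
Hypothesis hV : posup V.
Hypothesis zE : Pi (Gam 0) = U *m (D *m Q) *m V.
Let e := diag_sign D.
Hypothesis gz : germ e y0 (Gam 0).

Let GS t : - eps < t < eps -> Spin (Gam t). Proof. by have [h _ _] := hGam; exact: h. Qed.
Let in0 : - eps < 0 < eps. Proof. by rewrite oppr_lt0 eps0. Qed.

Let M t := V *m (Pi (Gam 0))^T *m poly_Pi (Gam t).

Let M0 : M 0 = V.
Proof.
rewrite /M (poly_PiE (GS in0)) -mulmxA.
by have [zz _] := Pi_SO (GS in0); rewrite (mulmx1C zz) mulmx1.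
Qed.

Let near_lead : exists2 c, 0 < c & exists2 d, 0 < d &
  forall t s, `|t| < d -> `|s| < d -> forall i, c <= lead i (M t *m lam n s).
Proof.
have [c c0 cP] := uniform_lower_bound (fun i => lead_posup i hV).
exists c => //; pose F (p : R * R) := M p.1 *m lam n p.2.
have KA := @continuous_falg R (R * R)%type (0, 0).
have cG : mxK (fun f : R * R -> R => {for (0, 0), continuous f}) (fun p => Gam p.1).
  move=> i j; apply: (@continuous_comp _ _ _ (fun p : R * R => p.1) (fun t => Gam t i j)).
    exact: cvg_fst.
  exact: (curve_cont hGam in0).
have cF : mxK (fun f : R * R -> R => {for (0, 0), continuous f}) F.
  apply: (mxKM KA); last by apply: (lam_falg KA); exact: cvg_snd.
  apply: (mxKM KA); first exact: (mxK_cst KA).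
  exact: (mxK_poly_Pi KA).
have nl : \forall p \near ((0, 0) : R * R), forall i, c < lead i (F p).
  apply: (@filter_forall _ _ (fun i (p : R * R) => c < lead i (F p)) _ (nbhs_filter _)) => i.
  by apply: (cvgr_gt _ (falg_minor KA _ _ cF)); rewrite /F /= lam0 mulmx1 M0; exact: cP.
have [d /= d0 dP] := (nbhs_ballP _ _).1 nl; exists d => // t s td sd i.
by apply/ltW/(dP (t, s)); split; rewrite -ball_normE /ball_ /= sub0r normrN.
Qed.

Let ae_der r : 0 < r < eps ->
  (@lebesgue_measure R).-negligible (~` [set t | - r < t < r -> derivable Gam t 1]).
Proof.
move=> /andP[r0 re].
have H i j : {ae (@lebesgue_measure R), forall t, - r < t < r -> derivable (fun t => Gam t i j) t 1}.
  have [g [_ _ h]] : exists g, FTC_on (fun t => Gam t i j) (- r) r g.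
    apply: (AC_FTC (curve_AC hGam i j).1) => //; first by rewrite ltrN2.
    by rewrite (lt_trans _ r0)// oppr_lt0.
  have F := ae_filter_ringOfSetsType (@lebesgue_measure R).
  by apply: filterS h => t h /h[].
have F := ae_filter_ringOfSetsType (@lebesgue_measure R).
have : {ae (@lebesgue_measure R), forall t, forall i j, - r < t < r -> derivable (fun t => Gam t i j) t 1}.
  apply: (filter_forall F) => i; apply: (filter_forall F) => j; exact: H.
by apply: filterS => t h ht; apply/derivable_mxP => i j; exact: h.
Qed.

Let flow : exists2 k, 0 < k < eps & forall t s, 0 <= t <= k -> 0 <= s <= k ->
  [/\ forall i, 0 < lead i (M t *m lam n s) & 0 < t \/ 0 < s -> tpos (lowf (M t *m lam n s))].
Proof.
have [c c0 [d d0 cP]] := near_lead.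
pose r := Num.min d eps / 2.
have m0 : 0 < Num.min d eps by rewrite lt_min d0.
have r0 : 0 < r by rewrite divr_gt0.
have rm : r < Num.min d eps by rewrite ltr_pdivrMr// ltr_pMr// ltr1n.
have [rd re] : r < d /\ r < eps by apply/andP; rewrite -lt_min.
have norm_lt t : - r < t < r -> `|t| < d by move=> h; rewrite (lt_trans _ rd)// ltr_norml.
have lead1 t : - r < t < r -> forall i, c <= lead i (M t).
  move=> ht i; have := cP t 0 (norm_lt _ ht); rewrite normr0 => /(_ d0 i).
  by rewrite lam0 mulmx1.
have AC1 : mxK (bounded_AC (- r) r) M.
  have KA := bounded_AC_falg (- r) r.
  apply: (mxKM KA); first exact: (mxK_cst KA).
  apply: (mxK_poly_Pi KA) => i j; have [h1 [C h2]] := curve_AC hGam i j; split.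
    by apply: abs_continuous_sub h1; rewrite ?lerN2 ltW.
  exists C => t /andP[t1 t2]; apply: h2.
  by rewrite (lt_trans _ t1) ?ltrN2// (lt_trans t2).
pose E := ~` [set t | - r < t < r -> derivable Gam t 1].
have E0 : (@lebesgue_measure R).-negligible E by apply: ae_der; rewrite r0.
have der1 t : - r < t < r -> ~ E t -> exists Lam : 'M[R]_m,
  [/\ mxder t M (M t *m Lam), forall i j : 'I_m, (j.+1 < i)%N -> Lam i j = 0 &
      forall i j : 'I_m, i = j.+1 :> nat -> 0 < Lam i j].
  move=> ht /contrapT/(_ ht) dG; have [t1 t2] := andP ht.
  have te : - eps < t < eps by rewrite (lt_trans _ t1) ?ltrN2// (lt_trans t2).
  have [S [h1 h2 h3]] := curve_der_Pi hGam te dG; exists S; split => //.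
  have := mxderM (mxder_cst t (V *m (Pi (Gam 0))^T)) h1.
  by rewrite mul0mx add0r mulmxA.
have nr0 : - r < 0 by rewrite oppr_lt0.
have tnn0 : tnn (lowf (M 0)) by rewrite M0 lowf_posup//; exact: tnn1.
have tn t := flow_tnn AC1 c0 lead1 E0 der1 nr0 tnn0 (t := t).
have tp t := flow_tpos AC1 c0 lead1 E0 der1 nr0 tnn0 (t := t).
exists (r / 2); first by rewrite divr_gt0//= (lt_trans _ re)// ltr_pdivrMr// ltr_pMr// ltr1n.
have r2 : r / 2 < r by rewrite ltr_pdivrMr// ltr_pMr// ltr1n.
have in_r t : 0 <= t <= r / 2 -> - r < t < r.
  by move=> /andP[t0 tr]; rewrite (lt_le_trans nr0)// (le_lt_trans tr).
move=> t s ht hs; have [tr sr] := (in_r _ ht, in_r _ hs).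
split; first by move=> i; apply: lt_le_trans c0 (cP _ _ (norm_lt _ tr) (norm_lt _ sr) i).
have /andP[_ tr2] := tr; have /andP[_ sr2] := sr.
have /andP[t0 _] := ht; have /andP[s0 _] := hs.
move=> ts; have [s0'|] := boolP (0 < s); last first.
  move=> ns; have s00 : s = 0 by apply/eqP; rewrite eq_le s0 andbT leNgt.
  rewrite s00 lam0 mulmx1; apply: tp tr2; case: ts => //.
  by rewrite s00 ltxx.
pose W u := M t *m lam n u.
have AC2 : mxK (bounded_AC (- r) r) W.
  have KA := bounded_AC_falg (- r) r.
  by apply: (mxKM KA); [exact: (mxK_cst KA)|apply: (lam_falg KA); exact: bounded_AC_id].
have lead2 u : - r < u < r -> forall i, c <= lead i (W u).
  by move=> hu i; apply: cP; exact: norm_lt.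
have der2 u : - r < u < r -> ~ set0 u -> exists Lam : 'M[R]_m,
  [/\ mxder u W (W u *m Lam), forall i j : 'I_m, (j.+1 < i)%N -> Lam i j = 0 &
      forall i j : 'I_m, i = j.+1 :> nat -> 0 < Lam i j].
  move=> _ _; exists (subdiag R n); split.
  - have := mxderM (mxder_cst u (M t)) (mxder_lam (n := n) u).
    by rewrite mul0mx add0r mulmxA.
  - by move=> i j ij; rewrite mxE gtn_eqF.
  - by move=> i j ij; rewrite mxE ij eqxx.
have tnnW : tnn (lowf (W 0)) by rewrite /W lam0 mulmx1; exact: tn.
exact: (flow_tpos AC2 c0 lead2 (negligible_set0 _) der2 nr0 tnnW s0' sr2).
Qed.

(** Two paths in the open cells: from z tau d to Gam t tau d along the curve, then to
    Gam t along the probe. *)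
Lemma curve_open_cell : exists2 d, 0 < d < eps & forall t, 0 < t <= d ->
  connected_component (Spin_over (signed e)) y0 (Gam t).
Proof.
have [k /andP[k0 ke] kP] := flow; have [dt dt0 dtP] := tau_liftable R n.
have [dg dg0 dgP] := gz.
pose d := Num.min k (Num.min dt dg).
have d0 : 0 < d by rewrite !lt_min k0 dt0 dg0.
have dk : d <= k by rewrite ge_min lexx.
have ddt : d <= dt by rewrite !ge_min lexx orbT.
have ddg : d <= dg by rewrite !ge_min lexx !orbT.
have sgn t s : 0 <= t <= d -> 0 <= s <= d -> 0 < t \/ 0 < s ->
    signed e (Pi (Gam t) *m lam n s).
  move=> ht hs ts; have [/andP[t0 td] /andP[s0 sd]] := (ht, hs).
  have te : - eps < t < eps.
    by rewrite (lt_le_trans _ t0) ?oppr_lt0// (le_lt_trans td)// (le_lt_trans dk).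
  have [] := kP t s; rewrite ?t0 ?s0 ?(le_trans td) ?(le_trans sd)// => ld /(_ ts) tp.
  have [_ hX FE] := lead_gt0_LU ld.
  set L := lowf _ in tp hX FE; set X := \adj L *m _ in hX FE.
  have -> : Pi (Gam t) *m lam n s = U *m (D *m (Q *m L)) *m X.
    have -> : U *m (D *m (Q *m L)) *m X = U *m (D *m Q) *m (L *m X) by rewrite !mulmxA.
    rewrite -FE /M (poly_PiE (GS te)) !(mulmxA (U *m (D *m Q))) -zE.
    by have [zz _] := Pi_SO (GS in0); rewrite zz mul1mx.
  move=> i; have [c c0 ->] := sw_posup i (D *m (Q *m L)) hU hX.
  rewrite -mulrA mulr_gt0//; apply: signed_diag => // a.
  exact: bottom_nonneg_sw.
exists d; first by rewrite d0 (le_lt_trans dk).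
move=> t /andP[t0 td].
have dd : 0 < d <= dg by rewrite d0.
have c1 := dgP d dd.
have h0 : (0 : R) <= (0 : R) <= t by rewrite lexx ltW.
have ht : 0 <= t <= t by rewrite lexx ltW.
have ld : liftable (lam n d) by apply: dtP; rewrite (ltW d0).
have in_eps u : 0 <= u <= d -> - eps < u < eps.
  move=> /andP[u0 ud].
  by rewrite (lt_le_trans _ u0) ?oppr_lt0// (le_lt_trans ud)// (le_lt_trans dk).
have c2 : connected_component (Spin_over (signed e)) (Gam 0 * tau n d) (Gam t * tau n d).
  apply: (path_component (f := fun u => Gam u * tau n d) _ _ h0 ht) => u /andP[u0 ut].
    have KA := @continuous_falg R R u.
    apply: (mxK_mul KA); last exact: (mxK_cst KA).
    by apply: (curve_cont hGam); apply: in_eps; rewrite u0 (le_trans ut).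
  have ud : 0 <= u <= d by rewrite u0 (le_trans ut).
  apply: over_tau => //; first exact/GS/in_eps.
  by apply: sgn => //; [rewrite (ltW d0) lexx|right].
have hd0 : (0 : R) <= (0 : R) <= d by rewrite lexx ltW.
have hdd : 0 <= d <= d by rewrite lexx ltW.
have htd : 0 <= t <= d by rewrite (ltW t0).
have H s : 0 <= s <= d -> liftable (lam n s) /\ signed e (Pi (Gam t) *m lam n s).
  move=> hs; split; last by apply: sgn => //; left.
  by have /andP[s0 sd] := hs; apply: dtP; rewrite s0 (le_trans sd).
have c3 := tau_path (GS (in_eps t htd)) H hdd hd0.
rewrite tau0 mulr1 in c3.
exact: (connected_component_trans c1 (connected_component_trans c2 c3)).
Qed.

End CurveGerm.

(** * Time reversal *)

Section AlternatingConjugation.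
Variables (R : realType) (n : nat).
Notation m := n.+1.
Notation Cl := (Clifford R m).
Notation Pi := (@Pi R m).
Notation gamma := (@gamma R m).
Implicit Types (x y z : Cl) (i j k : 'I_m) (P Q : 'M[R]_m).

Let chi (B : {set 'I_m}) : R := \prod_(k in B) (-1) ^+ k.

Let chi_sqr B : chi B * chi B = 1.
Proof. by rewrite /chi -big_split big1//= => k _; rewrite -expr2 sqrr_sign. Qed.

Let chi_U1 i (B : {set 'I_m}) : i \notin B -> chi (i |: B) = (-1) ^+ i * chi B.
Proof. by move=> iB; rewrite /chi finset.big_setU1. Qed.

Let T : Cl := diag_mx (\row_a chi (enum_val a)).

Let TT : T * T = 1.
Proof.
rewrite -mulmxE /T mulmx_diag -idmxE -diag_const_mx; congr diag_mx.
by apply/rowP => a; rewrite !mxE chi_sqr.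
Qed.

(** The automorphism of the Clifford algebra with e_i |-> (-1)^i e_i. *)
Definition alt x : Cl := T * x * T.

Lemma altE x a b : alt x a b = chi (enum_val a) * chi (enum_val b) * x a b.
Proof. by rewrite /alt -!mulmxE mul_mx_diag mul_diag_mx !mxE mulrAC. Qed.

Lemma alt_gamma i : alt (gamma i) = (-1) ^+ i *: gamma i.
Proof.
apply/matrixP => a b; rewrite altE !mxE /=.
case: ifP => [/eqP->|_]; last by rewrite !mulr0.
set B := enum_val b; rewrite [LHS]mulrC [RHS]mulrC; congr (_ * _).
have [iB|iB] := boolP (i \in B); last by rewrite chi_U1// -mulrA chi_sqr mulr1.
rewrite -[X in _ * chi X](finset.setD1K iB) chi_U1 ?inE ?eqxx//.
by rewrite mulrCA chi_sqr mulr1.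
Qed.

Lemma altM x y : alt (x * y) = alt x * alt y.
Proof. by rewrite /alt -!mulrA (mulrA T T) TT mul1r. Qed.

Lemma altK x : alt (alt x) = x.
Proof. by rewrite /alt !mulrA TT mul1r -mulrA TT mulr1. Qed.

Lemma alt1 : alt 1 = 1. Proof. by rewrite /alt mulr1 TT. Qed.

Lemma altD x y : alt (x + y) = alt x + alt y.
Proof. by rewrite /alt mulrDr mulrDl. Qed.

Lemma altZ (c : R) x : alt (c *: x) = c *: alt x.
Proof. by rewrite /alt clAr clAl. Qed.

Lemma altN x : alt (- x) = - alt x.
Proof. by rewrite -scaleN1r altZ scaleN1r. Qed.

Lemma altB x y : alt (x - y) = alt x - alt y.
Proof. by rewrite altD altN. Qed.

Lemma alt0 : alt 0 = 0. Proof. by rewrite /alt mulr0 mul0r. Qed.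

Lemma alt_sum (I : Type) (r : seq I) (F : I -> Cl) :
  alt (\sum_(i <- r) F i) = \sum_(i <- r) alt (F i).
Proof. exact: (big_morph alt altD alt0). Qed.

Lemma alt_prod (I : Type) (r : seq I) (F : I -> Cl) :
  alt (\prod_(i <- r) F i) = \prod_(i <- r) alt (F i).
Proof. exact: (big_morph alt altM alt1). Qed.

Lemma alt_tr x : (alt x)^T = alt x^T.
Proof. by apply/matrixP => a b; rewrite mxE !altE mxE [chi _ * chi (enum_val b)]mulrC. Qed.

Let altv (v : 'rV[R]_m) : 'rV[R]_m := \row_i ((-1) ^+ i * v 0 i).

Lemma alt_Spin z : Spin z -> Spin (alt z).
Proof.
move=> [vs [ev uv ->]]; exists (map altv vs); split; first by rewrite size_map.
  move=> _ /mapP[v vvs ->]; rewrite -[RHS](uv v vvs); apply: eq_bigr => i _.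
  by rewrite mxE exprMn sqrr_sign mul1r.
rewrite alt_prod big_map; apply: eq_bigr => v _; rewrite !cl_vecE alt_sum.
by apply: eq_bigr => i _; rewrite altZ alt_gamma scalerA mxE mulrC.
Qed.

Definition altmx P : 'M[R]_m := \matrix_(i, j) ((-1) ^+ i * (-1) ^+ j * P i j).

Lemma Pi_alt z : Spin z -> Pi (alt z) = altmx (Pi z).
Proof.
move=> hz; apply: isPi_Pi; first exact/Spin_unit/alt_Spin.
move=> j; have e : gamma j = (-1) ^+ j *: alt (gamma j).
  by rewrite alt_gamma scalerA -expr2 sqrr_sign scale1r.
rewrite e clAr -altM (Pi_isPi hz) altM alt_sum -clAl scaler_sumr; congr (_ * _).
by apply: eq_bigr => i _; rewrite altZ alt_gamma !scalerA mxE; congr (_ *: _); ring.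
Qed.

Lemma altmxM P Q : altmx (P *m Q) = altmx P *m altmx Q.
Proof.
apply/matrixP => i j; rewrite !mxE mulr_sumr; apply: eq_bigr => k _; rewrite !mxE.
transitivity ((-1) ^+ i * (-1) ^+ j * (P i k * Q k j) * ((-1) ^+ k) ^+ 2); last by ring.
by rewrite sqrr_sign mulr1.
Qed.

Lemma altmx_posup P : posup P -> posup (altmx P).
Proof.
move=> [p1 p2]; split => [i j ji|i]; rewrite mxE; first by rewrite p1// mulr0.
by rewrite -expr2 sqrr_sign mul1r.
Qed.

Lemma altmx_smx P s : smx P s -> smx (altmx P) s.
Proof.
move=> hP; apply: smxP => [i k|i]; rewrite !mxE.
  rewrite (smxE _ _ hP); have [->|_] := eqVneq k (s i); last by rewrite !mulr0.
  by rewrite !mulr1.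
by rewrite !exprMn !sqrr_sign (smx_sqr _ hP) !mulr1.
Qed.

Lemma mxK_alt (X : Type) (K : (X -> R) -> Prop) (F : X -> Cl) : funalg K -> mxK K F ->
  mxK K (fun u => alt (F u)).
Proof.
move=> KA KF; apply: (mxK_mul KA); last exact: (mxK_cst KA).
by apply: (mxK_mul KA) => //; exact: (mxK_cst KA).
Qed.

(** On the matrix side the automorphism is conjugation by the diagonal matrix
    of the signs (-1)^i, which preserves the positive triangular group. *)
Lemma alt_Bru z0 z : Spin z0 -> Bru z0 z -> Bru (alt z0) (alt z).
Proof.
move=> hz0 /Bru_component[C [C0 CA cC] Cz]; apply/Bru_component; exists (alt @` C); last by exists z.
split; first by exists z0.
  move=> _ [y /CA[hy [U [V [hU hV yE]]]] <-]; split; first exact: alt_Spin.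
  exists (altmx U), (altmx V); rewrite !Pi_alt// yE !altmxM.
  by split => //; exact: altmx_posup.
apply: connected_continuous_connected => //; apply: continuous_subspaceT => y.
apply: mx_continuous; apply: (@mxK_alt _ _ id (@continuous_falg R Cl y)).
by move=> a b; exact: coord_continuous.
Qed.

Lemma grave_gen_tr (j : 'I_n) : grave_gen R j = (acute_gen R j)^T.
Proof. by rewrite /grave_gen Spin_inv//; exact: acute_gen_Spin. Qed.

(** The signs of lo j and hi j are opposite. *)
Lemma alt_plane (j : 'I_n) :
  alt (gamma (lo j) * gamma (hi j)) = - (gamma (lo j) * gamma (hi j)).
Proof.
rewrite altM !alt_gamma clAl clAr scalerA hiE exprS mulrCA -expr2 sqrr_sign.
by rewrite mulr1 scaleN1r.
Qed.

Lemma alt_acute (j : 'I_n) : alt (acute_gen R j) = grave_gen R j.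
Proof.
have hl : hi j != lo j by rewrite eq_sym lo_neq_hi.
rewrite grave_gen_tr acute_genE /spin_planar altD altZ alt_plane.
rewrite -[(cos _)%:M]scalemx1 altZ idmxE alt1 -idmxE linearD /= !linearZ /= trmx1 trM !gamma_tr mulrNN.
by rewrite (gamma_anti R hl).
Qed.

Lemma alt_norm x : `|alt x| = `|x|.
Proof.
rewrite [LHS]/Num.Def.normr [RHS]/Num.Def.normr /= !mx_normrE; apply: eq_bigr => -[a b] _.
rewrite altE !normrM.
have c1 B : `|chi B| = 1.
  by apply/eqP; rewrite -sqrp_eq1// real_normK ?num_real// expr2 chi_sqr.
by rewrite !c1 !mul1r.
Qed.

Lemma der_neg (t : R) f df : der t f df -> der (- t) (fun u => f (- u)) (- df).
Proof.
move=> h; have hN : is_derive (- t) 1 (fun u : R => - u) (-1).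
  by have := is_deriveN (is_derive_id (- t) (1 : R)).
have := @is_derive1_comp R f (fun u => - u) (- t) df (-1).
by rewrite opprK mulrN1 /der; apply.
Qed.

(** Reversing time and conjugating both change the sign of the logarithmic
    derivative. *)
Lemma alt_curve eps (Gam : R -> Cl) : locally_convex_curve (- eps) eps Gam ->
  locally_convex_curve (- eps) eps (fun t => alt (Gam (- t))).
Proof.
move=> [hS hA hd].
have neg t : - eps < t < eps -> - eps < - t < eps.
  by move=> /andP[a b]; rewrite ltrN2 b ltrNl a.
split.
- by move=> t /neg/hS; exact: alt_Spin.
- move=> e /hA[d d0 H]; exists d => // N l r lr tr sd.
  rewrite (eq_bigr (fun k : 'I_N => `|Gam (- l k) - Gam (- r k)|)); last first.
    by move=> k _; rewrite -altB alt_norm distrC.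
  apply: (H N (fun k : 'I_N => - r k) (fun k : 'I_N => - l k)); last first.
  - by rewrite (eq_bigr (fun k : 'I_N => r k - l k))// => k _; rewrite opprK addrC.
  - move=> i j _ _ [u [/= ]]; rewrite !in_itv /= => hi hj.
    apply: tr => //; exists (- u); split; rewrite /= in_itv /=;
      [move: hi|move: hj]; by rewrite ltrNl ltrNr andbC.
  by move=> k; have [h1 h2 h3] := lr k; rewrite ltrN2 lerN2 ltrNl.
move=> t ht dt; have ht' := neg t ht.
have [dF hdF] := mxder_derivable ((derivable_mxP _ _ _).1 dt).
have hG : mxder (- t) Gam (- alt dF).
  move=> a b; have := derM (der_cst (- t) (chi (enum_val a) * chi (enum_val b))) (der_neg (hdF a b)).
  rewrite mul0r add0r [(- alt dF) a b]mxE altE -mulrN.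
  by apply: der_ext => u; rewrite altE opprK mulrA mulrACA !chi_sqr !mul1r.
have dG : derivable Gam (- t) 1 by apply/derivable_mxP => a b; have [] := hG a b.
have dGE : derive1 Gam (- t) = - alt dF.
  by apply/matrixP => a b; rewrite derive1E (derive_mx dG) mxE; have [_ e] := hG a b; exact: e.
have dE : derive1 (fun t => alt (Gam (- t))) t = dF.
  by apply/matrixP => a b; rewrite derive1E (derive_mx dt) mxE; have [_ e] := hdF a b; exact: e.
have [kap kap0 E] := hd _ ht' dG; exists kap => //.
rewrite dE; have hGt := hS _ ht'.
rewrite Spin_inv ?alt_tr; last exact: alt_Spin.
have -> : dF = - alt (derive1 Gam (- t)) by rewrite dGE altN altK opprK.
rewrite mulmxE mulrN -altM -(Spin_inv hGt) -mulmxE E alt_sum -sumrN; apply: eq_bigr => j _.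
by rewrite altZ spin_lie_so_basis altZ alt_plane !scalerN opprK.
Qed.

End AlternatingConjugation.

(** * Advancing and chopping *)

Section Assembly.
Variables (R : realType) (n : nat).
Notation m := n.+1.
Notation Cl := (Clifford R m).
Notation Pi := (@Pi R m).
Implicit Types (z q : Cl) (s : 'S_m) (w : seq 'I_n).

Lemma diag_neq0 q : Spin q -> is_diag_mx (Pi q) -> forall i, Pi q i i != 0.
Proof.
move=> hq dq; have [_ d1] := Pi_SO hq.
have up : upper (Pi q) by move=> i j ji; apply: (is_diag_mxP dq); rewrite gtn_eqF.
move=> i; have : \prod_i Pi q i i != 0 by rewrite -det_upper// d1 oner_neq0.
by move=> /prodf_neq0/(_ i isT).
Qed.

(** Also applied, with time reversed, to the images of the curve and of z0 under
    the alternating automorphism. *)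
Lemma curve_adv eps (Gam : R -> Cl) z0 q s w w' :
  0 < eps -> locally_convex_curve (- eps) eps Gam -> Quat q ->
  ascending 1%g w -> ascending 1%g w' -> (\prod_(j <- w') gen j)%g = eta n ->
  z0 = q * \prod_(j <- w) acute_gen R j -> smx (Pi z0) s -> Spin z0 -> Bru z0 (Gam 0) ->
  exists2 d, 0 < d < eps & forall t, 0 < t <= d ->
    Bru (q * \prod_(j <- w') acute_gen R j) (Gam t).
Proof.
move=> e0 hG [hq [_ dq]] aw aw' we z0E hs hz0 bz.
have uD := diag_neq0 hq dq.
have [hy0 [sy0 [Q [z0Q uQ nQ] g0]]] := germ_word dq uD hq erefl aw aw' we.
rewrite -z0E in z0Q g0.
have gz := germ_Bru hs hz0 bz g0.
have [_ [U [V [hU hV zE]]]] := connected_component_sub ((Bru_component z0 (Gam 0)).1 bz).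
rewrite z0Q in zE.
have [d dd H] := curve_open_cell e0 hG dq uD uQ nQ hU hV zE gz.
exists d => // t ht; apply/Bru_component.
by apply: component_sub (H t ht) => y [hy]; rewrite (signed_dc sy0).
Qed.

Lemma Spin_word w : Spin (\prod_(j <- w) acute_gen R j).
Proof.
elim: w => [|j w IH]; first by rewrite big_nil; exact: Spin1.
by rewrite big_cons; apply: SpinM => //; exact: acute_gen_Spin.
Qed.

Lemma smx_word w : smx (Pi (\prod_(j <- w) acute_gen R j)) (\prod_(j <- w) gen j)%g.
Proof.
elim: w => [|j w IH]; first by rewrite !big_nil Pi1; exact: smx1.
rewrite !big_cons PiM; [|exact: acute_gen_Spin|exact: Spin_word].
by apply: smxM => //; rewrite Pi_acute_gen; exact: smx_rot.
Qed.

Lemma smx_diag (P : 'M[R]_m) : smx P 1%g -> is_diag_mx P.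
Proof.
move=> hP; apply/is_diag_mxP => i j ij; rewrite (smxE _ _ hP) perm1.
by rewrite eq_sym -val_eqE /= (negbTE ij) mulr0.
Qed.

Lemma smx_tr (P : 'M[R]_m) s : smx P s -> smx P^T (s^-1)%g.
Proof.
move=> hP; apply: smxP => [i k|i]; rewrite !mxE; last by rewrite -{2}(permKV s i) (smx_sqr _ hP).
have [->|ki] := eqVneq k ((s^-1)%g i); first by rewrite mulr1.
have sk : (i == s k) = false by apply: contra_neqF ki => /eqP->; rewrite permK.
by rewrite mulr0 (smxE k i hP) sk mulr0.
Qed.

(** Dividing out the word leaves a signed permutation matrix of the identity
    permutation. *)
Lemma Quat_factor z0 s w : Spin z0 -> smx (Pi z0) s -> (\prod_(j <- w) gen j)%g = s ->
  exists q, Quat q /\ z0 = q * \prod_(j <- w) acute_gen R j.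
Proof.
move=> hz0 hs ws; pose a := \prod_(j <- w) acute_gen R j.
have ha : Spin a := Spin_word w; have hat := Spin_tr ha.
have hq : Spin (z0 * a^T) by exact: SpinM.
have sq : smx (Pi (z0 * a^T)) 1%g.
  rewrite PiM// Pi_tr// -(mulgV s); apply: smxM => //; apply: smx_tr.
  by rewrite -ws; exact: smx_word.
exists (z0 * a^T); split; last by rewrite -mulrA orthC ?mulr1//; exact: Spin_orth.
split => //; split; last exact: smx_diag.
by split; [exists 1%g|have [] := Pi_SO hq].
Qed.

Lemma alt_Quat q : Quat q -> Quat (alt q).
Proof.
move=> [hq [[[s hs] _] dq]]; have ha := alt_Spin hq; split => //.
rewrite /preimage /= Pi_alt//; split; last first.
  by apply/is_diag_mxP => i j ij; rewrite mxE (is_diag_mxP dq)// mulr0.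
split; first by exists s; exact: altmx_smx.
by rewrite -Pi_alt//; have [] := Pi_SO ha.
Qed.

Lemma alt_word w : alt (\prod_(j <- w) acute_gen R j) = \prod_(j <- w) grave_gen R j.
Proof. by rewrite alt_prod; apply: eq_bigr => j _; rewrite alt_acute. Qed.

Lemma alt_grave w : alt (\prod_(j <- w) grave_gen R j) = \prod_(j <- w) acute_gen R j.
Proof. by rewrite -alt_word altK. Qed.

End Assembly.

Theorem theorem3 (R : realType) (n : nat) (hn : (2 <= n)%N)
    (z : Clifford R n.+1) (hz : Spin z) (eps : R) (heps : 0 < eps)
    (Gam : R -> Clifford R n.+1) (hGam : locally_convex_curve (- eps) eps Gam)
    (hGam0 : Gam 0 = z) :
  (exists2 epsa : R, 0 < epsa < eps &
     forall t : R, 0 < t <= epsa -> Bru (adv z) (Gam t)) /\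
  (exists2 epsc : R, 0 < epsc < eps &
     forall t : R, - epsc <= t < 0 -> Bru (chop z) (Gam t)).
Proof.
have [c0 bz] : tBplus (cell_of z) /\ Bru (cell_of z) z by exact: xgetPex (cell_exists hz).
rewrite /adv /chop; set z0 := cell_of z in c0 bz *.
have [hz0 [[s0 hs0] _]] := c0.
have hs : smx (Pi z0) (sigma_of z0).
  exact: (xgetPex _ (ex_intro [set s | sgnperm (Pi z0) s] s0 hs0)).
set s := sigma_of z0 in hs *.
have [rs _] := some_reduced_wordP s; have [re _] := some_reduced_wordP (eta n).
have aw := reduced_ascending (some_reduced_wordP s).
have aw' := reduced_ascending (some_reduced_wordP (eta n)).
split.
- rewrite /acute; set q := xget _ _.
  have [hq z0E] : Quat q /\ z0 = q * \prod_(j <- some_reduced_word s) acute_gen R j.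
    exact: (xgetPex _ (Quat_factor hz0 hs (esym rs))).
  rewrite -hGam0 in bz.
  exact: (curve_adv heps hGam hq aw aw' (esym re) z0E hs hz0 bz).
- rewrite /grave; set q := xget _ _.
  have haz0 := alt_Spin hz0.
  have has : smx (Pi (alt z0)) s by rewrite Pi_alt//; exact: altmx_smx.
  have [hq z0E] : Quat q /\ z0 = q * \prod_(j <- some_reduced_word s) grave_gen R j.
    have [q' [hq' e]] := Quat_factor haz0 has (esym rs).
    have ex : exists q0, Quat q0 /\ z0 = q0 * \prod_(j <- some_reduced_word s) grave_gen R j.
      exists (alt q'); split; first exact: alt_Quat.
      by rewrite -alt_word -altM -e altK.
    exact: (xgetPex _ ex).
  have az0E : alt z0 = alt q * \prod_(j <- some_reduced_word s) acute_gen R j.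
    by rewrite z0E altM alt_grave.
  have abz : Bru (alt z0) (alt (Gam (- 0))) by rewrite oppr0 hGam0; exact: alt_Bru.
  have [d dd H] := curve_adv heps (alt_curve hGam) (alt_Quat hq) aw aw' (esym re) az0E has haz0 abz.
  exists d => // t /andP[t1 t2].
  have ht : 0 < - t <= d by rewrite oppr_gt0 t2 lerNl.
  have hy : Spin (alt q * \prod_(j <- some_reduced_word (eta n)) acute_gen R j).
    by apply: SpinM; [apply: alt_Spin; have [] := hq|exact: Spin_word].
  by have := alt_Bru hy (H _ ht); rewrite altM !altK alt_word opprK.
Qed.
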